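(* Let $M^7$ be a $7$-manifold with a closed and co-closed $G_2$-form $\varphi$ and with $b_1(M)=0$, and suppose the torus $T^3$ acts on $M$ preserving $\varphi$. Let $X_1,X_2,X_3$ be the vector fields on $M$ induced by a basis of the Lie algebra of $T^3$. Then the $1$-forms $$\sigma_1=i_{X_2}i_{X_3}\varphi,\quad \sigma_2=i_{X_3}i_{X_1}\varphi,\quad \sigma_3=i_{X_1}i_{X_2}\varphi$$ satisfy $\sigma_i=df_i$ for some $T^3$-invariant functions $f_1,f_2,f_3$ on $M$, and every common level set $L=\{f_1=c_1,\ f_2=c_2,\ f_3=c_3\}$ is, near each point $m\in L$ that is a regular point of the $T^3$-action, a smooth coassociative submanifold of $M$. (Thus $M$ is covered by the pairwise disjoint level sets $L$, which are coassociative at regular points.)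
   Context: A $G_2$-form on a $7$-manifold $M$ is a $3$-form $\varphi$ such that for each $m\in M$ there is a linear isomorphism $T_mM\cong\mathbb{R}^7$ identifying $\varphi$ with the standard $G_2$ $3$-form $\varphi_0$ on $\mathbb{R}^7$; it determines a metric and orientation. If $\varphi$ is closed and co-closed it is parallel, the holonomy of $M$ is contained in $G_2$, and $*\varphi$ is a calibration. A $4$-dimensional submanifold $L$ is coassociative if it is calibrated by $*\varphi$ (for a suitable orientation), equivalently $\varphi|_L=0$. A point $m$ is a regular point of the action if the differential of the action is injective at $m$, i.e. $X_1,X_2,X_3$ are linearly independent at $m$. It is assumed that no nontrivial element of the torus acts trivially. *)

(* Defs.v *)
From HB Require Import structures.
From mathcomp Require Import all_boot all_order all_algebra.
From mathcomp Require Import all_classical all_reals all_analysis.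

Set Implicit Arguments.
Unset Strict Implicit.
Unset Printing Implicit Defensive.

Import Order.TTheory GRing.Theory Num.Theory.
Import numFieldNormedType.Exports.
Local Open Scope classical_set_scope.
Local Open Scope ring_scope.

(* C^k and C^oo maps on an open subset U of a finite-dimensional space V:
   all iterated directional derivatives of order <= k exist and are
   continuous.  The values of f outside U play no role. *)
Fixpoint Ck_on (R : realType) (V W : normedModType R) (k : nat)
    (U : set V) (f : V -> W) : Prop :=
  (forall x, U x -> {for x, continuous f}) /\
  (if k is k'.+1 then
     forall v : V, (forall x, U x -> derivable f x v) /\ Ck_on k' U ('D_v f)
   else True).

Definition smooth_on (R : realType) (V W : normedModType R)
    (U : set V) (f : V -> W) : Prop := forall k, Ck_on k U f.

(* A homeomorphism from the open set cdom of M onto the open set ccod of R^n;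
   cfun and cinv are meaningful only on cdom and ccod respectively. *)
Record chart (R : realType) (n : nat) (M : topologicalType) := Chart {
  cdom : set M;
  ccod : set 'rV[R]_n;
  cfun :> M -> 'rV[R]_n;
  cinv : 'rV[R]_n -> M;
  cdom_open : open cdom;
  ccod_open : open ccod;
  cfun_cod : forall m, cdom m -> ccod (cfun m);
  cinv_dom : forall x, ccod x -> cdom (cinv x);
  cfunK : forall m, cdom m -> cinv (cfun m) = m;
  cinvK : forall x, ccod x -> cfun (cinv x) = x;
  cfun_continuous : forall m, cdom m -> {for m, continuous cfun};
  cinv_continuous : forall x, ccod x -> {for x, continuous cinv} }.

Definition compatible (R : realType) (n : nat) (M : topologicalType)
    (c c' : chart R n M) : Prop :=
  smooth_on [set x | ccod c x /\ cdom c' (cinv c x)] (c' \o cinv c) /\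
  smooth_on [set x | ccod c' x /\ cdom c (cinv c' x)] (c \o cinv c').

(* A smooth manifold is given by an atlas, not necessarily maximal. *)
Record smooth_manifold (R : realType) (n : nat) := SmoothManifold {
  carrier :> topologicalType;
  man_hausdorff : hausdorff_space carrier;
  man_second_countable : @second_countable carrier;
  idx : Type;
  atlas : idx -> chart R n carrier;
  atlas_cover : forall m, exists c, cdom (atlas c) m;
  atlas_compatible : forall c c', compatible (atlas c) (atlas c') }.

Section Forms.
Context (R : realType) (n : nat) (M : smooth_manifold R n).
Local Notation E := 'rV[R]_n.

(* A tangent vector at m is represented, in each chart c around m, by a vector
   of R^n; a field of k-covectors w is represented by its coordinate
   expressions: w c x v is its value at the point x = c(m) of the image of c, on
   the vectors with coordinates v_0, ..., v_(k-1). *)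
Definition coord_form (k : nat) := idx M -> E -> ('I_k -> E) -> R.

Definition replace (k : nat) (v : 'I_k -> E) (i : 'I_k) (u : E) : 'I_k -> E :=
  fun j => if j == i then u else v j.

(* f^* w = w, for a self-map f of M *)
Definition preserves (k : nat) (f : M -> M) (w : coord_form k) : Prop :=
  forall c c' m, cdom (atlas c) m -> cdom (atlas c') (f m) ->
  forall v : 'I_k -> E,
    w c (atlas c m) v =
    w c' (atlas c' (f m))
      (fun i => 'D_(v i) (atlas c' \o f \o cinv (atlas c)) (atlas c m)).

(* differential k-forms; form_glue is the change-of-chart rule *)
Record smooth_form (k : nat) (w : coord_form k) : Prop := SmoothForm {
  form_linear : forall c x, ccod (atlas c) x ->
    forall (v : 'I_k -> E) (i : 'I_k) (a : R) (u u' : E),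
      w c x (replace v i (a *: u + u')) =
      a * w c x (replace v i u) + w c x (replace v i u');
  form_alternating : forall c x, ccod (atlas c) x ->
    forall (v : 'I_k -> E) (i j : 'I_k), i != j -> v i = v j -> w c x v = 0;
  form_smooth : forall c (v : 'I_k -> E),
    smooth_on (ccod (atlas c)) (fun x => w c x v : R^o);
  form_glue : preserves id w }.

(* (dw)(v_0, ..., v_k) = \sum_i (-1)^i D_(v_i) w(v_0, .., ^v_i, .., v_k)
   for constant vector fields v_i on R^n *)
Definition ext_d (k : nat) (w : coord_form k) : coord_form k.+1 :=
  fun c x v => \sum_(i < k.+1)
    (-1) ^+ i * 'D_(v i) (fun y => w c y (fun j => v (lift i j)) : R^o) x.

Definition closed_form (k : nat) (w : coord_form k) : Prop :=
  forall c x, ccod (atlas c) x -> forall v, ext_d w c x v = 0.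

Definition smooth_fun (f : M -> R) : Prop :=
  forall c, smooth_on (ccod (atlas c)) (f \o cinv (atlas c) : E -> R^o).

(* w = df *)
Definition is_differential (w : coord_form 1) (f : M -> R) : Prop :=
  forall c x, ccod (atlas c) x -> forall v : 'I_1 -> E,
    w c x v = 'D_(v ord0) (f \o cinv (atlas c) : E -> R^o) x.

(* b_1(M) = b: some b closed 1-forms induce a basis of the de Rham space
   H^1(M; R) = {closed 1-forms} / {exact 1-forms} *)
Definition first_betti_number (b : nat) : Prop :=
  exists w : 'I_b -> coord_form 1,
    (forall i, smooth_form (w i) /\ closed_form (w i)) /\
    forall eta : coord_form 1, smooth_form eta -> closed_form eta ->
      exists! a : 'rV[R]_b, exists2 f : M -> R, smooth_fun f &
        is_differential
          (fun c x v => eta c x v - \sum_(i < b) a ord0 i * w i c x v) f.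

Definition coord_field := idx M -> E -> E.

(* (i_X w)(v_0, v_1, ...) = w(X, v_0, v_1, ...) *)
Definition interior_product (k : nat) (X : coord_field) (w : coord_form k.+1) :
    coord_form k :=
  fun c x v => w c x
    (fun i => if unlift ord0 i is Some j then v j else X c x).

(* A smooth action of the torus T^r = R^r / Z^r, given as a smooth action of
   R^r, the Lie algebra of T^r, for which Z^r acts trivially; the exponential
   map is the quotient map R^r -> T^r. *)
Record torus_action (r : nat) (act : 'rV[R]_r -> M -> M) : Prop := TorusAction {
  act0 : forall m, act 0 m = m;
  actD : forall s t m, act (s + t) m = act s (act t m);
  act_lattice : forall (z : 'rV[int]_r) m, act (map_mx intr z) m = m;
  act_continuous : continuous (fun p : 'rV[R]_r * M => act p.1 p.2);
  act_smooth : forall c c',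
    smooth_on [set p : 'rV[R]_r * E | ccod (atlas c) p.2 /\
                 cdom (atlas c') (act p.1 (cinv (atlas c) p.2))]
      (fun p => atlas c' (act p.1 (cinv (atlas c) p.2))) }.

(* no nontrivial element of T^r acts as the identity *)
Definition effective (r : nat) (act : 'rV[R]_r -> M -> M) : Prop :=
  forall t, (forall m, act t m = m) ->
    exists z : 'rV[int]_r, t = map_mx intr z.

(* the vector field d/ds|_(s = 0) exp(s xi) . m *)
Definition induced_field (r : nat) (act : 'rV[R]_r -> M -> M) (xi : 'rV[R]_r) :
    coord_field :=
  fun c x => 'D_xi (fun t => atlas c (act t (cinv (atlas c) x))) 0.

(* the differential at 0 of t |-> exp(t) . m is injective *)
Definition regular_point (r : nat) (act : 'rV[R]_r -> M -> M) (m : M) : Prop :=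
  forall c, cdom (atlas c) m ->
    forall xi, induced_field act xi c (atlas c m) = 0 -> xi = 0.

End Forms.

(* Hodge star of the standard oriented Euclidean R^(k+l):
   ( *w)(v) = 1/k! \sum_s w(e_s1, .., e_sk) det(e_s1, .., e_sk, v_1, .., v_l) *)
Definition hodge (R : realType) (k l : nat)
    (w : ('I_k -> 'rV[R]_(k + l)) -> R) : ('I_l -> 'rV[R]_(k + l)) -> R :=
  fun v => (k`!%:R)^-1 * \sum_(s : {ffun 'I_k -> 'I_(k + l)})
    w (fun i => delta_mx ord0 (s i)) *
    \det (col_mx (\matrix_(i < k) (delta_mx ord0 (s i) : 'rV_(k + l)))
                 (\matrix_(i < l) v i)).

(* e^(ijl) on R^7, with 1 <= i, j, l <= 7 *)
Definition e3 (R : realType) (i j l : nat) (v : 'I_3 -> 'rV[R]_7) : R :=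
  \det (\matrix_(a < 3, b < 3)
          v a ord0 (inord (nth 0%N [:: i; j; l] b).-1)).

Definition phi0 (R : realType) (v : 'I_3 -> 'rV[R]_7) : R :=
  e3 1 2 3 v + e3 1 4 5 v + e3 1 6 7 v + e3 2 4 6 v
  - e3 2 5 7 v - e3 3 4 7 v - e3 3 5 6 v.

Section G2.
Context (R : realType) (M : smooth_manifold R 7).
Local Notation E := 'rV[R]_7.

(* u |-> u *m B is a linear isomorphism T_mM -> R^7 taking phi to phi0 *)
Definition G2_iso (phi : coord_form M 3) (c : idx M) (x : E) (B : 'M[R]_7) :=
  B \in unitmx /\ forall v, phi c x v = phi0 (fun i => v i *m B).

Definition G2_form (phi : coord_form M 3) : Prop :=
  smooth_form phi /\
  forall c x, ccod (atlas c) x -> exists B, G2_iso phi c x B.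

(* The metric and the orientation of a G2-form are those transported from R^7
   by any such isomorphism.  The choice is immaterial, since the stabiliser of
   phi0 in GL(7) is contained in SO(7). *)
Definition G2_frame (phi : coord_form M 3) (c : idx M) (x : E) : 'M[R]_7 :=
  xget 1%:M [set B | G2_iso phi c x B].

Definition G2_metric (phi : coord_form M 3) (c : idx M) (x u v : E) : R :=
  \sum_(i < 7) (u *m G2_frame phi c x) ord0 i * (v *m G2_frame phi c x) ord0 i.

(* The Hodge star of phi for the metric and orientation above: since the frame
   is an oriented isometry taking phi to phi0, it takes *phi to *phi0. *)
Definition G2_star (phi : coord_form M 3) : coord_form M 4 :=
  fun c x v =>
    hodge (k := 3) (l := 4) (@phi0 R) (fun i => v i *m G2_frame phi c x).

End G2.

Section Submanifolds.
Context (R : realType) (n : nat) (M : smooth_manifold R n.+1).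
Local Notation E := 'rV[R]_n.+1.

(* In the smooth chart h, the set S is R^k x {0}. *)
Definition slice_chart (k : nat) (S : set M) (h : chart R n.+1 M) : Prop :=
  (forall c, compatible (atlas c) h) /\
  forall y, ccod h y ->
    (S (cinv h y) <-> forall i : 'I_n.+1, (k <= i)%N -> y ord0 i = 0).

(* the j-th coordinate vector of h at cinv h y, expressed in the chart c *)
Definition slice_vector (h : chart R n.+1 M) (c : idx M) (y : E) (j : nat) : E :=
  'D_(delta_mx ord0 (inord j)) (atlas c \o cinv h) y.

(* S is an embedded k-dimensional submanifold which is calibrated by w, for the
   metric g and a suitable orientation of S: around each point there is a slice
   chart in whose coordinates the restriction of w to S is the Riemannian
   volume form sqrt(det g_ij) dy^1 /\ .. /\ dy^k.  As w is then positive on the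
   coordinate frames of all these slice charts, they induce the same
   orientation on overlaps and so define an orientation of S. *)
Definition calibrated_submanifold (k : nat) (w : coord_form M k)
    (g : idx M -> E -> E -> E -> R) (S : set M) : Prop :=
  forall p, S p -> exists h : chart R n.+1 M,
    [/\ cdom h p, slice_chart k S h &
        forall y c, ccod h y -> S (cinv h y) -> cdom (atlas c) (cinv h y) ->
          let x := atlas c (cinv h y) in
          w c x (fun j => slice_vector h c y j) =
          Num.sqrt (\det (\matrix_(i < k, j < k)
            g c x (slice_vector h c y i) (slice_vector h c y j)))].

End Submanifolds.

Definition coassociative (R : realType) (M : smooth_manifold R 7)
    (phi : coord_form M 3) (S : set M) : Prop :=
  calibrated_submanifold (G2_star phi) (G2_metric phi) S.

(* S is a coassociative submanifold in a neighbourhood of m. *)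
Definition coassociative_near (R : realType) (M : smooth_manifold R 7)
    (phi : coord_form M 3) (S : set M) (m : M) : Prop :=
  exists W : set M, [/\ open W, W m & coassociative phi (S `&` W)].

Definition level_set (R : realType) (T : Type) (f1 f2 f3 : T -> R)
    (c : R * R * R) : set T :=
  [set m | [/\ f1 m = c.1.1, f2 m = c.1.2 & f3 m = c.2]].

(* Main.v *)
(* Cartan's formula for the commuting fields X_i, which preserve phi, makes each
   sigma_i closed, hence exact as b_1 = 0. Along an orbit, t |-> f_i (t m) has constant
   directional derivatives phi(X_j, X_k, X_l) and is periodic, so they vanish: f_i is
   invariant and phi(X_1, X_2, X_3) = 0.

   At a regular point the X_i are independent; since phi(Y, Z, _) = 0 only for dependent
   Y, Z, so are the sigma_i. The inverse function theorem then gives a chart whose last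
   three coordinates are the f_i - c_i and whose first four are linear, with a sign chosen
   so that the dual star is positive on the slice. The slice is tangent to the X_i and
   phi(X_i, X_j, _) vanishes on it, so phi vanishes on it. On a 4-space with basis p on
   which phi vanishes, ( *phi(p))^2 is the Gram determinant of p.

   The frames of a G2-form are not chosen continuously; positivity persists near the point
   because metric and star are explicit continuous functions of the coefficients of phi. *)

Require Import Defs.
From HB Require Import structures.
From mathcomp Require Import all_boot all_order all_algebra all_fingroup.
From mathcomp Require Import all_classical all_reals all_analysis.
From mathcomp Require Import ring lra zify.

Set Implicit Arguments.
Unset Strict Implicit.
Unset Printing Implicit Defensive.

Import Order.TTheory GRing.Theory Num.Theory.
Import numFieldNormedType.Exports.
Local Open Scope classical_set_scope.
Local Open Scope ring_scope.

(* Instances: functions continuous at a point, functions of class C^k. *)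
Section RingClass.
Context (R : realType) (T : Type).

(** Frames are picked pointwise by [xget], so neither metric nor star may be read off them. For any
    frame [B], the square of a determinant built from i_u phi is (|det B| |uB|^2)^4; a fourth root
    and polarisation give |det B| B B^T, whose determinant |det B|^9 fixes the scale through a ninth
    root. Hence B B^T depends on phi only. A polynomial identity expresses the dual 4-form through
    phi0 and the scalar product, so the star inherits both independence of the frame and continuity,
    orientation included.

    Smoothness is phrased by directional derivatives, so the chain rule is obtained from strict
    differentiability, which continuous partial derivatives provide; the same estimate drives the
    inverse function theorem. The action in charts lives on R^3 x R^7, so the chain rule leaves the
    source space arbitrary and uses coordinates only on the middle space.

    Calibration compares the star with a positive square root. Wherever the slice Jacobian is
    invertible, the square of the star already equals the Gram determinant, so only a sign has to be
    controlled near the point. *)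

Record ring_class (P : (T -> R) -> Prop) : Prop := RingClass {
  rc_cst : forall c, P (fun=> c);
  rc_add : forall f g, P f -> P g -> P (fun x => f x + g x);
  rc_mul : forall f g, P f -> P g -> P (fun x => f x * g x) }.

Context (P : (T -> R) -> Prop) (PP : ring_class P).

Lemma rc_opp f : P f -> P (fun x => - f x).
Proof.
move=> Pf; rewrite (_ : (fun x => _) = (fun x => -1 * f x)).
  by apply: (rc_mul PP) => //; exact: (rc_cst PP).
by apply/funext => x; rewrite mulN1r.
Qed.

Lemma rc_sub f g : P f -> P g -> P (fun x => f x - g x).
Proof. by move=> Pf Pg; apply: (rc_add PP) => //; exact: rc_opp. Qed.

Lemma rc_sum I (r : seq I) (Q : pred I) (F : I -> T -> R) :
  (forall i, P (F i)) -> P (fun x => \sum_(i <- r | Q i) F i x).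
Proof.
move=> PF; elim: r => [|i r IH].
  by rewrite (_ : (fun x => _) = (fun=> 0));
    [exact: (rc_cst PP) | apply/funext => x; rewrite big_nil].
rewrite (_ : (fun x => _) = if Q i
    then (fun x => F i x + \sum_(i <- r | Q i) F i x)
    else (fun x => \sum_(i <- r | Q i) F i x)).
  by case: (Q i) => //; apply: (rc_add PP).
by apply/funext => x; rewrite big_cons; case: (Q i).
Qed.

Lemma rc_prod I (r : seq I) (Q : pred I) (F : I -> T -> R) :
  (forall i, P (F i)) -> P (fun x => \prod_(i <- r | Q i) F i x).
Proof.
move=> PF; elim: r => [|i r IH].
  by rewrite (_ : (fun x => _) = (fun=> 1));
    [exact: (rc_cst PP) | apply/funext => x; rewrite big_nil].
rewrite (_ : (fun x => _) = if Q i
    then (fun x => F i x * \prod_(i <- r | Q i) F i x)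
    else (fun x => \prod_(i <- r | Q i) F i x)).
  by case: (Q i) => //; apply: (rc_mul PP).
by apply/funext => x; rewrite big_cons; case: (Q i).
Qed.

Lemma rc_mulmx m n p (A : T -> 'M[R]_(m, n)) (B : T -> 'M[R]_(n, p)) :
  (forall i j, P (fun x => A x i j)) -> (forall i j, P (fun x => B x i j)) ->
  forall i j, P (fun x => (A x *m B x) i j).
Proof.
move=> PA PB i j; rewrite (_ : (fun x => _) = (fun x => \sum_k A x i k * B x k j)).
  by apply: rc_sum => k; apply: (rc_mul PP).
by apply/funext => x; rewrite mxE.
Qed.

Lemma rc_det n (A : T -> 'M[R]_n) :
  (forall i j, P (fun x => A x i j)) -> P (fun x => \det (A x)).
Proof.
move=> PA; apply: (@rc_sum _ _ _ (fun (s : 'S_n) x => (-1) ^+ s * \prod_i A x i (s i))) => s.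
apply: (rc_mul PP (f := fun=> _) (g := fun x => \prod_i A x i (s i))).
  exact: (rc_cst PP).
exact: (@rc_prod _ _ _ (fun i x => A x i (s i))).
Qed.

Lemma rc_adj n (A : T -> 'M[R]_n) : (forall i j, P (fun x => A x i j)) ->
  forall i j, P (fun x => (\adj (A x)) i j).
Proof.
move=> PA i j.
rewrite (_ : (fun x => _) = (fun x => (-1) ^+ (j + i) * \det (row' j (col' i (A x))))).
  apply: (rc_mul PP); first exact: (rc_cst PP).
  by apply: rc_det => k l; under eq_fun do rewrite !mxE; exact: PA.
by apply/funext => x; rewrite mxE.
Qed.

End RingClass.

Definition cont_at (R : realType) (T : topologicalType) (x0 : T) (g : T -> R) : Prop :=
  {for x0, continuous g}.

Lemma continuous_at_ring_class (R : realType) (T : topologicalType) (x0 : T) :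
  ring_class (@cont_at R T x0).
Proof.
split=> [c|f g cf cg|f g cf cg]; first exact: cst_continuous.
- exact: continuousD.
- exact: continuousM.
Qed.

(** * Algebra of the standard G2-form *)

Section NatDet.
Context (R : comNzRingType).

(* Unlike \det, this unfolds to an explicit Laplace expansion. *)
Fixpoint ndet (n : nat) (f : nat -> nat -> R) : R :=
  if n is n'.+1 then
    \sum_(j <- iota 0 n) (-1) ^+ j * f 0%N j * ndet n' (fun i k => f i.+1 (bump j k))
  else 1.

Lemma ndetS n f : ndet n.+1 f = \sum_(j < n.+1) (-1) ^+ j * f 0%N j *
  ndet n (fun i k => f i.+1 (bump j k)).
Proof.
rewrite -(big_mkord xpredT (fun j => (-1) ^+ j * f 0%N j *
  ndet n (fun i k => f i.+1 (bump j k)))).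
by rewrite /index_iota subn0.
Qed.

Lemma det_ndet n (f : nat -> nat -> R) :
  \det (\matrix_(i < n, j < n) f i j) = ndet n f.
Proof.
elim: n f => [|n IH] f; first by rewrite det_mx00.
rewrite (expand_det_row _ ord0) ndetS; apply: eq_bigr => j _.
rewrite mxE /= /cofactor add0n mulrA [f _ _ * _]mulrC; congr (_ * _).
rewrite -IH; congr (\det _); apply/matrixP => i k; rewrite !mxE /=.
by rewrite /bump leq0n.
Qed.

Lemma ndet_delta n (f : nat -> nat -> R) c : (c <= n)%N ->
  (forall j, f 0%N j = (j == c)%:R) ->
  ndet n.+1 f = (-1) ^+ c * ndet n (fun i k => f i.+1 (bump c k)).
Proof.
move=> cn fE; rewrite ndetS (bigD1 (inord c)) //= inordK // fE eqxx mulr1.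
rewrite big1 ?addr0 // => j; rewrite -val_eqE /= inordK // => jc.
by rewrite fE (negbTE jc) mulr0 mul0r.
Qed.

Lemma eq_ndet n (f g : nat -> nat -> R) :
  (forall i j, (i < n)%N -> (j < n)%N -> f i j = g i j) -> ndet n f = ndet n g.
Proof.
move=> fg; rewrite -!det_ndet; congr (\det _).
by apply/matrixP => i j; rewrite !mxE fg.
Qed.

Lemma ndet3E f : ndet 3 f =
  (f 0%N 0%N * (f 1%N 1%N * f 2%N 2%N - f 1%N 2%N * f 2%N 1%N)
     - f 0%N 1%N * (f 1%N 0%N * f 2%N 2%N - f 1%N 2%N * f 2%N 0%N)
     + f 0%N 2%N * (f 1%N 0%N * f 2%N 1%N - f 1%N 1%N * f 2%N 0%N)).
Proof. rewrite /= !big_cons !big_nil /bump /=; ring. Qed.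

Lemma ndet4E f : ndet 4 f =
  f 0%N 0%N * (f 1%N 1%N * (f 2%N 2%N * f 3%N 3%N - f 2%N 3%N * f 3%N 2%N)
     - f 1%N 2%N * (f 2%N 1%N * f 3%N 3%N - f 2%N 3%N * f 3%N 1%N)
     + f 1%N 3%N * (f 2%N 1%N * f 3%N 2%N - f 2%N 2%N * f 3%N 1%N))
  - f 0%N 1%N * (f 1%N 0%N * (f 2%N 2%N * f 3%N 3%N - f 2%N 3%N * f 3%N 2%N)
     - f 1%N 2%N * (f 2%N 0%N * f 3%N 3%N - f 2%N 3%N * f 3%N 0%N)
     + f 1%N 3%N * (f 2%N 0%N * f 3%N 2%N - f 2%N 2%N * f 3%N 0%N))
  + f 0%N 2%N * (f 1%N 0%N * (f 2%N 1%N * f 3%N 3%N - f 2%N 3%N * f 3%N 1%N)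
     - f 1%N 1%N * (f 2%N 0%N * f 3%N 3%N - f 2%N 3%N * f 3%N 0%N)
     + f 1%N 3%N * (f 2%N 0%N * f 3%N 1%N - f 2%N 1%N * f 3%N 0%N))
  - f 0%N 3%N * (f 1%N 0%N * (f 2%N 1%N * f 3%N 2%N - f 2%N 2%N * f 3%N 1%N)
     - f 1%N 1%N * (f 2%N 0%N * f 3%N 2%N - f 2%N 2%N * f 3%N 0%N)
     + f 1%N 2%N * (f 2%N 0%N * f 3%N 1%N - f 2%N 1%N * f 3%N 0%N)).
Proof. rewrite ndetS !big_ord_recl big_ord0 !ndet3E /= /bump /=; ring. Qed.

End NatDet.

Section Phi0.
Context (R : realType).
Local Notation E := 'rV[R]_7.
Local Notation "v $[ k ]" := (v ord0 (inord k : 'I_7)) (at level 2, format "v $[ k ]").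

Definition tri (V : Type) (u v w : V) : 'I_3 -> V :=
  fun i => nth u [:: u; v; w] i.

Lemma triE (V : Type) (f : 'I_3 -> V) : f = tri (f (inord 0)) (f (inord 1)) (f (inord 2)).
Proof.
apply/funext => i; rewrite /tri.
case: i => -[|[|[|//]]] Hi /=; congr f; apply/val_inj; by rewrite /= inordK.
Qed.

Lemma tri_comp (V W : Type) (f : V -> W) u v w :
  (fun i => f (tri u v w i)) = tri (f u) (f v) (f w).
Proof.
by apply/funext => i; rewrite /tri; case: i => -[|[|[|//]]] Hi.
Qed.

Definition quad (V : Type) (u v w z : V) : 'I_4 -> V :=
  fun i => nth u [:: u; v; w; z] i.

Lemma quadE (V : Type) (f : 'I_4 -> V) :
  f = quad (f (inord 0)) (f (inord 1)) (f (inord 2)) (f (inord 3)).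
Proof.
apply/funext => i; rewrite /quad.
case: i => -[|[|[|[|//]]]] Hi /=; congr f; apply/val_inj; by rewrite /= inordK.
Qed.

(** The minor of the rows [u], [v], [w] in columns [i], [j], [k], counted from 0 whereas [e3] counts
    from 1. *)
Definition D3 (u v w : E) i j k : R :=
  u$[i] * (v$[j] * w$[k] - v$[k] * w$[j]) - u$[j] * (v$[i] * w$[k] - v$[k] * w$[i])
  + u$[k] * (v$[i] * w$[j] - v$[j] * w$[i]).

Lemma e3_tri (u v w : E) i j k : e3 i j k (tri u v w) = D3 u v w i.-1 j.-1 k.-1.
Proof.
transitivity (ndet 3 (fun a b =>
  (nth u [:: u; v; w] a)$[(nth 0%N [:: i; j; k] b).-1])).
  by rewrite -det_ndet.
rewrite /= !big_cons !big_nil /bump /=.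
rewrite /D3; ring.
Qed.

Lemma phi0_tri (u v w : E) : phi0 (tri u v w) =
  D3 u v w 0 1 2 + D3 u v w 0 3 4 + D3 u v w 0 5 6 + D3 u v w 1 3 5
  - D3 u v w 1 4 6 - D3 u v w 2 3 6 - D3 u v w 2 4 5.
Proof. by rewrite /phi0 !e3_tri. Qed.

Definition dot (u v : E) : R := \sum_(i < 7) u ord0 i * v ord0 i.

Lemma big_ord7 (V : nmodType) (F : 'I_7 -> V) : \sum_(i < 7) F i =
  F (inord 0) + F (inord 1) + F (inord 2) + F (inord 3) + F (inord 4) + F (inord 5)
  + F (inord 6).
Proof.
rewrite !big_ord_recl big_ord0 addr0 !addrA.
by do !congr (_ + _); congr F; apply/val_inj; rewrite /= inordK.
Qed.

Lemma delta_inord (i j : nat) : (i < 7)%N -> (j < 7)%N ->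
  (delta_mx ord0 (inord i) : E)$[j] = (j == i)%:R.
Proof.
by move=> i7 j7; rewrite mxE eqxx /= -val_eqE /= !inordK.
Qed.

(** The list holds the coordinates of the octonionic cross product u x v, defined by <u x v, w> =
    phi0(u, v, w). *)
Lemma phi0_delta (u v : E) k : (k < 7)%N -> phi0 (tri u v (delta_mx ord0 (inord k))) =
  nth 0 [:: (u$[1] * v$[2] - u$[2] * v$[1]) + (u$[3] * v$[4] - u$[4] * v$[3]) + (u$[5] * v$[6] - u$[6] * v$[5]);
    -(u$[0] * v$[2] - u$[2] * v$[0]) + (u$[3] * v$[5] - u$[5] * v$[3]) - (u$[4] * v$[6] - u$[6] * v$[4]);
    (u$[0] * v$[1] - u$[1] * v$[0]) - (u$[3] * v$[6] - u$[6] * v$[3]) - (u$[4] * v$[5] - u$[5] * v$[4]);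
    -(u$[0] * v$[4] - u$[4] * v$[0]) - (u$[1] * v$[5] - u$[5] * v$[1]) + (u$[2] * v$[6] - u$[6] * v$[2]);
    (u$[0] * v$[3] - u$[3] * v$[0]) + (u$[1] * v$[6] - u$[6] * v$[1]) + (u$[2] * v$[5] - u$[5] * v$[2]);
    -(u$[0] * v$[6] - u$[6] * v$[0]) + (u$[1] * v$[3] - u$[3] * v$[1]) - (u$[2] * v$[4] - u$[4] * v$[2]);
    (u$[0] * v$[5] - u$[5] * v$[0]) - (u$[1] * v$[4] - u$[4] * v$[1]) - (u$[2] * v$[3] - u$[3] * v$[2])] k.
Proof.
move: k; do 7?[case=> [_|]] => //.
all: rewrite phi0_tri /D3 !delta_inord //=; ring.
Qed.

Definition D4 (u v w z : E) a b c d : R := ndet 4 (fun i j =>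
  (nth u [:: u; v; w; z] i)$[nth 0%N [:: a; b; c; d] j]).

(** The dual 4-form e^4567 + e^2367 + e^2345 + e^1357 - e^1346 - e^1256 - e^1247, with indices
    counted from 0; each term is complementary to one of phi0. *)
Definition psi4 (u v w z : E) : R :=
  D4 u v w z 3 4 5 6 + D4 u v w z 1 2 5 6 + D4 u v w z 1 2 3 4 + D4 u v w z 0 2 4 6
  - D4 u v w z 0 2 3 5 - D4 u v w z 0 1 4 5 - D4 u v w z 0 1 3 6.

(** A polynomial identity in 28 coordinates. It expresses the dual form through cross products and
    the scalar product alone, so that later the star depends only on the form and its metric. *)
Lemma psi4E (u v w z : E) : psi4 u v w z =
  (\sum_(k < 7) phi0 (tri u v (delta_mx ord0 k)) * phi0 (tri w z (delta_mx ord0 k)))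
  - (dot u w * dot v z - dot u z * dot v w).
Proof.
rewrite /psi4 /D4.
rewrite /dot !big_ord7 !phi0_delta // !ndet4E.
rewrite [LHS]/= [X in _ = X - _]/=.
generalize (u$[0]) (u$[1]) (u$[2]) (u$[3]) (u$[4]) (u$[5]) (u$[6])=> u0 u1 u2 u3 u4 u5 u6.
generalize (v$[0]) (v$[1]) (v$[2]) (v$[3]) (v$[4]) (v$[5]) (v$[6])=> v0 v1 v2 v3 v4 v5 v6.
generalize (w$[0]) (w$[1]) (w$[2]) (w$[3]) (w$[4]) (w$[5]) (w$[6])=> w0 w1 w2 w3 w4 w5 w6.
generalize (z$[0]) (z$[1]) (z$[2]) (z$[3]) (z$[4]) (z$[5]) (z$[6])=> z0 z1 z2 z3 z4 z5 z6.
ring.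
Qed.

(** The case w = u of [psi4E], where the 4-form has a repeated argument. For v = z it reads |u x
    v|^2 = |u|^2 |v|^2 - <u, v>^2. *)
Lemma sum_phi0_phi0 (u v z : E) :
  \sum_(k < 7) phi0 (tri u v (delta_mx ord0 k)) * phi0 (tri u z (delta_mx ord0 k)) =
  dot u u * dot v z - dot u z * dot v u.
Proof.
have := psi4E u v u z.
suff -> : psi4 u v u z = 0 by move/esym/eqP; rewrite subr_eq0 => /eqP.
have D0 a b c d : D4 u v u z a b c d = 0.
  rewrite /D4 -det_ndet (determinant_alternate (i1 := inord 0) (i2 := inord 2)) //.
    by rewrite -val_eqE /= !inordK.
  by move=> j; rewrite !mxE !inordK.
by rewrite /psi4 !D0 !addr0 !subr0.
Qed.

(* the determinant in hodge for the indices s = (a, b, c) *)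
Definition hdet (v : 'I_4 -> E) (a b c : nat) : R :=
  ndet 7 (fun i j => if (i < 3)%N then (j == nth 0%N [:: a; b; c] i)%:R
                     else (v (inord (i - 3)))$[j]).

Lemma hdet_swap12 v a b c : hdet v a c b = - hdet v a b c.
Proof.
rewrite /hdet -!det_ndet.
rewrite (_ : \matrix_(i, j) _ = row_perm (tperm (inord 1) (inord 2))
  (\matrix_(i < 7, j < 7) (if (i < 3)%N then (j == nth 0%N [:: a; b; c] i :> nat)%:R
     else (v (inord (i - 3)))$[j]))); last first.
  apply/matrixP => i j; rewrite !mxE.
  case: tpermP => [->|->|]; rewrite ?inordK //.
  move=> /eqP + /eqP; rewrite -!val_eqE /= !inordK //.
  by case: i => -[|[|[|i]]].
rewrite row_permE det_mulmx det_perm odd_tperm -val_eqE /= !inordK //=.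
by rewrite expr1 mulN1r.
Qed.

Lemma hdet_swap01 v a b c : hdet v b a c = - hdet v a b c.
Proof.
rewrite /hdet -!det_ndet.
rewrite (_ : \matrix_(i, j) _ = row_perm (tperm (inord 0) (inord 1))
  (\matrix_(i < 7, j < 7) (if (i < 3)%N then (j == nth 0%N [:: a; b; c] i :> nat)%:R
     else (v (inord (i - 3)))$[j]))); last first.
  apply/matrixP => i j; rewrite !mxE.
  case: tpermP => [->|->|]; rewrite ?inordK //.
  move=> /eqP + /eqP; rewrite -!val_eqE /= !inordK //.
  by case: i => -[|[|[|i]]].
rewrite row_permE det_mulmx det_perm odd_tperm -val_eqE /= !inordK //=.
by rewrite expr1 mulN1r.
Qed.

Lemma sum_ffun3 (n : nat) (F : {ffun 'I_3 -> 'I_n} -> R) :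
  \sum_s F s = \sum_(a < n) \sum_(b < n) \sum_(c < n) F (finfun (tri a b c)).
Proof.
under [RHS]eq_bigr do rewrite pair_big /=.
rewrite pair_big /= (reindex (fun p : 'I_n * ('I_n * 'I_n) =>
  finfun (tri p.1 p.2.1 p.2.2))) //=.
exists (fun s : {ffun 'I_3 -> 'I_n} => (s (inord 0), (s (inord 1), s (inord 2)))).
  by case=> a [b c] _ /=; rewrite !ffunE /tri !inordK.
by move=> s _ /=; apply/ffunP => i; rewrite ffunE -(triE s).
Qed.

Lemma hodge_sum (w : ('I_3 -> 'rV[R]_(3 + 4)) -> R) (v : 'I_4 -> 'rV[R]_(3 + 4)) :
  hodge w v = 6%:R^-1 * \sum_(a < 7) \sum_(b < 7) \sum_(c < 7)
    w (tri (delta_mx ord0 a) (delta_mx ord0 b) (delta_mx ord0 c)) * hdet v a b c.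
Proof.
rewrite /hodge; congr (_ * _).
rewrite (sum_ffun3 (n := 7)).
apply: eq_bigr => a _; apply: eq_bigr => b _; apply: eq_bigr => c _.
congr (_ * _).
  congr w; rewrite -(tri_comp (fun a : 'I_7 => delta_mx ord0 a : E)).
  by apply/funext => i; rewrite ffunE.
rewrite /hdet -det_ndet; congr (\det _); apply/matrixP => i j; rewrite !mxE.
case: splitP => k ik; rewrite !mxE.
  rewrite ik ltn_ord ffunE eqxx /= -val_eqE /=; congr (_ == _)%:R.
  by rewrite /tri; case: k {ik} => -[|[|[|]]].
by rewrite ik /= addKn inord_val; congr (v _ _ _); apply/val_inj; rewrite /= inordK.
Qed.

Lemma sum_delta3 (i j l : nat) (F : nat -> nat -> nat -> R) :
  (i < 7)%N -> (j < 7)%N -> (l < 7)%N ->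
  \sum_(a < 7) \sum_(b < 7) \sum_(c < 7)
    (a == i :> nat)%:R * ((b == j :> nat)%:R * ((c == l :> nat)%:R * F a b c)) = F i j l.
Proof.
move=> i7 j7 l7.
have coll k (G : nat -> R) : (k < 7)%N -> \sum_(a < 7) (a == k :> nat)%:R * G a = G k.
  move=> k7; rewrite (bigD1 (inord k)) //= inordK // eqxx mul1r big1 ?addr0 // => a.
  by rewrite -val_eqE /= inordK // => /negbTE ->; rewrite mul0r.
transitivity (\sum_(a < 7) (a == i :> nat)%:R *
  \sum_(b < 7) (b == j :> nat)%:R * F a b l).
  apply: eq_bigr => a _; rewrite mulr_sumr; apply: eq_bigr => b _.
  by rewrite -mulr_sumr -mulr_sumr (coll l (F a b)).
transitivity (\sum_(a < 7) (a == i :> nat)%:R * F a j l).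
  by apply: eq_bigr => a _; rewrite (coll j (F a ^~ l)).
by rewrite (coll i (fun a => F a j l)).
Qed.

(** Only the six arrangements of (i, j, l) contribute to the sum over basis triples; by alternation
    they contribute equally, and their number cancels 1/3!. *)
Lemma hodge_e3 i j l (v : 'I_4 -> E) : (0 < i < 8)%N -> (0 < j < 8)%N -> (0 < l < 8)%N ->
  hodge (k := 3) (l := 4) (@e3 R i j l) v = hdet v i.-1 j.-1 l.-1.
Proof.
move=> hi hj hl; rewrite hodge_sum.
case: i hi => // i; case: j hj => // j; case: l hl => // l /= hl hj hi.
pose h a b c := hdet v a b c.
(* The six terms are the Leibniz expansion of the minor [D3] on basis vectors. *)
transitivity (6%:R^-1 * \sum_(a < 7) \sum_(b < 7) \sum_(c < 7) (
  (a == i :> nat)%:R * ((b == j :> nat)%:R * ((c == l :> nat)%:R * h a b c))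
  - (a == i :> nat)%:R * ((b == l :> nat)%:R * ((c == j :> nat)%:R * h a b c))
  - (a == j :> nat)%:R * ((b == i :> nat)%:R * ((c == l :> nat)%:R * h a b c))
  + (a == j :> nat)%:R * ((b == l :> nat)%:R * ((c == i :> nat)%:R * h a b c))
  + (a == l :> nat)%:R * ((b == i :> nat)%:R * ((c == j :> nat)%:R * h a b c))
  - (a == l :> nat)%:R * ((b == j :> nat)%:R * ((c == i :> nat)%:R * h a b c)))).
  congr (_ * _); apply: eq_bigr => a _; apply: eq_bigr => b _; apply: eq_bigr => c _.
  have dE (p : 'I_7) q : (q < 7)%N -> (delta_mx ord0 p : E)$[q] = (p == q :> nat)%:R.
    by move=> q7; rewrite mxE eqxx /= -val_eqE /= inordK // eq_sym.
  rewrite e3_tri /D3 /= !dE // -/(h a b c).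
  move: (h a b c) => hh.
  do 9! (move: (_%:R : R) => ?).
  ring.
have S3D (H K : nat -> nat -> nat -> R) :
    \sum_(a < 7) \sum_(b < 7) \sum_(c < 7) (H a b c + K a b c) =
    \sum_(a < 7) \sum_(b < 7) \sum_(c < 7) H a b c +
    \sum_(a < 7) \sum_(b < 7) \sum_(c < 7) K a b c.
  rewrite -big_split; apply: eq_bigr => a _ /=; rewrite -big_split.
  by apply: eq_bigr => b _ /=; rewrite -big_split.
have S3B (H K : nat -> nat -> nat -> R) :
    \sum_(a < 7) \sum_(b < 7) \sum_(c < 7) (H a b c - K a b c) =
    \sum_(a < 7) \sum_(b < 7) \sum_(c < 7) H a b c -
    \sum_(a < 7) \sum_(b < 7) \sum_(c < 7) K a b c.
  rewrite -sumrB; apply: eq_bigr => a _ /=; rewrite -sumrB.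
  by apply: eq_bigr => b _ /=; rewrite -sumrB.
pose d a b c p q r := (a == p :> nat)%:R * ((b == q :> nat)%:R *
  ((c == r :> nat)%:R * h a b c)).
rewrite (S3B (fun a b c => d a b c i j l - d a b c i l j - d a b c j i l
  + d a b c j l i + d a b c l i j) (fun a b c => d a b c l j i)).
rewrite (S3D (fun a b c => d a b c i j l - d a b c i l j - d a b c j i l
  + d a b c j l i) (fun a b c => d a b c l i j)).
rewrite (S3D (fun a b c => d a b c i j l - d a b c i l j - d a b c j i l)
  (fun a b c => d a b c j l i)).
rewrite (S3B (fun a b c => d a b c i j l - d a b c i l j) (fun a b c => d a b c j i l)).
rewrite (S3B (fun a b c => d a b c i j l) (fun a b c => d a b c i l j)).
rewrite /d !sum_delta3 // /h.
have e1 : hdet v i l j = - hdet v i j l by rewrite hdet_swap12.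
have e2 : hdet v j i l = - hdet v i j l by rewrite hdet_swap01.
have e3 : hdet v j l i = hdet v i j l by rewrite hdet_swap12 e2 opprK.
have e4 : hdet v l i j = hdet v i j l by rewrite hdet_swap01 e1 opprK.
have e5 : hdet v l j i = - hdet v i j l by rewrite hdet_swap12 e4.
rewrite e1 e2 e3 e4 e5; field.
by [].
Qed.

(** The three unit rows are removed one after the other. Deleting column [a] shifts [b] to b - 1,
    and deleting that one leaves [c] at c - 2; the nested [bump] undoes this renumbering. *)
Lemma hdet_ndet4 v a b c : (a < b)%N -> (b < c)%N -> (c < 7)%N ->
  hdet v a b c = (-1) ^+ (a + b.-1 + c.-2) * ndet 4 (fun i k =>
    (v (inord i))$[bump a (bump b.-1 (bump c.-2 k))]).
Proof.
move=> ab bc c7; rewrite /hdet.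
have a6 : (a <= 6)%N by lia.
have b5 : (b.-1 <= 5)%N by lia.
have c4 : (c.-2 <= 4)%N by lia.
pose f0 (i j : nat) : R := if (i < 3)%N then (j == nth 0%N [:: a; b; c] i)%:R
                     else (v (inord (i - 3)))$[j].
pose f1 i k := f0 i.+1 (bump a k); pose f2 i k := f1 i.+1 (bump b.-1 k).
have f1E j : f1 0%N j = (j == b.-1)%:R.
  rewrite /f1 /f0 /=; congr (_%:R); congr nat_of_bool.
  by rewrite /bump; case: (leqP a j) => aj; apply/eqP/eqP; lia.
have f2E j : f2 0%N j = (j == c.-2)%:R.
  rewrite /f2 /f1 /f0 /=; congr (_%:R); congr nat_of_bool.
  by rewrite /bump; case: (leqP b.-1 j) => bj; case: (leqP a _) => aj; apply/eqP/eqP; lia.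
transitivity (ndet 7 f0) => //.
rewrite (@ndet_delta _ 6 f0 a a6 (fun=> erefl)).
rewrite (@ndet_delta _ 5 f1 b.-1 b5 f1E) (@ndet_delta _ 4 f2 c.-2 c4 f2E).
rewrite !exprD -!mulrA; congr (_ * (_ * (_ * _))).
Qed.

Lemma hodge_phi0 (u v w z : E) :
  hodge (k := 3) (l := 4) (@phi0 R) (quad u v w z) = psi4 u v w z.
Proof.
have hE : hodge (k := 3) (l := 4) (@phi0 R) (quad u v w z) =
  hodge (k := 3) (l := 4) (@e3 R 1 2 3) (quad u v w z)
  + hodge (k := 3) (l := 4) (@e3 R 1 4 5) (quad u v w z)
  + hodge (k := 3) (l := 4) (@e3 R 1 6 7) (quad u v w z)
  + hodge (k := 3) (l := 4) (@e3 R 2 4 6) (quad u v w z)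
  - hodge (k := 3) (l := 4) (@e3 R 2 5 7) (quad u v w z)
  - hodge (k := 3) (l := 4) (@e3 R 3 4 7) (quad u v w z)
  - hodge (k := 3) (l := 4) (@e3 R 3 5 6) (quad u v w z).
  rewrite /hodge -!mulrDr -!mulrBr; congr (_ * _).
  rewrite -!big_split -!sumrB; apply: eq_bigr => s _.
  by rewrite /phi0 /= !mulrDl !mulNr.
rewrite hE !hodge_e3 // !hdet_ndet4 // /psi4.
(* The nested [bump] enumerates the four columns that survive the three deletions. *)
have D4E a b c d a' b' c' : [seq bump a' (bump b' (bump c' k)) | k <- iota 0 4] = [:: a; b; c; d] ->
    ndet 4 (fun i k => (quad u v w z (inord i))$[bump a' (bump b' (bump c' k))]) = D4 u v w z a b c d.
  move=> [e0 e1 e2 e3']; apply: eq_ndet => i j i4 j4; congr (_ _ _).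
    by rewrite /quad inordK.
  by congr inord; case: j j4 => [|[|[|[|]]]].
rewrite (D4E 3 4 5 6 1.-1 2.-2 3.-1.-2 erefl)%N (D4E 1 2 5 6 1.-1 4.-2 5.-1.-2 erefl)%N.
rewrite (D4E 1 2 3 4 1.-1 6.-2 7.-1.-2 erefl)%N (D4E 0 2 4 6 2.-1 4.-2 6.-1.-2 erefl)%N.
rewrite (D4E 0 2 3 5 2.-1 5.-2 7.-1.-2 erefl)%N (D4E 0 1 4 5 3.-1 4.-2 7.-1.-2 erefl)%N.
rewrite (D4E 0 1 3 6 3.-1 5.-2 6.-1.-2 erefl)%N.
move: (D4 u v w z 3 4 5 6) (D4 u v w z 1 2 5 6) (D4 u v w z 1 2 3 4) (D4 u v w z 0 2 4 6)
  (D4 u v w z 0 2 3 5) (D4 u v w z 0 1 4 5) (D4 u v w z 0 1 3 6) => *.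
by rewrite -!(signr_odd R (_ + _)) /= !expr0 !mul1r.
Qed.

End Phi0.

(** * Cross product by a fixed vector, and a determinant that recovers its length *)

Section Frames.
Context (R : realType).
Local Notation E := 'rV[R]_7.
Local Notation e k := (delta_mx ord0 k : 'rV[R]_7).

Lemma dotE n (u v : 'rV[R]_n) : (u *m v^T) ord0 ord0 = \sum_(i < n) u ord0 i * v ord0 i.
Proof. by rewrite mxE; apply: eq_bigr => i _; rewrite mxE. Qed.

Lemma dotC (u v : E) : dot u v = dot v u.
Proof. by apply: eq_bigr => i _; rewrite mulrC. Qed.

Lemma dotDl (u v w : E) : dot (u + v) w = dot u w + dot v w.
Proof. by rewrite -big_split; apply: eq_bigr => i _; rewrite mxE mulrDl. Qed.

Lemma dotZl a (u v : E) : dot (a *: u) v = a * dot u v.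
Proof. by rewrite mulr_sumr; apply: eq_bigr => i _; rewrite mxE mulrA. Qed.

Lemma dotDr (u v w : E) : dot w (u + v) = dot w u + dot w v.
Proof. by rewrite ![dot w _]dotC dotDl. Qed.

Lemma dotZr a (u v : E) : dot v (a *: u) = a * dot v u.
Proof. by rewrite ![dot v _]dotC dotZl. Qed.

Lemma dot_ge0 (u : E) : 0 <= dot u u.
Proof. by apply: sumr_ge0 => i _; rewrite -expr2 sqr_ge0. Qed.

Lemma dot_eq0 (u : E) : (dot u u == 0) = (u == 0).
Proof.
apply/idP/eqP => [|->]; last by rewrite /dot big1 // => i _; rewrite mxE mul0r.
rewrite psumr_eq0 => [/allP u0|i _]; last by rewrite -expr2 sqr_ge0.
apply/rowP => i; rewrite mxE; apply/eqP.
by have := u0 i (mem_index_enum _); rewrite /= mulf_eq0 orbb.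
Qed.

Lemma mul_tr_dot (u v : E) : u *m v^T = (dot u v)%:M.
Proof. by rewrite [LHS]mx11_scalar dotE. Qed.

Lemma phi0_lin1 a (u u' v w : E) :
  phi0 (tri (a *: u + u') v w) = a * phi0 (tri u v w) + phi0 (tri u' v w).
Proof. by rewrite !phi0_tri /D3 !mxE; ring. Qed.

Lemma phi0_lin2 a (u v v' w : E) :
  phi0 (tri u (a *: v + v') w) = a * phi0 (tri u v w) + phi0 (tri u v' w).
Proof. by rewrite !phi0_tri /D3 !mxE; ring. Qed.

Lemma phi0_lin3 a (u v w w' : E) :
  phi0 (tri u v (a *: w + w')) = a * phi0 (tri u v w) + phi0 (tri u v w').
Proof. by rewrite !phi0_tri /D3 !mxE; ring. Qed.

Lemma phi0_swap12 (u v w : E) : phi0 (tri u w v) = - phi0 (tri u v w).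
Proof. by rewrite !phi0_tri /D3; ring. Qed.

Lemma phi0_swap01 (u v w : E) : phi0 (tri v u w) = - phi0 (tri u v w).
Proof. by rewrite !phi0_tri /D3; ring. Qed.

Lemma phi0_alt (u v : E) : phi0 (tri u u v) = 0.
Proof. by rewrite !phi0_tri /D3; ring. Qed.

Lemma phi0_sum3 n (u v : E) (a : 'I_n -> R) (w : 'I_n -> E) :
  phi0 (tri u v (\sum_i a i *: w i)) = \sum_i a i * phi0 (tri u v (w i)).
Proof.
elim/big_rec2: _ => [|i y1 y2 _ <-]; last by rewrite phi0_lin3.
by rewrite !phi0_tri /D3 !mxE; ring.
Qed.

Lemma phi0_sum2 n (u v : E) (a : 'I_n -> R) (w : 'I_n -> E) :
  phi0 (tri u (\sum_i a i *: w i) v) = \sum_i a i * phi0 (tri u (w i) v).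
Proof.
by rewrite phi0_swap12 phi0_sum3 -sumrN; apply: eq_bigr => i _; rewrite phi0_swap12 mulrN opprK.
Qed.

Lemma phi0_sum1 n (u v : E) (a : 'I_n -> R) (w : 'I_n -> E) :
  phi0 (tri (\sum_i a i *: w i) u v) = \sum_i a i * phi0 (tri (w i) u v).
Proof.
by rewrite phi0_swap01 phi0_sum2 -sumrN; apply: eq_bigr => i _; rewrite phi0_swap01 mulrN opprK.
Qed.

(** The skew matrix of i_a phi0; its right action on rows is the cross product with [a]. *)
Definition Smx (a : E) : 'M[R]_7 := \matrix_(i, j) phi0 (tri a (e i) (e j)).

Lemma Smx_tr a : (Smx a)^T = - Smx a.
Proof. by apply/matrixP => i j; rewrite !mxE phi0_swap12. Qed.

Lemma row_mulSmx a u j : (u *m Smx a) ord0 j = phi0 (tri a u (e j)).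
Proof.
rewrite [in RHS](row_sum_delta u) phi0_swap12 phi0_sum3 mxE.
rewrite -sumrN; apply: eq_bigr => i _; rewrite mxE phi0_swap12; ring.
Qed.

Lemma mulSmx a u v : (u *m Smx a *m v^T) ord0 ord0 = phi0 (tri a u v).
Proof.
rewrite mxE [in RHS](row_sum_delta v) phi0_sum3; apply: eq_bigr => j _.
by rewrite row_mulSmx mulrC !mxE.
Qed.

Lemma Smx_self a : a *m Smx a = 0.
Proof. by apply/rowP => j; rewrite row_mulSmx mxE phi0_alt. Qed.

(** The double cross product a x (a x v) = <a, v> a - |a|^2 v, read off [sum_phi0_phi0] entry by
    entry; skewness supplies the sign. *)
Lemma Smx_sqr a : Smx a *m Smx a = a^T *m a - (dot a a)%:M.
Proof.
apply/matrixP => i j; rewrite !mxE.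
have := sum_phi0_phi0 a (e i) (e j).
have -> : dot (e i) (e j) = (i == j)%:R.
  by rewrite /dot (bigD1 i) //= !mxE !eqxx /= mul1r big1 ?addr0 // => k /negbTE ki;
    rewrite !mxE ki /= mul0r.
have dE k : dot (e k) a = a ord0 k.
  rewrite /dot (bigD1 k) //= !mxE !eqxx /= mul1r big1 ?addr0 // => l /negbTE ki.
  by rewrite !mxE ki /= mul0r.
rewrite [dot a (e j)]dotC !dE big_ord1 !mxE => H.
transitivity (- \sum_k phi0 (tri a (e i) (e k)) * phi0 (tri a (e j) (e k))).
  by rewrite -sumrN; apply: eq_bigr => k _; rewrite !mxE (phi0_swap12 _ (e j)) mulrN.
rewrite H; case: eqP => _ /=; ring.
Qed.

(** The bordered matrix [A] has two block triangular factorisations, one for each side. *)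
Lemma det_1Dmul n (x y : 'rV[R]_n) : \det (1%:M + x^T *m y) = 1 + (y *m x^T) ord0 ord0.
Proof.
pose A := block_mx 1%:M (- x^T) y (1%:M : 'M[R]_1).
have e1 : A = block_mx 1%:M 0 y 1%:M *m block_mx 1%:M (- x^T) 0 (1%:M + y *m x^T).
  rewrite mulmx_block !mul1mx !mul0mx !mulmx1 !addr0 mulmxN.
  by rewrite addrCA addNr addr0.
have e2 : A = block_mx 1%:M (- x^T) 0 1%:M *m block_mx (1%:M + x^T *m y) 0 y 1%:M.
  by rewrite mulmx_block !mul1mx !mul0mx !mulmx1 !add0r mulNmx addrK.
have : \det A = \det A by [].
rewrite {1}e2 e1 !det_mulmx !det_ublock !det_lblock !det1 !mul1r !mulr1 => ->.
by rewrite det_mx11 !mxE eqxx; congr (_ + _); apply: eq_bigr.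
Qed.

(** [Smx a] is singular, with [a] in its kernel. A congruence by a shear [L] fixes it and reduces
    [w] to a multiple of [a]; for the resulting [T], the product T T^T is a scalar times a rank one
    perturbation of the identity. Squaring avoids the sign of the determinant. *)
Lemma det_Smx_rank1 a w : dot a w != 0 ->
  \det (Smx a + w^T *m w) ^+ 2 = dot a a ^+ 4 * dot a w ^+ 4.
Proof.
move=> aw0; set r := dot a a.
have a0 : r != 0.
  by rewrite dot_eq0; apply: contra_neq aw0 => ->; rewrite /dot big1 // => i _; rewrite mxE mul0r.
pose al := dot a w / r; have al0 : al != 0 by rewrite mulf_neq0 ?invr_neq0.
(* Orthogonality of [x] to [a] gives the shear 1 + a^T x determinant 1; it sends [a] to a + r x,
   wanted parallel to [w]. Pairing with [a] forces the ratio [al]. *)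
have [x [xa xw]] : exists x, dot a x = 0 /\ a + r *: x = al^-1 *: w.
  exists ((al * r)^-1 *: (w - al *: a)); split.
    by rewrite dotZr dotDr -scaleNr dotZr -/r /al mulNr divfK // subrr mulr0.
  rewrite scalerA.
  have -> : r * (al * r)^-1 = al^-1 by field; rewrite a0 al0.
  by rewrite scalerBr scalerA mulVf // scale1r addrC subrK.
have [L [dL aL SL]] : exists L, [/\ \det L = 1, a *m L = al^-1 *: w &
    L^T *m Smx a *m L = Smx a].
  exists (1%:M + a^T *m x); split.
  - by rewrite det_1Dmul dotE -/(dot x a) dotC xa addr0.
  - by rewrite mulmxDr mulmx1 mulmxA mul_tr_dot -/r mul_scalar_mx.
  have ST : Smx a *m a^T = 0.
    by apply: trmx_inj; rewrite trmx_mul trmxK Smx_tr mulmxN Smx_self oppr0 trmx0.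
  have -> : (1%:M + a^T *m x)^T = 1%:M + x^T *m a.
    by rewrite [LHS]linearD /= trmx1 trmx_mul trmxK.
  rewrite mulmxDl mul1mx -mulmxA Smx_self mulmx0 addr0.
  by rewrite mulmxDr mulmx1 mulmxA ST mul0mx addr0.
have -> : Smx a + w^T *m w = L^T *m (Smx a + al ^+ 2 *: (a^T *m a)) *m L.
  rewrite (mulmxDr L^T) (mulmxDl _ _ L) SL; congr (_ + _).
  rewrite -scalemxAr -scalemxAl -!mulmxA aL mulmxA -trmx_mul aL.
  rewrite -scalemxAr [(_ *: w)^T]linearZ /= -scalemxAl !scalerA.
  set k := (X in _ = X *: _); have -> : k = 1 by rewrite /k; field.
  by rewrite scale1r.
rewrite !det_mulmx det_tr dL mul1r mulr1.
set T := Smx a + _.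
(* In T T^T the mixed products vanish, and [Smx_sqr] evaluates the square of [Smx a]. *)
have -> : \det T ^+ 2 = \det (T *m T^T) by rewrite det_mulmx det_tr.
have -> : T *m T^T = r *: (1%:M + ((al ^+ 4 * r - 1) / r *: a)^T *m a).
  have aS : Smx a *m (a^T *m a) = 0.
    by rewrite mulmxA -[Smx a]opprK -Smx_tr mulNmx -trmx_mul Smx_self trmx0 oppr0 mul0mx.
  have Sa : (a^T *m a) *m Smx a = 0 by rewrite -mulmxA Smx_self mulmx0.
  have aa : (a^T *m a) *m (a^T *m a) = r *: (a^T *m a).
    by rewrite -mulmxA [a *m _]mulmxA mul_tr_dot -/r mul_scalar_mx -scalemxAr.
  have -> : T^T = - Smx a + al ^+ 2 *: (a^T *m a).
    by rewrite /T [LHS]linearD /= [in X in _ + X]linearZ /= trmx_mul trmxK Smx_tr.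
  have key (S A : 'M[R]_7) k : S *m A = 0 -> A *m S = 0 ->
      (S + k *: A) *m (- S + k *: A) = - (S *m S) + (k * k) *: (A *m A).
    move=> SA AS; rewrite mulmxDr !mulmxDl !mulmxN -!scalemxAl AS -!scalemxAr SA.
    by rewrite !scaler0 oppr0 addr0 add0r scalerA.
  rewrite /T key // aa Smx_sqr -/r.
  apply/matrixP => i j; rewrite !mxE.
  rewrite !big_ord1 !mxE; move: (a ord0 i) (a ord0 j) => s t.
  by case: (i == j); rewrite ?mulr1n ?mulr0n; field.
rewrite detZ det_1Dmul linearZ /= -scalemxAr mxE dotE -/(dot a a) -/r.
rewrite /al; field.
by [].
Qed.

End Frames.

(** * Metric and Hodge star determined by a G2-form *)

Section MetricFromForm.
Context (R : realType).
Local Notation E := 'rV[R]_7.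
Local Notation e k := (delta_mx ord0 k : 'rV[R]_7).
Implicit Types (f : ('I_3 -> E) -> R) (B : 'M[R]_7) (u v w z : E) (k : 'I_7).

Definition is_frame f B := B \in unitmx /\ forall v : 'I_3 -> E, f v = phi0 (fun i => v i *m B).

Definition fmx f (u : E) : 'M[R]_7 := \matrix_(i, j) f (tri u (e i) (e j)).

Lemma frame_tri f B u v w : is_frame f B ->
  f (tri u v w) = phi0 (tri (u *m B) (v *m B) (w *m B)).
Proof. by move=> [_ ->]; rewrite -(tri_comp (fun u => u *m B)). Qed.

Lemma frame_fmx f B u : is_frame f B -> fmx f u = B *m Smx (u *m B) *m B^T.
Proof.
move=> fB; apply/matrixP => i j; rewrite mxE (frame_tri _ _ _ fB) -!rowE.
rewrite -mulSmx !mxE; apply: eq_bigr => k _; rewrite !mxE; congr (_ * _).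
by apply: eq_bigr => l _; rewrite !mxE.
Qed.

(* i_u phi has rank 6 and kernel u; the rank one term makes it invertible, and the
   determinant records |u|: see frame_Nf. *)
Definition Nf f (u : E) (k : 'I_7) : R := \det (fmx f u + (e k)^T *m e k) ^+ 2.

(** In frame coordinates the added term is w^T w for a [w] with <uB, w> = u_k = 1, so
    [det_Smx_rank1] applies; the outer factors B and B^T contribute (det B)^4. *)
Lemma frame_Nf f B u k : is_frame f B -> u ord0 k = 1 ->
  Nf f u k = (`|\det B| * dot (u *m B) (u *m B)) ^+ 4.
Proof.
move=> fB uk; have [Bu _] := fB.
pose w := e k *m (invmx B)^T.
have Bw : B *m w^T = (e k)^T by rewrite trmx_mul trmxK mulmxA mulmxV // mul1mx.
have dw : dot (u *m B) w = 1.
  rewrite -[LHS]dotE -mulmxA Bw mxE (bigD1 k) //= !mxE !eqxx mulr1 uk.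
  by rewrite big1 ?addr0 // => i /negbTE ik; rewrite !mxE ik mulr0.
rewrite /Nf (frame_fmx _ fB).
have -> : (e k)^T *m e k = B *m (w^T *m w) *m B^T.
  by rewrite mulmxA Bw -mulmxA; congr (_ *m _); apply: trmx_inj; rewrite trmx_mul trmxK Bw.
rewrite -mulmxDl -mulmxDr !det_mulmx det_tr !exprMn det_Smx_rank1 ?dw ?oner_eq0 //.
rewrite expr1n mulr1 (exprM `|\det B| 2 2) real_normK ?num_real //; ring.
Qed.

Definition root4 (x : R) := Num.sqrt (Num.sqrt x).

Lemma root4_exp y : 0 <= y -> root4 (y ^+ 4) = y.
Proof.
move=> y0; rewrite /root4 (exprM y 2 2) sqrtr_sqr ger0_norm ?sqr_ge0 //.
by rewrite sqrtr_sqr ger0_norm.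
Qed.

(* For a frame B of f this is |det B| B B^T, see conf_frame. *)
Definition conf f : 'M[R]_7 := \matrix_(i, j)
  if i == j then root4 (Nf f (e i) i)
  else (root4 (Nf f (e i + e j) i) - root4 (Nf f (e i) i) - root4 (Nf f (e j) j)) / 2.

(** Both e_i and e_i + e_j have i-th coordinate 1, as [frame_Nf] requires; polarisation yields the
    entries off the diagonal. *)
Lemma conf_frame f B : is_frame f B -> conf f = `|\det B| *: (B *m B^T).
Proof.
move=> fB.
have NE u k : u ord0 k = 1 -> root4 (Nf f u k) = `|\det B| * dot (u *m B) (u *m B).
  by move=> uk; rewrite (frame_Nf fB uk) root4_exp // mulr_ge0 ?dot_ge0.
have e1 i : (e i) ord0 i = 1 by rewrite mxE !eqxx.
have BE i j : dot (row i B) (row j B) = (B *m B^T) i j.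
  by rewrite mxE; apply: eq_bigr => k _; rewrite !mxE.
apply/matrixP => i j; rewrite mxE [RHS]mxE; case: eqP => [<-|/eqP ij].
  by rewrite NE // -rowE BE.
rewrite !NE //; last by rewrite !mxE !eqxx (negbTE ij) addr0.
rewrite mulmxDl -!rowE dotDl !dotDr !BE.
have -> : (B *m B^T) j i = (B *m B^T) i j by rewrite -!BE dotC.
by field.
Qed.

(** The ninth root undoes [det_conf]: scaling a 7 x 7 matrix by |det B| contributes |det B|^7, and
    det(B B^T) two more factors. Through [expR] and [ln] it is visibly continuous on positive
    numbers. *)
Definition root9 (x : R) := expR (9^-1 * ln x).

Lemma root9_exp y : 0 < y -> root9 (y ^+ 9) = y.
Proof.
move=> y0; rewrite /root9 lnXn // -[ln y *+ 9]mulr_natl mulrA mulVf ?mul1r ?lnK //.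
Qed.

Definition gmx f : 'M[R]_7 := (root9 (\det (conf f)))^-1 *: conf f.

Lemma det_conf f B : is_frame f B -> \det (conf f) = `|\det B| ^+ 9.
Proof.
move=> fB; rewrite (conf_frame fB) detZ det_mulmx det_tr -expr2 -(@real_normK _ (\det B)) ?num_real //.
by rewrite -exprD.
Qed.

Lemma frame_det_gt0 f B : is_frame f B -> 0 < `|\det B|.
Proof. by move=> [Bu _]; rewrite normr_gt0 -unitfE -unitmxE. Qed.

(* Hence all frames of f induce the same metric, i.e. the stabiliser of phi0 is
   orthogonal. *)
Lemma frame_gmx f B : is_frame f B -> B *m B^T = gmx f.
Proof.
move=> fB; have d0 := frame_det_gt0 fB.
rewrite /gmx (det_conf fB) root9_exp // (conf_frame fB) scalerA mulVf ?scale1r //.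
exact: lt0r_neq0.
Qed.

(** The cross product with its index lowered, a covector. It is spelled out through the coefficients
    of [f], which shows its continuity in [f]. *)
Definition cross f (u v : E) : E :=
  \row_p \sum_i \sum_j u ord0 i * v ord0 j * f (tri (e i) (e j) (e p)).

Lemma frame_cross f B u v p : is_frame f B ->
  cross f u v ord0 p = f (tri u v (e p)).
Proof.
move=> fB; rewrite mxE (frame_tri _ _ _ fB).
have mE (x : E) : x *m B = \sum_i x ord0 i *: (e i *m B).
  rewrite {1}[x](row_sum_delta x) mulmx_suml.
  by apply: eq_bigr => i _; rewrite scalemxAl.
rewrite [u *m B]mE phi0_sum1; apply: eq_bigr => i _.
rewrite [v *m B]mE phi0_sum2 mulr_sumr; apply: eq_bigr => j _.
by rewrite (frame_tri _ _ _ fB) mulrA.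
Qed.

Definition gdot f (u v : E) : R := (u *m gmx f *m v^T) ord0 ord0.

(** The formula of [psi4E] in arbitrary coordinates: the two covectors are paired by the inverse
    metric, written with the adjugate so as to be rational in the entries of the metric. *)
Definition star f (v : 'I_4 -> E) : R :=
  let: (u, v, w, z) := (v (inord 0), v (inord 1), v (inord 2), v (inord 3)) in
  (cross f u v *m ((\det (gmx f))^-1 *: \adj (gmx f)) *m (cross f w z)^T) ord0 ord0
  - (gdot f u w * gdot f v z - gdot f u z * gdot f v w).

Lemma frame_gdot f B u v : is_frame f B -> gdot f u v = dot (u *m B) (v *m B).
Proof. by move=> fB; rewrite /gdot -(frame_gmx fB) -[RHS]dotE trmx_mul !mulmxA. Qed.

Lemma frame_star f B (v : 'I_4 -> E) : is_frame f B ->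
  hodge (k := 3) (l := 4) (@phi0 R) (fun i => v i *m B) = star f v.
Proof.
move=> fB; rewrite /star.
rewrite [fun i => _]quadE hodge_phi0 psi4E.
rewrite !(frame_gdot _ _ fB); congr (_ - _).
set x := v (inord 0); set y := v (inord 1); set w := v (inord 2); set z := v (inord 3).
have cE s t : cross f s t = (\row_k phi0 (tri (s *m B) (t *m B) (e k))) *m B^T.
  apply/rowP => p; rewrite (frame_cross _ _ _ fB) (frame_tri _ _ _ fB).
  rewrite -mulSmx mxE [RHS]mxE; apply: eq_bigr => k _.
  by rewrite row_mulSmx -rowE !mxE.
rewrite !cE trmx_mul trmxK -(frame_gmx fB).
have [Bu _] := fB.
have -> : (\det (B *m B^T))^-1 *: \adj (B *m B^T) = invmx (B *m B^T).
  by rewrite /invmx unitmx_mul unitmx_tr Bu.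
(* Each lowered cross product carries a factor B^T or its transpose, which the inverse metric
   cancels. *)
have key : B^T *m invmx (B *m B^T) *m B = 1%:M.
  have GU : B *m B^T \in unitmx by rewrite unitmx_mul unitmx_tr Bu.
  have h : B *m (B^T *m invmx (B *m B^T) *m B) = B *m 1%:M.
    by rewrite mulmx1 !mulmxA mulmxV // mul1mx.
  move: (_ *m B) h => X h.
  by rewrite -[LHS]mul1mx -(mulVmx Bu) -mulmxA h mulmx1.
set a := \row_k _; set b := \row_k _.
have -> : a *m B^T *m invmx (B *m B^T) *m (B *m b^T) =
  a *m (B^T *m invmx (B *m B^T) *m B) *m b^T by rewrite !mulmxA.
rewrite key mulmx1.
by rewrite mxE; apply: eq_bigr => k _; rewrite !mxE.
Qed.

End MetricFromForm.

Section StarContinuous.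
Context (R : realType) (T : topologicalType) (x0 : T).
Local Notation E := 'rV[R]_7.
Local Notation e k := (delta_mx ord0 k : 'rV[R]_7).

(** The frame at [x0] makes the determinant of [conf] positive there, for the logarithm, and that of
    [gmx] nonzero, for the inverse. Frames at nearby points do not enter. *)
Lemma continuous_star (F : T -> ('I_3 -> E) -> R) (V : T -> 'I_4 -> E) B :
  (forall v, cont_at x0 (F ^~ v)) -> is_frame (F x0) B ->
  (forall i j, cont_at x0 (fun x => V x i ord0 j)) ->
  (cont_at x0 (fun x => star (F x) (V x))).
Proof.
move=> cF fB cV; have CC := @continuous_at_ring_class R T x0.
have cN u k : cont_at x0 (fun x => root4 (Nf (F x) u k)).
  have c1 : cont_at x0 (fun x => Nf (F x) u k).
    apply: (rc_mul CC (f := fun x => \det (fmx (F x) u + (e k)^T *m e k))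
                      (g := fun x => \det (fmx (F x) u + (e k)^T *m e k)));
    apply: (rc_det CC) => i j; under eq_fun do rewrite mxE [fmx _ _ _ _]mxE;
    by apply: (rc_add CC); [exact: cF | exact: (rc_cst CC)].
  apply: (continuous_comp (f := fun x => Num.sqrt (Nf (F x) u k)) (g := @Num.sqrt R));
    last exact: sqrt_continuous.
  by apply: (continuous_comp (g := @Num.sqrt R)) => //; exact: sqrt_continuous.
have cconf i j : cont_at x0 (fun x => conf (F x) i j).
  under eq_fun do rewrite mxE; case: eqP => _; first exact: cN.
  apply: (rc_mul CC); last exact: (rc_cst CC).
  by do 2?apply: (rc_sub CC).
have d0 : 0 < \det (conf (F x0)).
  by rewrite (det_conf fB) exprn_gt0 // (frame_det_gt0 fB).
have cdet : cont_at x0 (fun x => \det (conf (F x))) by exact: (rc_det CC).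
have cg i j : cont_at x0 (fun x => gmx (F x) i j).
  under eq_fun do rewrite mxE; apply: (rc_mul CC) => //.
  apply: continuousV; first by rewrite gt_eqF // expR_gt0.
  apply: (continuous_comp (f := fun x => 9^-1 * ln (\det (conf (F x)))) (g := @expR R));
    last exact: continuous_expR.
  apply: (rc_mul CC (f := fun=> 9^-1)); first exact: (rc_cst CC).
  by apply: (continuous_comp (g := @ln R)) => //; exact: continuous_ln.
have cgdot i j : cont_at x0 (fun x => gdot (F x) (V x i) (V x j)).
  apply: (rc_mulmx CC) => k l; last by rewrite (_ : (fun x => _) = (fun x => V x j ord0 k));
    [exact: cV | apply/funext => x; rewrite mxE ord1].
  by apply: (rc_mulmx CC) => // {}k m; rewrite ord1; exact: cV.
have ccross i j p : cont_at x0 (fun x => cross (F x) (V x i) (V x j) ord0 p).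
  under eq_fun do rewrite mxE; do 2!apply: (rc_sum CC) => ?.
  by apply: (rc_mul CC); [exact: (rc_mul CC) | exact: cF].
have G0 : \det (gmx (F x0)) != 0.
  by rewrite -(frame_gmx fB) -unitfE -unitmxE unitmx_mul unitmx_tr; case: fB => ->.
apply: (rc_sub CC); last by apply: (rc_sub CC); apply: (rc_mul CC).
apply: (rc_mulmx CC) => k l; last first.
  rewrite (_ : (fun x => _) = (fun x => cross (F x) (V x (inord 2)) (V x (inord 3)) ord0 k)).
    exact: ccross.
  by apply/funext => x; rewrite mxE ord1.
apply: (rc_mulmx CC) => [{}k {}l|{}k {}l]; first by rewrite ord1; exact: ccross.
under eq_fun do rewrite mxE; apply: (rc_mul CC); last exact: (rc_adj CC).
by apply: continuousV => //; exact: (rc_det CC).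
Qed.

End StarContinuous.

(** * Four-planes on which the form vanishes *)

Section Coassociative.
Context (R : realType).
Local Notation E := 'rV[R]_7.
Local Notation e k := (delta_mx ord0 k : 'rV[R]_7).

Lemma psi4_alt (u v w z : E) (i1 i2 : 'I_4) : i1 != i2 ->
  quad u v w z i1 = quad u v w z i2 -> psi4 u v w z = 0.
Proof.
move=> i12 uE.
have D0 a b c d : D4 u v w z a b c d = 0.
  rewrite /D4 -det_ndet (determinant_alternate i12) // => j; rewrite !mxE.
  by rewrite -[nth _ _ i1]/(quad u v w z i1) uE.
by rewrite /psi4 !D0 !addr0 !subr0.
Qed.

Lemma gram_det_neq0 m (U : 'M[R]_(m, 7)) : row_free U -> \det (U *m U^T) != 0.
Proof.
move=> Uf; apply/det0P => -[v v0 vU].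
have : dot (v *m U) (v *m U) = 0.
  by rewrite -[LHS]dotE trmx_mul mulmxA -(mulmxA v) vU mul0mx mxE.
move/eqP; rewrite dot_eq0 => /eqP vU0.
by move/negP: v0; apply; rewrite -(mulmx_free_eq0 v Uf) vU0.
Qed.

(* The four vectors p0 x p1, p0 x p2, p0 x p3, p2 x p3 lie in the 3-dimensional
   orthogonal complement of the p_i, so their Gram determinant vanishes; by
   psi4E it equals g00 * det (g_ij)_(i,j = 0,2,3) * (det g - psi4 ^+ 2). *)
Lemma psi4_sqr (p : 'I_4 -> E) :
  row_free (\matrix_i p i) ->
  (forall i j k, phi0 (tri (p i) (p j) (p k)) = 0) ->
  psi4 (p (inord 0)) (p (inord 1)) (p (inord 2)) (p (inord 3)) ^+ 2 =
  \det (\matrix_(i, j) dot (p i) (p j)).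
Proof.
move=> Uf p0; pose q k := p (inord k); set psi := psi4 _ _ _ _.
pose c i j : E := \row_k phi0 (tri (q i) (q j) (e k)).
have cp i j k : dot (c i j) (p k) = 0.
  rewrite -(p0 (inord i) (inord j) k) [in RHS](row_sum_delta (p k)) phi0_sum3.
  by apply: eq_bigr => l _; rewrite mxE mulrC.
have cc i j k l : dot (c i j) (c k l) = psi4 (q i) (q j) (q k) (q l)
    + (dot (q i) (q k) * dot (q j) (q l) - dot (q i) (q l) * dot (q j) (q k)).
  rewrite psi4E subrK; apply: eq_bigr => m _; by rewrite !mxE.
pose r i := nth 0 [:: c 0%N 1%N; c 0%N 2%N; c 0%N 3%N; c 2%N 3%N] i.
pose C : 'M[R]_(4, 7) := \matrix_(i < 4) r i.
have CU : C *m (\matrix_i p i)^T = 0.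
  apply/matrixP => i j; rewrite !mxE.
  transitivity (dot (r i) (p j)); first by apply: eq_bigr => k _; rewrite !mxE.
  by case: i => -[|[|[|[|]]]] ? //=; rewrite cp.
have detC : \det (C *m C^T) = 0.
  apply/eqP; apply: contraT => d0.
  have := mulmx0_rank_max CU; rewrite mxrank_tr (eqP Uf).
  have := mxrankM_maxl C C^T; rewrite [in X in (X <= _)%N]mxrank_unit ?unitmxE ?unitfE //.
  lia.
pose g i j := dot (q i) (q j).
have gC i j : g i j = g j i by rewrite /g dotC.
have pE (i : 'I_4) : p i = q i by rewrite /q inord_val.
have gramE : \det (\matrix_(i, j) dot (p i) (p j)) = ndet 4 g.
  by rewrite -det_ndet; congr (\det _); apply/matrixP => i j; rewrite !mxE !pE.
have CE : \det (C *m C^T) = ndet 4 (fun i j => dot (r i) (r j)).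
  rewrite -det_ndet; congr (\det _); apply/matrixP => i j; rewrite !mxE.
  by apply: eq_bigr => k _; rewrite !mxE.
have alt a b c' d (i1 i2 : 'I_4) : i1 != i2 -> quad (q a) (q b) (q c') (q d) i1 =
    quad (q a) (q b) (q c') (q d) i2 -> psi4 (q a) (q b) (q c') (q d) = 0.
  by move=> *; apply: (@psi4_alt _ _ _ _ i1 i2).
pose m := ndet 3 (fun i j => g (nth 0%N [:: 0; 2; 3] i) (nth 0%N [:: 0; 2; 3] j))%N.
have key : ndet 4 (fun i j => dot (r i) (r j)) = g 0%N 0%N * m * (ndet 4 g - psi ^+ 2).
  have o (i j : nat) : (i < 4)%N -> (j < 4)%N -> i != j -> (inord i : 'I_4) != inord j.
    by move=> i4 j4 ij; rewrite -val_eqE /= !inordK.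
  have a02 a b d : psi4 (q a) (q b) (q a) (q d) = 0.
    by apply: (@alt _ _ _ _ (inord 0) (inord 2)); rewrite ?o // /quad !inordK.
  have a12 a b d : psi4 (q a) (q b) (q b) (q d) = 0.
    by apply: (@alt _ _ _ _ (inord 1) (inord 2)); rewrite ?o // /quad !inordK.
  have a13 a b d : psi4 (q a) (q b) (q d) (q b) = 0.
    by apply: (@alt _ _ _ _ (inord 1) (inord 3)); rewrite ?o // /quad !inordK.
  have e10 : dot (c 2%N 3%N) (c 0%N 1%N) = dot (c 0%N 1%N) (c 2%N 3%N) by rewrite dotC.
  have e20 : dot (c 2%N 3%N) (c 0%N 2%N) = dot (c 0%N 2%N) (c 2%N 3%N) by rewrite dotC.
  have e30 : dot (c 2%N 3%N) (c 0%N 3%N) = dot (c 0%N 3%N) (c 2%N 3%N) by rewrite dotC.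
  rewrite /m !ndet4E !ndet3E /= /r /= e10 e20 e30 !cc.
  rewrite !a02 !a12 !a13 -/(psi4 _ _ _ _) -[psi4 _ _ _ _]/psi -!/(g _ _).
  rewrite (gC 1%N 0%N) (gC 2%N 0%N) (gC 3%N 0%N) (gC 2%N 1%N) (gC 3%N 1%N) (gC 3%N 2%N).
  generalize (g 0%N 0%N) (g 0%N 1%N) (g 0%N 2%N) (g 0%N 3%N) (g 1%N 1%N) (g 1%N 2%N)
    (g 1%N 3%N) (g 2%N 2%N) (g 2%N 3%N) (g 3%N 3%N) psi => *.
  ring.
have g00 : g 0%N 0%N != 0.
  rewrite dot_eq0; apply/eqP => q0.
  have := mulmx_free_eq0 (delta_mx ord0 (inord 0) : 'rV[R]_4) Uf.
  rewrite -rowE rowK -/(q 0%N) q0 eqxx => /esym/eqP/rowP/(_ (inord 0))/eqP.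
  by rewrite !mxE !eqxx oner_eq0.
have m0 : m != 0.
  pose U' : 'M[R]_(3, 7) := \matrix_(i < 3) q (nth 0 [:: 0; 2; 3] i)%N.
  have -> : m = \det (U' *m U'^T).
    rewrite /m -det_ndet; congr (\det _); apply/matrixP => i j; rewrite !mxE.
    by apply: eq_bigr => k _; rewrite !mxE.
  apply: gram_det_neq0; apply: inj_row_free => v vU.
  (* [v] extended by zero at the index 1, which is omitted from (0, 2, 3). *)
  pose v' : 'rV[R]_4 := v ord0 (inord 0) *: delta_mx ord0 (inord 0)
    + v ord0 (inord 1) *: delta_mx ord0 (inord 2)
    + v ord0 (inord 2) *: delta_mx ord0 (inord 3).
  have : v' *m (\matrix_i p i) = 0.
    rewrite /v' !mulmxDl -!scalemxAl -!rowE !rowK -vU.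
    rewrite [v in RHS]row_sum_delta mulmx_suml !big_ord_recl big_ord0 addr0 addrA.
    congr (_ + _ + _); rewrite -scalemxAl -rowE rowK; congr (_ *: _); rewrite ?/q.
    - by congr (v _ _); apply/val_inj; rewrite /= inordK.
    - by congr (v _ _); apply/val_inj; rewrite /= inordK.
    - by congr (v _ _); apply/val_inj; rewrite /= inordK.
  move/eqP; rewrite mulmx_free_eq0 // => /eqP/rowP v'0.
  apply/rowP => i; rewrite mxE.
  have := v'0 (inord 0); have := v'0 (inord 2); have := v'0 (inord 3).
  rewrite !mxE -!val_eqE /= !inordK //= !mulr1 !mulr0 !addr0 !add0r => h2 h1 h0.
  by case: i => -[|[|[|//]]] Hi;
    [rewrite -[RHS]h0|rewrite -[RHS]h1|rewrite -[RHS]h2]; congr (v _ _);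
    apply/val_inj; rewrite /= inordK.
rewrite gramE; apply/eqP; rewrite eq_sym -subr_eq0.
have /eqP := detC; rewrite CE key mulf_eq0 mulf_eq0 (negbTE g00) (negbTE m0) /=.
by [].
Qed.

Lemma star_sqr f B (s : 'I_4 -> E) : is_frame f B ->
  row_free (\matrix_i s i) ->
  (forall i j k, f (tri (s i) (s j) (s k)) = 0) ->
  star f s ^+ 2 = \det (\matrix_(i, j) gdot f (s i) (s j)).
Proof.
move=> fB sf fs; have [Bu _] := fB.
rewrite -(frame_star _ fB) [fun i => _]quadE hodge_phi0 (psi4_sqr (p := fun i => s i *m B)).
- by congr (\det _); apply/matrixP => i j; rewrite !mxE (frame_gdot _ _ fB).
- have -> : \matrix_i (s i *m B) = (\matrix_i s i) *m B.
    by apply/row_matrixP => i; rewrite row_mul !rowK.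
  by rewrite /row_free mxrankMfree // row_free_unit.
- by move=> i j k; rewrite -(frame_tri _ _ _ fB).
Qed.

(** When the cross product vanishes, [sum_phi0_phi0] reads |a|^2 <b, z> = <a, z> <a, b> for every z,
    so b equals its projection onto a. *)
Lemma frame_dependent f B (u v : E) : is_frame f B -> u != 0 ->
  (forall w, f (tri u v w) = 0) -> exists c, v = c *: u.
Proof.
move=> fB u0 fuv; have [Bu _] := fB.
set a := u *m B; set b := v *m B.
have ab w : phi0 (tri a b w) = 0.
  have := fuv (w *m invmx B).
  by rewrite (frame_tri _ _ _ fB) -mulmxA mulVmx // mulmx1.
have a0 : dot a a != 0.
  rewrite dot_eq0; apply: contra u0 => /eqP aB.
  by rewrite -[u]mulmx1 -(mulmxV Bu) mulmxA -/a aB mul0mx.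
exists (dot a b / dot a a).
have bE : b = (dot a b / dot a a) *: a.
  apply/rowP => j; rewrite [RHS]mxE.
  have := sum_phi0_phi0 a b (e j).
  rewrite big1 => [|k _]; last by rewrite ab mul0r.
  have dE x : dot x (e j) = x ord0 j.
    rewrite /dot (bigD1 j) //= !mxE !eqxx /= mulr1 big1 ?addr0 // => l /negbTE ki.
    by rewrite !mxE ki /= mulr0.
  rewrite !dE [dot b a]dotC => /esym/eqP; rewrite subr_eq0 => /eqP H.
  by apply: (mulfI a0); rewrite /= H; field.
have vb : v = b *m invmx B by rewrite -mulmxA mulmxV // mulmx1.
by rewrite {1}vb {1}bE -scalemxAl -mulmxA mulmxV // mulmx1.
Qed.

End Coassociative.

(** * Differential calculus and the inverse function theorem *)

Section Directional.
Context {R : realType} {V V' W : normedModType R}.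
Implicit Types (f : V' -> W) (A L : V -> V').

(** Both difference quotients are the same function of [h], so their limits agree, existing or
    not. *)
Lemma derive_comp_affine f A L (x v : V) :
  (forall h : R, A (h *: v + x) = h *: L v + A x) ->
  'D_v (f \o A) x = 'D_(L v) f (A x).
Proof.
move=> AL; rewrite /derive.
suff -> : (fun h : R => h^-1 *: ((f \o A) (h *: v + x) - (f \o A) x)) =
  (fun h : R => h^-1 *: (f (h *: L v + A x) - f (A x))) by [].
by apply/funext => h /=; rewrite AL.
Qed.

Lemma derivable_comp_affine f A L (x v : V) :
  (forall h : R, A (h *: v + x) = h *: L v + A x) ->
  derivable (f \o A) x v <-> derivable f (A x) (L v).
Proof.
move=> AL; rewrite /derivable.
suff -> : (fun h : R => h^-1 *: ((f \o A) (h *: v + x) - (f \o A) x)) =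
  (fun h : R => h^-1 *: (f (h *: L v + A x) - f (A x))) by [].
by apply/funext => h /=; rewrite AL.
Qed.

End Directional.

Section Line.
Context {R : realType} {V W : normedModType R}.
Implicit Types (f : V -> W).

Lemma derivable_lineP f (a v : V) (s : R) :
  derivable (fun s : R => f (s *: v + a)) s 1 <-> derivable f (s *: v + a) v.
Proof.
have := @derivable_comp_affine R R V W f (fun s => s *: v + a) (fun s => s *: v) s 1.
rewrite scale1r; apply => h /=.
by rewrite scalerDl addrA /GRing.scale /= mulr1.
Qed.

Lemma derive_line f (a v : V) (s : R) :
  'D_1 (fun s : R => f (s *: v + a)) s = 'D_v f (s *: v + a).
Proof.
have := @derive_comp_affine R R V W f (fun s => s *: v + a) (fun s => s *: v) s 1.
rewrite scale1r; apply => h /=.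
by rewrite scalerDl addrA /GRing.scale /= mulr1.
Qed.

(** Restriction to a line turns this into a one-variable chain rule, where derivable and
    differentiable agree; c = 0 is included. *)
Lemma derivable_scale f (x v : V) (c : R) : derivable f x v ->
  derivable f x (c *: v) /\ 'D_(c *: v) f x = c *: 'D_v f x.
Proof.
move=> fv; pose g s := f (s *: v + x).
have gx : x = (0 : R) *: v + x by rewrite scale0r add0r.
have g0 : derivable g 0 1 by apply/derivable_lineP; rewrite -gx.
have AL h : (c * (h *: (1 : R) + 0) : R) = h *: c + c * 0.
  by rewrite mulr0 addr0 addr0 /GRing.scale /= mulr1 mulrC.
have dg : differentiable g 0 by apply/derivable1_diffP.
have E : (fun s : R => f (s *: (c *: v) + x)) = g \o (fun h : R => c * h).
  by apply/funext => s; rewrite /g /= scalerA mulrC.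
split.
  rewrite gx -[X in derivable _ _ X]/(c *: v).
  have := derivable_lineP f x (c *: v) 0; rewrite !scale0r !add0r => <-.
  rewrite E; apply/(@derivable_comp_affine R R R W g (fun h => c * h) (fun=> c)) => //.
  by rewrite mulr0; apply: diff_derivable.
have := derive_line f x (c *: v) 0; rewrite !scale0r !add0r => <-.
rewrite E (@derive_comp_affine R R R W g (fun h => c * h) (fun=> c)) // mulr0.
rewrite deriveE // -[X in 'd g 0 X]mulr1 -[c * 1]/(c *: (1 : R)) linearZ /= -deriveE //.
by rewrite derive_line scale0r add0r.
Qed.

End Line.

Section MeanValue.
Context {R : realType} {V : normedModType R}.

Lemma MVT_dir (f : V -> R^o) (a v : V) :
  (forall s : R, 0 <= s <= 1 -> derivable f (s *: v + a) v) ->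
  exists2 s, 0 <= s <= 1 & f (v + a) - f a = 'D_v f (s *: v + a).
Proof.
move=> fd; pose g (s : R) := f (s *: v + a).
have gd s : s \in `[0, 1]%R -> derivable g s 1.
  by rewrite in_itv /= => s01; apply/derivable_lineP/fd.
have [|s|s] := @MVT_segment R g (fun s => 'D_v f (s *: v + a)) 0 1 ler01.
- move=> x /[!in_itv]/= /andP[x0 x1]; rewrite -derive_line.
  by apply/derivableP/gd; rewrite in_itv /= !ltW.
- exact: derivable_within_continuous.
rewrite in_itv /= => s01; rewrite /g scale1r scale0r add0r subr0 mulr1 => E.
by exists s.
Qed.

End MeanValue.

(** * Strict differentiability and the chain rule *)

Section StrictDiff.
Context {R : realType} {n : nat}.
Local Notation E := 'rV[R]_n.
Implicit Types (f : E -> R^o) (x y z : E).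

(** Strict differentiability at [x] with partial derivatives [d]: the estimate is uniform in both
    endpoints, as the contraction in [local_bijection] demands. *)
Definition sdiff f x (d : 'I_n -> R) := forall e, 0 < e -> exists2 r, 0 < r &
  forall y z, `|y - x| < r -> `|z - x| < r ->
    `|f z - f y - \sum_i (z - y) ord0 i * d i| <= e * `|z - y|.

Lemma coord_le_norm (x : E) i : `|x ord0 i| <= `|x|.
Proof.
rewrite [leRHS]/Num.Def.normr /= mx_normrE.
exact: (le_bigmax _ (fun ij : 'I_1 * 'I_n => `|x ij.1 ij.2|) (ord0, i)).
Qed.

Lemma norm_ltP (x : E) r : 0 < r -> (forall i, `|x ord0 i| < r) -> `|x| < r.
Proof.
move=> r0 xr; rewrite [ltLHS]/Num.Def.normr /= mx_normrE.
by apply: bigmax_lt => // -[i j] _ /=; rewrite ord1.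
Qed.

(** One coordinate is changed at a time between [y] and [z], with the mean value theorem on each
    step; continuity of the partial derivatives at [x] makes the errors uniform. *)
Lemma C1_sdiff f U x : open U -> Ck_on 1 U f -> U x ->
  sdiff f x (fun i => 'D_(delta_mx ord0 i) f x).
Proof.
move=> oU [_ fU] Ux e e0.
(* Each of the n steps may cost [e']; n + 1 keeps the denominator nonzero for n = 0. *)
pose e' := e / n.+1%:R; have e'0 : 0 < e' by rewrite divr_gt0 // ltr0Sn.
have : \forall y \near x, U y /\ forall i : 'I_n,
    `|'D_(delta_mx ord0 i) f y - 'D_(delta_mx ord0 i) f x| <= e'.
  near=> y; split; first by near: y; exact: open_nbhs_nbhs.
  near: y; apply: filter_forall => i.
  have [_ [ci _]] := fU (delta_mx ord0 i).
  have /cvgrPdist_le /(_ _ e'0) := ci x Ux.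
  by apply: filterS => y; rewrite distrC.
move=> /nbhs_ballP[r r0 rU]; exists r => // y z yx zx.
have ballP w : `|w - x| < r -> ball x r w by rewrite -ball_normE /= distrC.
(* Corner [k] of the path has the first k coordinates of [z] and the others of [y]; in the maximum
   norm it stays within [r] of [x]. *)
pose w k : E := \row_j if (j < k)%N then z ord0 j else y ord0 j.
have wx k : `|w k - x| < r.
  apply: norm_ltP => // i; rewrite !mxE; case: ifP => _.
    by apply: le_lt_trans zx; have := coord_le_norm (z - x) i; rewrite !mxE.
  by apply: le_lt_trans yx; have := coord_le_norm (y - x) i; rewrite !mxE.
have w0 : w 0%N = y by apply/rowP => j; rewrite mxE.
have wn : w n = z by apply/rowP => j; rewrite mxE ltn_ord.
have wS (k : 'I_n) : w k.+1 = ((z - y) ord0 k) *: delta_mx ord0 k + w k.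
  apply/rowP => j; rewrite !mxE eqxx /= ltnS leq_eqVlt.
  case: (eqVneq j k) => [->|jk]; first by rewrite eqxx ltnn /= mulr1 subrK.
  rewrite mulr0 add0r (_ : (j == k :> nat) = false) //.
  exact: negbTE jk.
have -> : f z - f y = \sum_(k < n) (f (w k.+1) - f (w k)).
  by rewrite -(big_mkord xpredT (fun k => f (w k.+1) - f (w k))) telescope_sumr // wn w0.
rewrite -sumrB; apply: le_trans (ler_norm_sum _ _ _) _.
have step (k : 'I_n) : `|f (w k.+1) - f (w k) - (z - y) ord0 k * 'D_(delta_mx ord0 k) f x|
    <= e' * `|z - y|.
  set c := (z - y) ord0 k.
  have wkr (s : R) : 0 <= s <= 1 -> `|s *: (c *: delta_mx ord0 k) + w k - x| < r.
    move=> /andP[s0 s1].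
    have -> : s *: (c *: delta_mx ord0 k) + w k - x =
        s *: (w k.+1 - x) + (1 - s) *: (w k - x).
      rewrite wS -/c; apply/rowP => j; rewrite !mxE; ring.
    apply: le_lt_trans (ler_normD _ _) _; rewrite !normrZ (ger0_norm s0).
    have s1' : 0 <= 1 - s by rewrite subr_ge0.
    rewrite (ger0_norm s1').
    have h1 := wx k; have h2 := wx k.+1.
    have n1 := normr_ge0 (w k - x); have n2 := normr_ge0 (w k.+1 - x).
    by case: (ltrP s 1) => hs; nra.
  have dU s : 0 <= s <= 1 ->
      derivable f (s *: (c *: delta_mx ord0 k) + w k) (c *: delta_mx ord0 k).
    move=> s01; have [+ _] := fU (c *: delta_mx ord0 k); apply.
    by have [] := rU _ (ballP _ (wkr s s01)).
  have [s s01] := MVT_dir dU; rewrite -wS => ->.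
  have [Us Ds] := rU _ (ballP _ (wkr s s01)).
  have [dk _] := fU (delta_mx ord0 k).
  have [_ ->] := derivable_scale c (dk _ Us).
  rewrite -[c *: _]/(c * _) -mulrBr normrM mulrC ler_pM //; exact: coord_le_norm.
apply: le_trans (ler_sum _ (fun k _ => step k)) _.
rewrite sumr_const card_ord -mulr_natl mulrA ler_wpM2r // /e' mulrCA.
by rewrite ger_pMr // ler_pdivrMr ?ltr0Sn // mul1r ler_nat.
Unshelve. all: by end_near. Qed.

End StrictDiff.

Section ChainRule.
Context {R : realType} {V : normedModType R} {n : nat}.
Local Notation E := 'rV[R]_n.

(** [f] is derivable in the direction [v] only, so the increment of [g] is estimated along the curve
    h |-> f(hv + x) alone. *)
Lemma sdiff_comp (f : V -> E) (g : E -> R^o) (x v : V) d :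
  derivable f x v -> sdiff g (f x) d ->
  derivable (g \o f) x v /\ 'D_v (g \o f) x = \sum_i ('D_v f x) ord0 i * d i.
Proof.
move=> fv gd; pose q (h : R) := h^-1 *: (f (h *: v + x) - f x).
have qv : q h @[h --> 0^'] --> 'D_v f x by exact: fv.
suff H : (h^-1 *: ((g \o f) (h *: v + x) - (g \o f) x)) @[h --> 0^'] -->
    (\sum_i ('D_v f x) ord0 i * d i : R^o).
  by split; [apply/cvg_ex; exists (\sum_i ('D_v f x) ord0 i * d i) | exact: cvg_lim].
(* [M] bounds the difference quotients of [f] near 0, hence its increments by |h| M. *)
pose M := `|'D_v f x| + 1; have M0 : 0 < M by rewrite ltr_wpDl.
have qM : \forall h \near 0^', `|q h| <= M.
  have /cvgrPdist_le /(_ _ ltr01) := qv; apply: filterS => h hq.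
  rewrite -[q h](subrK ('D_v f x)) addrC; apply: le_trans (ler_normD _ _) _.
  by rewrite lerD2l distrC.
have sumc : (\sum_i (q h) ord0 i * d i) @[h --> 0^'] --> \sum_i ('D_v f x) ord0 i * d i.
  apply: (@cvg_comp _ _ _ q (fun u : E => \sum_i u ord0 i * d i) _ _ _ qv).
  rewrite -/(continuous_at _ _).
  have CC := @continuous_at_ring_class R E ('D_v f x).
  have : cont_at ('D_v f x) (fun u : E => \sum_i u ord0 i * d i).
    apply: (rc_sum CC) => i; apply: (rc_mul CC); last exact: (rc_cst CC).
    exact: coord_continuous.
  by [].
apply/cvgrPdist_le => e e0.
have e2 : 0 < e / 2 by rewrite divr_gt0.
have eM : 0 < e / 2 / M by rewrite divr_gt0.
have [r r0 gr] := gd _ eM.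
near=> h.
have h0 : h != 0 by near: h; exact: nbhs_dnbhs_neq.
have Mh : `|q h| <= M by near: h.
have hr : `|h| < r / M by near: h; apply: dnbhs0_lt; rewrite divr_gt0.
have fhE : f (h *: v + x) - f x = h *: q h by rewrite /q scalerA divff // scale1r.
have fr : `|f (h *: v + x) - f x| < r.
  rewrite fhE normrZ; apply: le_lt_trans (ler_wpM2l (normr_ge0 h) Mh) _.
  by rewrite -ltr_pdivlMr.
have := gr (f x) (f (h *: v + x)); rewrite subrr normr0 => /(_ r0 fr).
have -> : \sum_i (f (h *: v + x) - f x) ord0 i * d i = h * \sum_i (q h) ord0 i * d i.
  by rewrite mulr_sumr fhE; apply: eq_bigr => i _; rewrite mxE mulrA.
rewrite fhE normrZ => H.
rewrite -[X in `|X - _|](subrK (\sum_i (q h) ord0 i * d i)) -addrA.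
apply: le_trans (ler_normD _ _) _; rewrite (splitr e) lerD //.
  by near: h; move/cvgrPdist_le : sumc; apply.
have -> : \sum_i (q h) ord0 i * d i - h^-1 *: (g (f (h *: v + x)) - g (f x)) =
    - (h^-1 * (g (f (h *: v + x)) - g (f x) - h * \sum_i (q h) ord0 i * d i)).
  by rewrite mulrBr mulKf // opprB.
rewrite normrN normrM normfV ler_pdivrMl ?normr_gt0 //.
apply: le_trans H _; rewrite mulrCA ler_wpM2l //.
by rewrite mulrAC ler_pdivrMr // ler_wpM2l // ltW.
Unshelve. all: by end_near. Qed.

End ChainRule.

(** * Closure properties of C^k maps *)

Section Ck.
Context {R : realType}.

Lemma Ck_on_continuous {V W : normedModType R} k (U : set V) (f : V -> W) x :
  Ck_on k U f -> U x -> {for x, continuous f}.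
Proof. by case: k => [|k] [fc _]; apply: fc. Qed.

Lemma Ck_on_leq {V W : normedModType R} k l (U : set V) (f : V -> W) :
  (k <= l)%N -> Ck_on l U f -> Ck_on k U f.
Proof.
elim: k l f => [|k IH] [|l] f //; first by move=> _ [].
move=> kl [fc fd]; split=> // v; have [dv /IH] := fd v.
by move=> /(_ kl).
Qed.

Lemma Ck_on_sub {V W : normedModType R} k (U U' : set V) (f : V -> W) :
  U' `<=` U -> Ck_on k U f -> Ck_on k U' f.
Proof.
move=> sU; elim: k f => [|k IH] f [fc fd]; split=> //; try by move=> x /sU; exact: fc.
by move=> v; have [dv dk] := fd v; split=> [x /sU|]; [exact: dv | exact: IH].
Qed.

Lemma near_open {V : topologicalType} (U : set V) (Q : V -> Prop) x : open U -> U x ->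
  (forall y, U y -> Q y) -> \forall y \near x, Q y.
Proof. by move=> oU Ux UQ; apply: filterS UQ _; exact: open_nbhs_nbhs. Qed.

Lemma near_eq_continuous_at {V W : topologicalType} (f g : V -> W) x :
  (\forall y \near x, f y = g y) -> {for x, continuous f} -> {for x, continuous g}.
Proof.
move=> fg; rewrite /prop_for /continuous_at (nbhs_singleton fg) => fc.
by apply: cvg_trans fc; apply: near_eq_cvg; apply: filterS fg => y /esym.
Qed.

Lemma Ck_on_ext {V W : normedModType R} k (U : set V) (f g : V -> W) : open U ->
  (forall x, U x -> f x = g x) -> Ck_on k U f -> Ck_on k U g.
Proof.
move=> oU; elim: k f g => [|k IH] f g fg [fc fd]; split=> //;
  try by move=> x Ux; apply: near_eq_continuous_at (fc _ Ux); exact: near_open fg.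
move=> v; have [dv dk] := fd v; split=> [x Ux|].
  by apply: near_eq_derivable (dv _ Ux); exact: near_open fg.
  by apply: IH dk => x Ux; apply: near_eq_derive; exact: near_open fg.
Qed.

Lemma Ck_on_cst {V W : normedModType R} k (U : set V) (c : W) : Ck_on k U (fun=> c).
Proof.
elim: k c => [|k IH] c; split=> //; try by move=> ? _; exact: cst_continuous.
move=> v.
split=> [x _|]; first exact: derivable_cst.
by rewrite (_ : 'D_v _ = (fun=> 0)) //; apply/funext => x; exact: derive_cst.
Qed.

Lemma Ck_onD {V W : normedModType R} k (U : set V) (f g : V -> W) : open U ->
  Ck_on k U f -> Ck_on k U g -> Ck_on k U (fun x => f x + g x).
Proof.
move=> oU; elim: k f g => [|k IH] f g [fc fd] [gc gd]; split=> //;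
  try by move=> x Ux; exact: (continuousD (fc x Ux) (gc x Ux)).
move=> v; have [fv fk] := fd v; have [gv gk] := gd v; split=> [x Ux|].
    exact: (derivableD (fv x Ux) (gv x Ux)).
  apply: (Ck_on_ext oU _ (IH _ _ fk gk)) => x Ux.
  by rewrite -(deriveD (fv x Ux) (gv x Ux)).
Qed.

Lemma Ck_onM {V : normedModType R} k (U : set V) (f g : V -> R^o) : open U ->
  Ck_on k U f -> Ck_on k U g -> Ck_on k U (fun x => f x * g x : R^o).
Proof.
move=> oU; elim: k f g => [|k IH] f g F G.
  by split=> // x Ux; apply: continuousM; [case: F => + _|case: G => + _]; apply.
have [fc fd] := F; have [gc gd] := G.
split=> [x Ux|v]; first exact: (continuousM (fc x Ux) (gc x Ux)).
have [fv fk] := fd v; have [gv gk] := gd v; split=> [x Ux|].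
  exact: (derivableM (fv x Ux) (gv x Ux)).
have F' := Ck_on_leq (leqnSn k) F; have G' := Ck_on_leq (leqnSn k) G.
apply: (Ck_on_ext oU _ (Ck_onD oU (IH _ _ F' gk) (IH _ _ G' fk))) => x Ux.
by rewrite (_ : (fun x => f x * g x) = f * g) // (deriveM (fv x Ux) (gv x Ux)).
Qed.

Lemma Ck_on_ring_class {V : normedModType R} k (U : set V) : open U ->
  ring_class (fun f : V -> R => Ck_on k U (f : V -> R^o)).
Proof.
move=> oU; split=> [c|f g|f g]; [exact: Ck_on_cst | exact: Ck_onD | exact: Ck_onM].
Qed.

Lemma Ck_onV {V : normedModType R} k (U : set V) (f : V -> R^o) : open U ->
  (forall x, U x -> f x != 0) -> Ck_on k U f -> Ck_on k U (fun x => (f x)^-1 : R^o).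
Proof.
move=> oU f0; elim: k => [|k IH] F; have [fc fd] := F.
  by split=> // x Ux; apply: continuousV; [exact: f0 | exact: fc].
split=> [x Ux|v]; first by apply: continuousV; [exact: f0 | exact: fc].
have [fv fk] := fd v; split=> [x Ux|]; first exact: derivableV (f0 x Ux) (fv x Ux).
have IH' := IH (Ck_on_leq (leqnSn k) F).
have C := Ck_on_ring_class k oU.
have H : Ck_on k U (fun x => - ((f x)^-1 * ((f x)^-1 * 'D_v f x)) : R^o).
  by apply: (rc_opp C); apply: (rc_mul C) => //; apply: (rc_mul C).
apply: (Ck_on_ext oU _ H) => x Ux.
rewrite deriveV; [|exact: f0|exact: fv].
rewrite /GRing.scale /= -exprVn; ring.
Qed.

Lemma Ck_on_mx {V : normedModType R} {n} k (U : set V) (f : V -> 'rV[R]_n) :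
  open U ->
  Ck_on k U f <-> forall i, Ck_on k U (fun x => f x ord0 i : R^o).
Proof.
move=> oU; elim: k f => [|k IH] f.
  split=> [[fc _] i|H]; split=> // x Ux.
    exact: (continuous_comp (fc x Ux) (@coord_continuous _ _ _ _ _ _)).
  apply/cvgrPdist_le => e e0.
  have : \forall y \near x, forall i : 'I_n, `|f x ord0 i - f y ord0 i| <= e.
    apply: filter_forall => i; have [+ _] := H i.
    by move=> /(_ x Ux) /cvgrPdist_le /(_ e e0).
  apply: filterS => y H'; rewrite [leLHS]/Num.Def.normr /= mx_normrE.
  by apply: (bigmax_le _ (ltW e0)) => -[i j] _ /=; rewrite ord1 !mxE.
have contP : (forall x, U x -> {for x, continuous f}) <->
    forall i x, U x -> {for x, continuous (fun x => f x ord0 i : R^o)}.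
  split=> [fc i x Ux|H x Ux].
    exact: (continuous_comp (fc x Ux) (@coord_continuous _ _ _ _ _ _)).
  apply/cvgrPdist_le => e e0.
  have : \forall y \near x, forall i : 'I_n, `|f x ord0 i - f y ord0 i| <= e.
    by apply: filter_forall => i; have /cvgrPdist_le /(_ e e0) := H i x Ux.
  apply: filterS => y H'; rewrite [leLHS]/Num.Def.normr /= mx_normrE.
  by apply: (bigmax_le _ (ltW e0)) => -[i j] _ /=; rewrite ord1 !mxE.
have dE v x i : derivable f x v -> 'D_v f x ord0 i = 'D_v (fun x => f x ord0 i : R^o) x.
  by move=> fv; rewrite derive_mx // mxE.
split=> [[fc fd] i|H].
  split=> [x Ux|v]; first by apply: (contP.1 fc).
  have [fv fk] := fd v; split=> [x Ux|]; first by have /derivable_mxP := fv x Ux; apply.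
  apply: (Ck_on_ext oU _ ((IH _).1 fk i)) => x Ux; exact: dE (fv x Ux).
split; first by apply/contP => i x Ux; have [+ _] := H i; apply.
move=> v; have fv x : U x -> derivable f x v.
  move=> Ux; apply/derivable_mxP => i j; rewrite ord1.
  by have [_ /(_ v)[+ _]] := H j; apply.
split=> //; apply/IH => i; have [_ /(_ v)[_ Hk]] := H i.
by apply: (Ck_on_ext oU _ Hk) => x Ux; rewrite dE //; exact: fv.
Qed.

Lemma C1_comp {V : normedModType R} {n} (O : set 'rV[R]_n)
    (f : V -> 'rV[R]_n) (g : 'rV[R]_n -> R^o) x v : open O -> Ck_on 1 O g ->
  O (f x) -> derivable f x v ->
  derivable (g \o f) x v /\
  'D_v (g \o f) x = \sum_i ('D_v f x) ord0 i * 'D_(delta_mx ord0 i) g (f x).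
Proof. by move=> oO gO Ofx fv; apply: sdiff_comp fv (C1_sdiff oO gO Ofx). Qed.

(** Induction on [k]: D_v (g o f) is a sum of products of coordinates of D_v f with partial
    derivatives of [g] composed with [f]. The source is an arbitrary normed space because the action
    is differentiated on a product. *)
Lemma Ck_on_comp1 {V : normedModType R} {n} k (U : set V) (O : set 'rV[R]_n)
    (f : V -> 'rV[R]_n) (g : 'rV[R]_n -> R^o) : open U -> open O ->
  (forall x, U x -> O (f x)) -> Ck_on k U f -> Ck_on k O g -> Ck_on k U (g \o f).
Proof.
move=> oU oO UO; elim: k f g UO => [|k IH] f g UO F G.
  split=> // x Ux; apply: continuous_comp; first exact: Ck_on_continuous F Ux.
  exact: (Ck_on_continuous G (UO x Ux)).
split=> [x Ux|v].
  apply: continuous_comp; first exact: Ck_on_continuous F Ux.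
  exact: (Ck_on_continuous G (UO x Ux)).
have G1 : Ck_on 1 O g by apply: Ck_on_leq G.
have fv x : U x -> derivable f x v by have [_ /(_ v)[+ _]] := F; apply.
split=> [x Ux|]; first by have [] := C1_comp oO G1 (UO x Ux) (fv x Ux).
have H : Ck_on k U (fun x => \sum_i ('D_v f x) ord0 i * 'D_(delta_mx ord0 i) g (f x) : R^o).
  apply: (rc_sum (Ck_on_ring_class k oU)) => i; apply: (rc_mul (Ck_on_ring_class k oU)).
    by have [_ /(_ v)[_ /(Ck_on_mx k _ oU)]] := F; apply.
  apply: (IH f ('D_(delta_mx ord0 i) g) UO); first exact: Ck_on_leq (leqnSn k) F.
  by have [_ /(_ (delta_mx ord0 i))[]] := G.
apply: (Ck_on_ext oU _ H) => x Ux.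
by have [_ ->] := C1_comp oO G1 (UO x Ux) (fv x Ux).
Qed.

Lemma Ck_on_comp {V : normedModType R} {n m} k (U : set V) (O : set 'rV[R]_n)
    (f : V -> 'rV[R]_n) (g : 'rV[R]_n -> 'rV[R]_m) : open U -> open O ->
  (forall x, U x -> O (f x)) -> Ck_on k U f -> Ck_on k O g -> Ck_on k U (g \o f).
Proof.
move=> oU oO UO F /(Ck_on_mx k _ oO) G; apply/(Ck_on_mx k _ oU) => i.
exact: (Ck_on_comp1 (g := fun y => g y ord0 i : R^o) oU oO UO F (G i)).
Qed.

(** Serves to freeze one argument of the action in charts; [L] is the linear part of [A]. *)
Lemma Ck_on_comp_affine {V V' W : normedModType R} k (U : set V') (A L : V -> V')
    (f : V' -> W) : continuous A -> (forall (h : R) v x, A (h *: v + x) = h *: L v + A x) ->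
  Ck_on k U f -> Ck_on k (A @^-1` U) (f \o A).
Proof.
move=> Ac AL; elim: k f => [|k IH] f [fc fd]; split=> //;
  try by move=> x Ux; apply: continuous_comp; [exact: Ac | exact: fc].
move=> v; have [fv fk] := fd (L v); split=> [x Ux|].
    by apply/(derivable_comp_affine _ (AL ^~ v ^~ x)); exact: fv.
  rewrite (_ : 'D_v _ = 'D_(L v) f \o A); first exact: IH.
  by apply/funext => x; apply: derive_comp_affine => h; exact: AL.
Qed.

End Ck.

Section NormForms.
Context {R : realType} {V : normedModType R}.

Lemma nbhs_norm_ex (Q : set V) (x : V) : nbhs x Q ->
  exists2 r : R, 0 < r & forall y : V, `|y - x| < r -> Q y.
Proof.
move=> /nbhs_ballP[r r0 rQ]; exists r => // y yx.
by apply: rQ; rewrite -ball_normE /= distrC.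
Qed.

Lemma open_norm_ex (U : set V) (x : V) : open U -> U x ->
  exists2 r : R, 0 < r & forall y : V, `|y - x| < r -> U y.
Proof. by move=> oU Ux; apply: nbhs_norm_ex; exact: open_nbhs_nbhs. Qed.

Lemma continuous_norm_ex (W : normedModType R) (g : V -> W) (x : V) (e : R) :
  {for x, continuous g} -> 0 < e ->
  exists2 r : R, 0 < r & forall y : V, `|y - x| < r -> `|g y - g x| <= e.
Proof.
move=> /cvgrPdist_le gx e0; apply: nbhs_norm_ex.
by have := gx e e0; apply: filterS => y; rewrite distrC.
Qed.

Lemma norm_continuous_at (W : normedModType R) (g : V -> W) (x : V) :
  (forall e : R, 0 < e ->
    exists2 r : R, 0 < r & forall y : V, `|y - x| < r -> `|g y - g x| <= e) ->
  {for x, continuous g}.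
Proof.
move=> H; apply/cvgrPdist_le => e e0; have [r r0 rH] := H e e0.
apply/nbhs_ballP; exists r => // y; rewrite -ball_normE /= distrC [leLHS]distrC.
exact: rH.
Qed.

End NormForms.

(** * Symmetry of second derivatives *)

Section Schwarz.
Context {R : realType} {V : normedModType R}.
Implicit Types (f : V -> R^o) (U : set V) (x y u v : V).

(** The mean value theorem twice: for y |-> f(hv + y) - f(y) along hu, then for D_u f along hv. *)
Let second_difference f U x r u v (h : R) :
  (forall y, `|y - x| < r -> U y) -> open U -> Ck_on 2 U f ->
  0 < h -> h * (`|u| + `|v|) < r ->
  exists2 y, `|y - x| < r &
    f (h *: v + (h *: u + x)) - f (h *: u + x) - (f (h *: v + x) - f x) =
    h * h * 'D_v ('D_u f) y.
Proof.
move=> rU oU F h0 hr.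
have nr (s t : R) : 0 <= s <= 1 -> 0 <= t <= 1 ->
    `|s *: (h *: v) + (t *: (h *: u) + x) - x| < r.
  move=> /andP[s0 s1] /andP[t0 t1]; rewrite addrA addrK; apply: le_lt_trans hr.
  apply: le_trans (ler_normD _ _) _; rewrite !normrZ.
  rewrite (ger0_norm s0) (ger0_norm t0) (gtr0_norm h0).
  have n1 := normr_ge0 v; have n2 := normr_ge0 u.
  have hv : 0 <= h * `|v| by rewrite mulr_ge0 // ltW.
  have hu : 0 <= h * `|u| by rewrite mulr_ge0 // ltW.
  rewrite mulrDr; nra.
have s0 : 0 <= (0 : R) <= 1 by rewrite lexx ler01.
have s1 : 0 <= (1 : R) <= 1 by rewrite lexx ler01.
have nr0 t : 0 <= t <= 1 -> `|t *: (h *: u) + x - x| < r.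
  by move=> /(nr 0 t s0); rewrite scale0r add0r.
have [_ F1] := F; have [fu [_ F2]] := F1 u; have [fuv _] := F2 v.
pose g y := f (h *: v + y) - f y.
have gd (t : R) : 0 <= t <= 1 ->
    is_derive (t *: (h *: u) + x) (h *: u) g
      (h * ('D_u f (h *: v + (t *: (h *: u) + x)) - 'D_u f (t *: (h *: u) + x))).
  move=> t01; set y := t *: (h *: u) + x.
  have Uy : U y by apply: rU; exact: nr0.
  have Uvy : U (h *: v + y).
    by apply: rU; have := nr 1 t s1 t01; rewrite scale1r.
  have AL (k : R) : h *: v + (k *: (h *: u) + y) = k *: (h *: u) + (h *: v + y).
    by rewrite addrCA.
  have [d1 e1] := derivable_scale h (fu _ Uy).
  have [d2 e2] := derivable_scale h (fu _ Uvy).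
  have d2' : derivable (f \o (fun y => h *: v + y)) y (h *: u).
    exact/(@derivable_comp_affine _ _ _ _ f (fun y => h *: v + y) id y (h *: u) AL).
  rewrite mulrBr; apply: is_deriveB; split=> //.
    by rewrite (@derive_comp_affine _ _ _ _ f (fun y => h *: v + y) id y (h *: u) AL).
have [|t t01] := @MVT_dir _ _ g x (h *: u); first by move=> t /gd [].
have [_ ->] := gd t t01; rewrite /g => ->.
have dd (s : R) : 0 <= s <= 1 -> derivable ('D_u f) (s *: (h *: v) + (t *: (h *: u) + x)) (h *: v).
  by move=> s01; have [] := derivable_scale h (fuv _ (rU _ (nr s t s01 t01))).
have [s s01 ->] := MVT_dir dd.
have [_ ->] := derivable_scale h (fuv _ (rU _ (nr s t s01 t01))).
exists (s *: (h *: v) + (t *: (h *: u) + x)); first exact: nr.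
by rewrite -mulrA.
Qed.

Let ler_dist_half (a b c e : R) : `|c - a| <= e / 2 -> `|c - b| <= e / 2 -> `|a - b| <= e.
Proof. by rewrite !ler_norml => /andP[? ?] /andP[? ?]; apply/andP; split; lra. Qed.

(** The second difference is symmetric in [u] and [v], so one mixed derivative at some point near
    [x] equals the other at another such point; continuity brings both to [x]. *)
Lemma derive_sym f U x u v : open U -> Ck_on 2 U f -> U x ->
  'D_v ('D_u f) x = 'D_u ('D_v f) x.
Proof.
move=> oU F Ux.
have cF a b : {for x, continuous ('D_b ('D_a f))}.
  by have [_ F1] := F; have [_ [_ F2]] := F1 a; have [_ [+ _]] := F2 b; apply.
apply/eqP; rewrite -subr_eq0 -normr_eq0 eq_le normr_ge0 andbT.
apply/ler_addgt0Pr => e e0; rewrite add0r.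
have e2 : 0 < e / 2 by rewrite divr_gt0.
have [r1 r10 rU] := open_norm_ex oU Ux.
have [r2 r20 ru] := continuous_norm_ex (cF u v) e2.
have [r3 r30 rv] := continuous_norm_ex (cF v u) e2.
pose r := Num.min r1 (Num.min r2 r3).
have r0 : 0 < r by rewrite !lt_min r10 r20.
have rU' y : `|y - x| < r -> U y by rewrite lt_min => /andP[/rU].
(* The parallelogram spanned by hu and hv must stay within [r]; the 1 covers u = v = 0. *)
pose h := r / 2 / (`|u| + `|v| + 1).
have M0 : 0 < `|u| + `|v| + 1 by rewrite ltr_wpDl // addr_ge0.
have h0 : 0 < h by rewrite !divr_gt0.
have hr : h * (`|u| + `|v|) < r.
  rewrite /h mulrAC ltr_pdivrMr //; have := normr_ge0 u; have := normr_ge0 v; nra.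
have [y1 y1r E1] := second_difference rU' oU F h0 hr.
have [y2 y2r E2] := second_difference (u := v) (v := u) rU' oU F h0
  (etrans (congr1 (fun z => h * z < r) (addrC _ _)) hr).
have : h * h * 'D_v ('D_u f) y1 = h * h * 'D_u ('D_v f) y2.
  apply: (etrans (esym E1)); apply: etrans E2; rewrite [h *: u + (h *: v + x)]addrCA.
  by rewrite !opprB addrACA [- _ + _]addrC addrACA.
move/mulfI => /(_ (mulf_neq0 (lt0r_neq0 h0) (lt0r_neq0 h0))) E.
have d1 : `|'D_v ('D_u f) y1 - 'D_v ('D_u f) x| <= e / 2.
  by apply: ru; move: y1r; rewrite !lt_min => /and3P[].
have d2 : `|'D_u ('D_v f) y2 - 'D_u ('D_v f) x| <= e / 2.
  by apply: rv; move: y2r; rewrite !lt_min => /and3P[].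
by rewrite E in d1; exact: ler_dist_half d1 d2.
Qed.

End Schwarz.

(** * The inverse function theorem *)

HB.instance Definition _ (R : realType) (m n : nat) := Complete.on 'M[R]_(m, n).

Section Jacobian.
Context {R : realType} {n : nat}.
Local Notation E := 'rV[R]_n.
Implicit Types (F : E -> E) (U : set E) (x y z p v : E) (A : 'M[R]_n).

Definition jac F x : 'M[R]_n := \matrix_(i, j) 'D_(delta_mx ord0 i) F x ord0 j.

(** A bound for the operator norm in the maximum norm; the 1 makes it positive, so that it may be
    divided by. *)
Definition mx_bound A : R := 1 + \sum_i \sum_j `|A i j|.

Lemma mx_bound_gt0 A : 0 < mx_bound A.
Proof. by rewrite ltr_wpDr // sumr_ge0 // => i _; apply: sumr_ge0. Qed.

Lemma norm_leP x r : 0 <= r -> (forall i, `|x ord0 i| <= r) -> `|x| <= r.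
Proof.
move=> r0 xr; rewrite [leLHS]/Num.Def.normr /= mx_normrE.
by apply: bigmax_le => // -[i j] _ /=; rewrite ord1.
Qed.

Lemma norm_mulmx_le A v : `|v *m A| <= mx_bound A * `|v|.
Proof.
apply: norm_leP => [|j]; first by rewrite mulr_ge0 // ltW // mx_bound_gt0.
rewrite mxE; apply: le_trans (ler_norm_sum _ _ _) _.
apply: (@le_trans _ _ ((\sum_i \sum_j `|A i j|) * `|v|)); last first.
  by rewrite ler_wpM2r // /mx_bound lerDr.
rewrite mulr_suml; apply: ler_sum => i _; rewrite normrM mulrC ler_pM //.
  rewrite (bigD1 j) //= lerDl; exact: sumr_ge0.
exact: coord_le_norm.
Qed.

Lemma C1_derive_jac F U x v : open U -> Ck_on 1 U F -> U x ->
  'D_v F x = v *m jac F x.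
Proof.
move=> oU FU Ux; apply/rowP => j; rewrite mxE.
have Fv w : derivable F x w by have [_ /(_ w)[+ _]] := FU; apply.
have [_ H] := C1_comp (f := @id E) oU ((Ck_on_mx 1 F oU).1 FU j) Ux (@derivable_id _ _ x v).
have dE w : 'D_w F x ord0 j = 'D_w (fun y => F y ord0 j : R^o) x by rewrite derive_mx // mxE.
rewrite dE (_ : (fun y => F y ord0 j : R^o) = (fun y => F y ord0 j : R^o) \o id) // H.
by rewrite derive_id; apply: eq_bigr => i _; rewrite mxE dE.
Qed.

Lemma sdiff_vec F U x e : open U -> Ck_on 1 U F -> U x -> 0 < e ->
  exists2 r : R, 0 < r & forall y z, `|y - x| < r -> `|z - x| < r ->
    `|F z - F y - (z - y) *m jac F x| <= e * `|z - y|.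
Proof.
move=> oU FU Ux e0.
have FUj := (Ck_on_mx 1 F oU).1 FU.
have Fv w : derivable F x w by have [_ /(_ w)[+ _]] := FU; apply.
have dE j w : 'D_w F x ord0 j = 'D_w (fun y => F y ord0 j : R^o) x by rewrite derive_mx // mxE.
have : \forall r \near 0^'+, forall j : 'I_n, forall y z, `|y - x| < r -> `|z - x| < r ->
    `|(F z - F y - (z - y) *m jac F x) ord0 j| <= e * `|z - y|.
  apply: filter_forall => j.
  have [r r0 H] := C1_sdiff oU (FUj j) Ux e0.
  near=> s => y z ys zs.
  have sr : s <= r by near: s; exact: nbhs_right_le.
  have := H y z (lt_le_trans ys sr) (lt_le_trans zs sr).
  have E1 : ((z - y) *m jac F x) ord0 j = \sum_i (z - y) ord0 i *
      'D_(delta_mx ord0 i) (fun y => F y ord0 j : R^o) x.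
    by rewrite mxE; apply: eq_bigr => i _; rewrite [jac _ _ _ _]mxE dE.
  by rewrite -E1 !mxE.
move=> /(filterI (nbhs_right_gt 0))/filter_ex[r [r0 H]]; exists r => // y z yx zx.
by apply: norm_leP => [|j]; [rewrite mulr_ge0 // ltW | exact: H].
Unshelve. all: by end_near. Qed.

(** Newton's iteration with the derivative frozen at [p]: x |-> x - (F x - w) A^-1 is 1/2-Lipschitz
    on a ball, and its fixed points solve F x = w. The same estimate gives |z - y| <= |z - y|/2 + K0
    |F z - F y|, whence K = 2 K0. *)
Lemma local_bijection F U p : open U -> Ck_on 1 U F -> U p -> jac F p \in unitmx ->
  exists K r : R, [/\ 0 < K, 0 < r, forall x, `|x - p| <= r -> U x,
    forall y z, `|y - p| <= r -> `|z - p| <= r -> `|z - y| <= K * `|F z - F y| &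
    forall w, K * `|w - F p| < r -> exists2 x, `|x - p| < r & F x = w].
Proof.
move=> oU FU Up Ju; set A := jac F p in Ju *.
pose K0 := mx_bound (invmx A); have K00 : 0 < K0 := mx_bound_gt0 _.
(* This error, multiplied by the bound [K0] of the inverse, leaves the factor 1/2. *)
have e0 : 0 < (2 * K0)^-1 by rewrite invr_gt0 mulr_gt0.
have [r1 r10 H1] := sdiff_vec oU FU Up e0.
have [r2 r20 H2] := open_norm_ex oU Up.
(* Halved, so that the closed ball lies in both open balls. *)
pose r := Num.min r1 r2 / 2.
have m0 : 0 < Num.min r1 r2 by rewrite lt_min r10 r20.
have r0 : 0 < r by rewrite divr_gt0.
have rm : r < Num.min r1 r2 by rewrite /r ltr_pdivrMr // ltr_pMr // ltr1n.
have rr1 x : `|x - p| <= r -> `|x - p| < r1.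
  by move=> h; move: (le_lt_trans h rm); rewrite lt_min => /andP[].
have rU x : `|x - p| <= r -> U x.
  by move=> h; apply: H2; move: (le_lt_trans h rm); rewrite lt_min => /andP[].
pose T w x := x - (F x - w) *m invmx A.
have Tlip w y z : `|y - p| <= r -> `|z - p| <= r -> `|T w z - T w y| <= 2^-1 * `|z - y|.
  move=> yr zr; have H := H1 y z (rr1 _ yr) (rr1 _ zr).
  have -> : T w z - T w y = - ((F z - F y - (z - y) *m A) *m invmx A).
    have -> : F z - F y = (F z - w) - (F y - w) by rewrite opprB addrA subrK.
    rewrite [X in _ = - X]mulmxBl -[(_ *m A) *m _]mulmxA mulmxV // mulmx1 [X in _ = - (X - _)]mulmxBl /T.
    move: ((F z - w) *m invmx A) ((F y - w) *m invmx A) => X Y.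
    by apply/rowP => i; rewrite !mxE; ring.
  rewrite normrN; apply: le_trans (norm_mulmx_le _ _) _; rewrite -/K0.
  apply: le_trans (ler_wpM2l (ltW K00) H) _.
  by rewrite mulrA invfM mulrCA mulfV ?mulr1 // lt0r_neq0.
exists (2 * K0), r; split=> //; first by rewrite mulr_gt0.
  move=> y z yr zr; have H := Tlip 0 y z yr zr.
  have E1 : z - y = (T 0 z - T 0 y) + (F z - F y) *m invmx A.
    rewrite /T !subr0 mulmxBl.
    move: (F z *m _) (F y *m _) => X Y.
    by apply/rowP => i; rewrite !mxE; ring.
  have H3 : `|z - y| <= 2^-1 * `|z - y| + K0 * `|F z - F y|.
    rewrite {1}E1; apply: le_trans (ler_normD _ _) _; apply: lerD => //.
    exact: norm_mulmx_le.
  by move: (`|z - y|) (`|F z - F y|) H3 => a b; lra.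
move=> w wr; pose B : set E := closed_ball_ Num.norm p r.
have BE x : B x <-> `|x - p| <= r by rewrite /B /closed_ball_ /= distrC.
have pB : `|p - p| <= r by rewrite subrr normr0 ltW.
have TB : {homo T w : x / B x >-> B x}.
  move=> x /BE xr; apply/BE; rewrite -(subrK (T w p) (T w x)) -addrA.
  apply: le_trans (ler_normD _ _) _.
  have h1 := Tlip w p x pB xr.
  have h2 : `|T w p - p| <= K0 * `|w - F p|.
    rewrite /T addrC addKr -mulNmx opprB.
    exact: norm_mulmx_le.
  move: (`|T w x - T w p|) (`|T w p - p|) (`|x - p|) (`|w - F p|) xr h1 h2 wr.
  by move=> a b c d; lra.
pose Tf : {fun B >-> B} := HB.pack (T w) (isFun.Build E E B B (T w) TB).
have ctr : is_contraction Tf.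
  exists (2^-1)%:nng; split; first by rewrite /= invf_lt1 ?ltr1n.
  by move=> [y z] [/BE yr /BE zr] /=; exact: Tlip.
have [x Bx xT] := banach_fixed_point ctr (@closed_closed_ball_ _ _ _ _) (ex_intro _ p ((BE p).2 pB)).
have xr := (BE x).1 Bx.
have Fx : F x = w.
  apply/eqP; rewrite -subr_eq0.
  have : (F x - w) *m invmx A = 0.
    move: xT; rewrite /= /T => /eqP; rewrite -subr_eq0 opprB addrC addrNK.
    by move/eqP.
  by move=> /(congr1 (mulmx^~ A)); rewrite -mulmxA mulVmx // mulmx1 mul0mx => ->.
exists x => //.
(* The fixed point is so far known to lie in the closed ball only; the contraction gives |x - p| <=
   2 K0 |w - F p| < r. *)
have := Tlip w p x pB xr.
have xT' : T w x = x by rewrite {2}xT.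
have h2 : `|T w p - p| <= K0 * `|w - F p|.
  rewrite /T addrC addKr -mulNmx opprB.
  exact: norm_mulmx_le.
have h3 : `|x - p| <= `|T w x - T w p| + `|T w p - p|.
  by rewrite -{1}xT' -(subrKA (T w p)); exact: ler_normD.
move: (`|T w x - T w p|) (`|T w p - p|) (`|x - p|) (`|w - F p|) h2 h3 wr.
by move=> a b c d; lra.
Qed.

Lemma open_norm_sub U : (forall x, U x ->
  exists2 r : R, 0 < r & forall y, `|y - x| < r -> U y) -> open U.
Proof.
move=> H; rewrite openE => x /H[r r0 rU]; apply/nbhs_ballP; exists r => // y.
by rewrite -ball_normE /= distrC; exact: rU.
Qed.

Lemma open_norm_ball p (r : R) : open [set y : E | `|y - p| < r].
Proof.
apply: open_norm_sub => x /= xr; exists (r - `|x - p|); first by rewrite subr_gt0.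
move=> y; rewrite ltrBrDr => yx; apply: le_lt_trans yx.
by rewrite -{1}(subrKA x); exact: ler_normD.
Qed.

Lemma smooth_jac F U k : open U -> smooth_on U F ->
  forall i j, Ck_on k U (fun x => jac F x i j : R^o).
Proof.
move=> oU FU i j; have [_ /(_ (delta_mx ord0 i))[_ H]] := FU k.+1.
apply: (Ck_on_ext oU _ ((Ck_on_mx k _ oU).1 H j)) => x _.
by rewrite mxE.
Qed.

Lemma smooth_on_sub U U' F : U' `<=` U -> smooth_on U F -> smooth_on U' F.
Proof. by move=> sU FU k; exact: Ck_on_sub sU (FU k). Qed.

Lemma open_jac_unit F U : open U -> smooth_on U F ->
  open [set x | U x /\ jac F x \in unitmx].
Proof.
move=> oU FU; apply: open_norm_sub => x [Ux].
rewrite unitmxE unitfE => d0.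
have [r r0 rU] := open_norm_ex oU Ux.
have C : Ck_on 0 U (fun x => \det (jac F x) : R^o).
  by apply: (rc_det (Ck_on_ring_class 0 oU)) => i j; exact: smooth_jac.
have e0 : 0 < `|\det (jac F x)| / 2 by rewrite divr_gt0 // normr_gt0.
have [r1 r10 rd] := continuous_norm_ex (Ck_on_continuous C Ux) e0.
exists (Num.min r r1); first by rewrite lt_min r0 r10.
move=> y; rewrite lt_min => /andP[/rU Uy /rd dy]; split=> //.
rewrite unitmxE unitfE; apply: contraL dy => /eqP ->.
rewrite sub0r normrN -ltNge ltr_pdivrMr // ltr_pMr ?ltr1n // normr_gt0 //.
Qed.

(** Strict differentiability compares [F] at G(y) and at G(hw + y) with an error relative to the
    increment of [G]; the Lipschitz bound makes it relative to [h]. *)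
Lemma inverse_derive F G U (K : R) y w : open U -> Ck_on 1 U F -> U (G y) ->
  jac F (G y) \in unitmx -> 0 < K ->
  (\forall h \near 0^', F (G (h *: w + y)) = h *: w + y /\
     `|G (h *: w + y) - G y| <= K * `|h *: w|) -> F (G y) = y ->
  derivable G y w /\ 'D_w G y = w *m invmx (jac F (G y)).
Proof.
move=> oU FU UG Ju K0 HG FGy; set x := G y in UG Ju HG FGy *; set J := jac F x in Ju *.
suff H : (h^-1 *: (G (h *: w + y) - x)) @[h --> 0^'] --> w *m invmx J.
  by split; [apply/cvg_ex; exists (w *m invmx J) | exact: cvg_lim].
apply/cvgrPdist_le => e e0.
(* Absorbs the bound of the inverse Jacobian, the Lipschitz constant and the length of [w]. *)
pose e' := e / (mx_bound (invmx J) * (K * (`|w| + 1))).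
have w1 : 0 < `|w| + 1 by rewrite ltr_wpDl.
have B0 := mx_bound_gt0 (invmx J).
have e'0 : 0 < e' by rewrite divr_gt0 // !mulr_gt0.
have [r r0 Hr] := sdiff_vec oU FU UG e'0.
near=> h.
have h0 : h != 0 by near: h; exact: nbhs_dnbhs_neq.
have [Fh Gh] : F (G (h *: w + y)) = h *: w + y /\
     `|G (h *: w + y) - x| <= K * `|h *: w| by near: h.
have hr : `|h| < r / (K * (`|w| + 1)).
  by near: h; apply: dnbhs0_lt; rewrite divr_gt0 // mulr_gt0.
set xh := G (h *: w + y) in Fh Gh.
have xhr : `|xh - x| < r.
  apply: le_lt_trans Gh _; rewrite normrZ mulrCA.
  apply: (@le_lt_trans _ _ (`|h| * (K * (`|w| + 1)))).
    by rewrite ler_wpM2l // ler_wpM2l ?lerDl // ltW.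
  by rewrite -ltr_pdivlMr // mulr_gt0.
have := Hr x xh; rewrite subrr normr0 => /(_ r0 xhr).
rewrite Fh FGy addrK => H.
have -> : w *m invmx J - h^-1 *: (xh - x) = h^-1 *: ((h *: w - (xh - x) *m J) *m invmx J).
  rewrite mulmxBl -mulmxA mulmxV // mulmx1 -scalemxAl !scalerBr scalerA mulVf //.
  by rewrite scale1r.
rewrite normrZ normfV ler_pdivrMl ?normr_gt0 //.
apply: le_trans (norm_mulmx_le _ _) _.
apply: le_trans (ler_wpM2l (ltW B0) H) _.
apply: (@le_trans _ _ (mx_bound (invmx J) * (e' * (K * (`|h| * (`|w| + 1)))))).
  rewrite ler_wpM2l ?(ltW B0) // ler_wpM2l ?(ltW e'0) //; apply: le_trans Gh _.
  by rewrite ler_wpM2l ?(ltW K0) // normrZ ler_wpM2l // lerDl.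
rewrite /e' le_eqVlt; apply/orP; left; apply/eqP; field.
by rewrite !lt0r_neq0.
Unshelve. all: by end_near. Qed.

Theorem inverse_function F U p : open U -> smooth_on U F -> U p ->
  (forall v, 'D_v F p = 0 -> v = 0) ->
  exists (O : set E) (G : E -> E) (r : R), [/\ open O, O p, O `<=` U, 0 < r &
    [/\ forall x, O x -> `|F x - F p| < r, forall y, `|y - F p| < r -> O (G y),
        forall x, O x -> G (F x) = x, forall y, `|y - F p| < r -> F (G y) = y &
        smooth_on [set y : E | `|y - F p| < r] G]].
Proof.
move=> oU FU Up Finj.
(* Invertibility of the Jacobian is wanted at every point, so that [inverse_derive] applies
   throughout the image. *)
pose U1 := [set x | U x /\ jac F x \in unitmx].
have oU1 : open U1 by exact: open_jac_unit.
have sU1 : U1 `<=` U by move=> x [].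
have FU1 : smooth_on U1 F := smooth_on_sub sU1 FU.
have Jp : jac F p \in unitmx.
  rewrite -row_free_unit; apply: inj_row_free => v vJ; apply: Finj.
  by rewrite (C1_derive_jac v oU (FU 1%N) Up).
have U1p : U1 p by [].
have [K [r [K0 r0 rU1 Flip Fsurj]]] := local_bijection oU1 (FU1 1%N) U1p Jp.
pose s := r / K; have s0 : 0 < s by rewrite divr_gt0.
have sE y : (`|y - F p| < s) = (K * `|y - F p| < r) by rewrite /s ltr_pdivlMr // mulrC.
(* The preimage in the ball about [p], and [p] itself where there is none. *)
pose G (y : E) : E := xget p [set x : E | `|x - p| < r /\ F x = y].
have GP y : `|y - F p| < s -> `|G y - p| < r /\ F (G y) = y.
  rewrite sE => /Fsurj[x xr Fx].
  have Px : [set x : E | `|x - p| < r /\ F x = y] x by [].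
  exact: (xgetI p Px).
pose O := [set x : E | `|x - p| < r /\ `|F x - F p| < s].
pose V := [set y : E | `|y - F p| < s].
have oV : open V by exact: open_norm_ball.
have Glip y z : V y -> V z -> `|G z - G y| <= K * `|z - y|.
  move=> /GP[yr Fy] /GP[zr Fz]; have := Flip _ _ (ltW yr) (ltW zr).
  by rewrite Fy Fz.
exists O, G, s; split => //.
- apply: open_norm_sub => x [xr Fx].
  have [a a0 Ha] := open_norm_ex (@open_norm_ball p r) xr.
  have Ux : U x by apply: sU1; apply: rU1; exact: ltW.
  have [b b0 Hb] := open_norm_ex oV Fx.
  have b20 : 0 < b / 2 by rewrite divr_gt0.
  have [c c0 Hc] := continuous_norm_ex (Ck_on_continuous (FU 0%N) Ux) b20.
  exists (Num.min a c); first by rewrite lt_min a0 c0.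
  move=> y; rewrite lt_min => /andP[/Ha yr /Hc Fy]; split=> //.
  apply: Hb; apply: le_lt_trans Fy _.
  by rewrite ltr_pdivrMr // ltr_pMr // ltr1n.
- by split=> /=; rewrite subrr normr0.
- by move=> x [xr _]; apply: sU1; apply: rU1; exact: ltW.
split.
- by move=> x [].
- by move=> y ys; have [Gr Fy] := GP y ys; split=> //=; rewrite Fy.
- move=> x [xr Fx]; have [Gr FG] := GP _ Fx.
  apply/eqP; rewrite -subr_eq0 -normr_le0.
  have := Flip _ _ (ltW xr) (ltW Gr); rewrite FG subrr normr0 mulr0 //.
- by move=> y /GP[].
have GU1 y : V y -> U1 (G y) by move=> /GP[yr _]; apply: rU1; exact: ltW.
have dG y w : V y -> derivable G y w /\ 'D_w G y = w *m invmx (jac F (G y)).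
  move=> Vy; apply: (inverse_derive oU1 (FU1 1%N) (GU1 y Vy) _ K0).
  - by have [] := GU1 y Vy.
  - have [a a0 Ha] := open_norm_ex oV Vy.
    near=> h.
    have Vh : V (h *: w + y).
      apply: Ha; rewrite addrK normrZ.
      have : `|h| < a / (`|w| + 1).
        by near: h; apply: dnbhs0_lt; rewrite divr_gt0 // ltr_wpDl.
      rewrite ltr_pdivlMr ?ltr_wpDl //; apply: le_lt_trans.
      by rewrite ler_wpM2l // lerDl.
    split; first by have [] := GP _ Vh.
    by have := Glip y _ Vy Vh; rewrite addrK.
  - by have [] := GP _ Vy.
have cG y : V y -> {for y, continuous G}.
  move=> Vy; apply: norm_continuous_at => e e0.
  have [a a0 Ha] := open_norm_ex oV Vy.
  exists (Num.min a (e / K)); first by rewrite lt_min a0 divr_gt0.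
  move=> z; rewrite lt_min => /andP[/Ha Vz]; rewrite ltr_pdivlMr // => H.
  by apply: le_trans (Glip _ _ Vy Vz) _; rewrite mulrC ltW.
(* Smoothness by induction: D_w G = w J(G)^-1 is rational in the entries of J composed with [G],
   which are C^k when [G] is. *)
elim=> [|k IH]; split=> // w; split=> [y Vy|]; first by have [] := dG y w Vy.
have CC := Ck_on_ring_class k oV.
have J0 y : V y -> \det (jac F (G y)) != 0.
  by move=> /GU1[_]; rewrite unitmxE unitfE.
have CJ i j : Ck_on k V (fun y => jac F (G y) i j : R^o).
  apply: (Ck_on_comp1 (O := U1) (f := G) (g := fun x => jac F x i j : R^o)) => //.
  exact: smooth_jac.
have H : Ck_on k V (fun y => w *m ((\det (jac F (G y)))^-1 *: \adj (jac F (G y)))).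
  apply/(Ck_on_mx k _ oV) => i.
  apply: (rc_mulmx CC (A := fun=> w) (B := fun y => (\det (jac F (G y)))^-1 *: \adj (jac F (G y)))) => a b.
    exact: (rc_cst CC).
  rewrite (_ : (fun y => _) = (fun y => (\det (jac F (G y)))^-1 * (\adj (jac F (G y))) a b));
    last by apply/funext => y; rewrite mxE.
  apply: (rc_mul CC); last exact: (rc_adj CC).
  by apply: Ck_onV => //; exact: (rc_det CC).
apply: (Ck_on_ext oV _ H) => y Vy.
have [_ ->] := dG y w Vy; rewrite /invmx ifT //; by have [] := GU1 y Vy.
Unshelve. all: by end_near. Qed.

End Jacobian.

Section DirectionalChain.
Context {R : realType} {V : normedModType R} {n : nat}.
Local Notation E := 'rV[R]_n.

Lemma C1_derive_sum (O : set E) (g : E -> R^o) (x v : E) : open O -> Ck_on 1 O g -> O x ->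
  'D_v g x = \sum_i v ord0 i * 'D_(delta_mx ord0 i) g x.
Proof.
move=> oO gO Ox.
have [_ H] := C1_comp (f := @id E) oO gO Ox (@derivable_id _ _ x v).
by rewrite -[g]/(g \o id) H derive_id.
Qed.

Lemma C1_chain1 (O : set E) (f : V -> E) (g : E -> R^o) (x v : V) : open O ->
  Ck_on 1 O g -> O (f x) -> derivable f x v ->
  derivable (g \o f) x v /\ 'D_v (g \o f) x = 'D_('D_v f x) g (f x).
Proof.
move=> oO gO Ofx fv; have [d ->] := C1_comp oO gO Ofx fv; split=> //.
by rewrite (C1_derive_sum _ oO gO Ofx).
Qed.

Lemma C1_chain (m : nat) (O : set E) (f : V -> E) (g : E -> 'rV[R]_m) (x v : V) : open O ->
  Ck_on 1 O g -> O (f x) -> derivable f x v ->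
  derivable (g \o f) x v /\ 'D_v (g \o f) x = 'D_('D_v f x) g (f x).
Proof.
move=> oO gO Ofx fv; have gj := (Ck_on_mx 1 g oO).1 gO.
have gd w : derivable g (f x) w by have [_ /(_ w)[+ _]] := gO; apply.
have d : derivable (g \o f) x v.
  apply/derivable_mxP => i j; rewrite ord1.
  by have [] := C1_chain1 oO (gj j) Ofx fv.
split; first exact: d.
apply/rowP => j; rewrite (derive_mx d) (derive_mx (gd _)) mxE [RHS]mxE.
by have [_] := C1_chain1 oO (gj j) Ofx fv.
Qed.

End DirectionalChain.

(** * Charts, torus actions and invariant forms *)

Section Charts.
Context {R : realType} {n : nat} {M : topologicalType}.
Implicit Types (c h : chart R n M).

Lemma chart_nbhs_cod c x (W : set M) : ccod c x -> open W -> W (cinv c x) ->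
  \forall y \near x, ccod c y /\ W (cinv c y).
Proof.
move=> cx oW Wx.
have H1 : nbhs x (ccod c) by apply: open_nbhs_nbhs; split=> //; exact: ccod_open.
have H2 : nbhs x (cinv c @^-1` W).
  by apply: (cinv_continuous cx); apply: open_nbhs_nbhs.
exact: filterI H1 H2.
Qed.

Lemma open_chart_cod c (W : set M) : open W -> open [set x | ccod c x /\ W (cinv c x)].
Proof. by move=> oW; rewrite openE => x [cx Wx]; exact: chart_nbhs_cod. Qed.

Lemma open_chart_dom c (O : set 'rV[R]_n) : open O -> open [set m | cdom c m /\ O (c m)].
Proof.
move=> oO; rewrite openE => m [cm Om].
have H1 : nbhs m (cdom c) by apply: open_nbhs_nbhs; split=> //; exact: cdom_open.
have H2 : nbhs m (cfun c @^-1` O).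
  by apply: (cfun_continuous cm); apply: open_nbhs_nbhs.
exact: filterI H1 H2.
Qed.

End Charts.

Section Manifold.
Context {R : realType} {n : nat} (M : smooth_manifold R n).
Local Notation E := 'rV[R]_n.
Local Notation at_ := (@atlas R n M).

Definition overlap (c c' : idx M) : set E :=
  [set x | ccod (at_ c) x /\ cdom (at_ c') (cinv (at_ c) x)].

Definition trans (c c' : idx M) : E -> E := at_ c' \o cinv (at_ c).

Lemma open_overlap c c' : open (overlap c c').
Proof. by apply: open_chart_cod; exact: cdom_open. Qed.

Lemma smooth_trans c c' k : Ck_on k (overlap c c') (trans c c').
Proof. by have [H _] := atlas_compatible c c'; exact: H. Qed.

Lemma overlap_chart c c' (m : M) : cdom (at_ c) m -> cdom (at_ c') m ->
  overlap c c' (at_ c m).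
Proof. by move=> cm c'm; split; [exact: cfun_cod | rewrite cfunK]. Qed.

Lemma trans_derive_inv c c' x v : overlap c c' x ->
  'D_('D_v (trans c c') x) (trans c' c) (trans c c' x) = v.
Proof.
move=> [cx c'x]; have Ox : overlap c c' x by [].
have dv : derivable (trans c c') x v.
  by have [_ /(_ v)[+ _]] := smooth_trans c c' 1; apply.
have O' : overlap c' c (trans c c' x).
  by rewrite /trans /=; apply: overlap_chart => //; exact: cinv_dom.
have [_ <-] := C1_chain (@open_overlap c' c) (smooth_trans c' c 1) O' dv.
rewrite -[RHS](derive_id x v); apply: near_eq_derive.
apply: (near_open (@open_overlap c c') Ox) => y [cy c'y].
by rewrite /trans /= cfunK // cinvK.
Qed.

End Manifold.

(** * The torus action in charts and its induced fields *)

Section Action.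
Context {R : realType} {n r : nat} (M : smooth_manifold R n).
Context (act : 'rV[R]_r -> M -> M) (actP : torus_action act).
Local Notation E := 'rV[R]_n.
Local Notation T := 'rV[R]_r.
Local Notation at_ := (@atlas R n M).

Definition adom (c c' : idx M) : set (T * E) :=
  [set p | ccod (at_ c) p.2 /\ cdom (at_ c') (act p.1 (cinv (at_ c) p.2))].

Definition amap (c c' : idx M) (p : T * E) : E := at_ c' (act p.1 (cinv (at_ c) p.2)).

Lemma open_adom c c' : open (adom c c').
Proof.
rewrite openE => -[t x] [/= cx c'x].
have sc : {for (t, x), continuous (fun p : T * E => p.2)} by exact: cvg_snd.
have fc : {for (t, x), continuous (fun p : T * E => p.1)} by exact: cvg_fst.
have ic : {for (t, x), continuous (fun p : T * E => cinv (at_ c) p.2)}.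
  exact: (continuous_comp sc (cinv_continuous cx)).
have cc : {for (t, x), continuous (fun p : T * E => (p.1, cinv (at_ c) p.2) : T * M)}.
  exact: cvg_pair fc ic.
have H1 : nbhs (t, x) (fun p : T * E => ccod (at_ c) p.2).
  by apply: sc; apply: open_nbhs_nbhs; split=> //; exact: ccod_open.
have H2 : nbhs (t, x) (fun p : T * E => cdom (at_ c') (act p.1 (cinv (at_ c) p.2))).
  apply: (cc (fun q : T * M => cdom (at_ c') (act q.1 q.2))).
  apply: (@act_continuous _ _ _ _ _ actP (t, cinv (at_ c) x)).
  by apply: open_nbhs_nbhs; split=> //; exact: cdom_open.
exact: filterI H1 H2.
Qed.

Lemma smooth_amap c c' k : Ck_on k (adom c c') (amap c c').
Proof. exact: (act_smooth actP). Qed.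

Definition slice_t (t : T) c c' : set E :=
  [set x | ccod (at_ c) x /\ cdom (at_ c') (act t (cinv (at_ c) x))].

Definition tmap (t : T) (c c' : idx M) : E -> E := at_ c' \o act t \o cinv (at_ c).

Let pairE (h : R) (t : T) (v x : E) : (t, h *: v + x) = h *: (0, v) + (t, x) :> T * E.
Proof. by congr pair; rewrite /= scaler0 add0r. Qed.

Let pairE1 (h : R) (v t : T) (x : E) : (h *: v + t, x) = h *: (v, 0) + (t, x) :> T * E.
Proof. by congr pair; rewrite /= scaler0 add0r. Qed.

Lemma pair_continuous_l (t : T) : continuous (fun x : E => (t, x)).
Proof.
move=> x.
have h1 : (fun=> t) @ nbhs x --> t by exact: cvg_cst.
have h2 : id @ nbhs x --> x by exact: cvg_id.
exact: (cvg_pair h1 h2).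
Qed.

Lemma smooth_tmap t c c' k : Ck_on k (slice_t t c c') (tmap t c c').
Proof.
apply: (@Ck_on_comp_affine _ _ _ _ k _ (fun x : E => (t, x)) (fun v => (0, v))
  (amap c c') (@pair_continuous_l t) _ (smooth_amap c c' k)) => h v x; exact: pairE.
Qed.

Lemma open_slice_t t c c' : open (slice_t t c c').
Proof.
rewrite openE => x xs.
have H : nbhs ((t, x) : T * E) (adom c c').
  exact: (open_nbhs_nbhs (conj (@open_adom c c') (xs : adom c c' (t, x)))).
exact: (@pair_continuous_l t x _ H).
Qed.

Lemma derive_tmap t c c' x v : 'D_v (tmap t c c') x = 'D_(0, v) (amap c c') (t, x).
Proof.
exact: (@derive_comp_affine _ _ _ _ (amap c c') (fun x : E => (t, x)) (fun v => (0, v))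
  x v (fun h => pairE h t v x)).
Qed.

Lemma derive_orbit t c c' x w :
  'D_w (fun t => amap c c' (t, x)) t = 'D_(w, 0) (amap c c') (t, x).
Proof.
exact: (@derive_comp_affine _ _ _ _ (amap c c') (fun t : T => (t, x)) (fun v => (v, 0))
  t w (fun h => pairE1 h w t x)).
Qed.

Lemma derivable_orbit t c c' x w : adom c c' (t, x) ->
  derivable (fun t => amap c c' (t, x)) t w.
Proof.
move=> tx.
apply/(@derivable_comp_affine _ _ _ _ (amap c c') (fun t : T => (t, x)) (fun v => (v, 0))
  t w (fun h => pairE1 h w t x)).
by have [_ /(_ (w, 0))[+ _]] := smooth_amap c c' 1; apply.
Qed.

Local Notation X := (induced_field act).

Lemma adom0 c x : ccod (at_ c) x -> adom c c (0, x).
Proof. by move=> cx; split=> //=; rewrite (act0 actP); exact: cinv_dom. Qed.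

Lemma induced_fieldE c x w : X w c x = 'D_(w, 0) (amap c c) (0, x).
Proof. by rewrite -derive_orbit. Qed.

Lemma smooth_induced_field w c k : Ck_on k (ccod (at_ c)) (X w c).
Proof.
have [_ /(_ (w, 0))[_ H]] := smooth_amap c c k.+1.
pose A0 (x : E) : T * E := (0, x).
have H0 : Ck_on k (A0 @^-1` adom c c) ('D_(w, 0) (amap c c) \o A0).
  apply: (@Ck_on_comp_affine _ _ _ _ k _ A0 (fun v => (0, v))) H.
    exact: pair_continuous_l.
  by move=> h v x; exact: pairE.
have H1 : Ck_on k (ccod (at_ c)) ('D_(w, 0) (amap c c) \o A0).
  by apply: Ck_on_sub H0 => x cx; exact: adom0.
apply: (Ck_on_ext _ _ H1); first exact: ccod_open.
by move=> x _ /=; rewrite induced_fieldE.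
Qed.

(** By the group law, translating the parameter by [t] moves the base point of the orbit to act t
    m. *)
Lemma derive_orbit_field c' t (m : M) w : cdom (at_ c') (act t m) ->
  'D_w (fun s => at_ c' (act s m)) t = X w c' (at_ c' (act t m)).
Proof.
move=> c'm; rewrite /induced_field (cfunK c'm).
have AL (h : R) : (h *: w + 0) + t = h *: w + (0 + t) :> T by rewrite addrA.
have := @derive_comp_affine _ _ _ _ (fun s => at_ c' (act s m)) (fun s : T => s + t)
  id 0 w AL; rewrite add0r => <-.
congr ('D_w _ 0); apply/funext => s /=; by rewrite (actD actP).
Qed.

Lemma derivable_orbit_pt c' t (m : M) w : cdom (at_ c') (act t m) ->
  derivable (fun s => at_ c' (act s m)) t w.
Proof.
move=> c'm; have [c cm] := atlas_cover m.
have := @derivable_orbit t c c' (at_ c m) w.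
rewrite /amap /= cfunK //; apply; split=> /=; first exact: cfun_cod.
by rewrite cfunK.
Qed.

(** Differentiate act t (act s m) = act s (act t m) at s = 0. Commutativity of the torus enters
    here: its induced fields are invariant under the action. *)
Lemma induced_field_push c c' t (m : M) w : cdom (at_ c) m -> cdom (at_ c') (act t m) ->
  X w c' (at_ c' (act t m)) = 'D_(X w c (at_ c m)) (tmap t c c') (at_ c m).
Proof.
move=> cm c'm.
have c0m : cdom (at_ c) (act 0 m) by rewrite (act0 actP).
have E1 := derive_orbit_field w c0m; rewrite (act0 actP) in E1.
have D1 := @derivable_orbit_pt c 0 m w c0m.
have Om : slice_t t c c' (at_ c (act 0 m)).
  by rewrite (act0 actP); split; [exact: cfun_cod | rewrite cfunK].
have [_ ] := C1_chain (@open_slice_t t c c') (smooth_tmap t c c' 1) Om D1.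
rewrite E1 (act0 actP) => <-.
rewrite -(derive_orbit_field w c'm).
have AL (h : R) : (h *: w + 0) + t = h *: w + (0 + t) :> T by rewrite addrA.
have := @derive_comp_affine _ _ _ _ (fun s => at_ c' (act s m)) (fun s : T => s + t)
  id 0 w AL; rewrite add0r => <-.
apply: near_eq_derive.
(* Only for small [s] is the orbit known to stay in the domain of [c]. *)
have : \forall s \near (0 : T), cdom (at_ c) (act s m).
  have [c1 c1m] := atlas_cover m.
  have H1 := open_nbhs_nbhs (conj (@open_adom c1 c) _ : open_nbhs ((0 : T), at_ c1 m) (adom c1 c)).
  have {}H1 : nbhs ((0 : T), at_ c1 m) (adom c1 c).
    by apply: H1; split=> /=; [exact: cfun_cod | rewrite cfunK // (act0 actP)].
  have pc : {for (0 : T), continuous (fun s : T => (s, at_ c1 m))}.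
    have h1 : id @ nbhs (0 : T) --> (0 : T) by exact: cvg_id.
    have h2 : (fun=> at_ c1 m) @ nbhs (0 : T) --> at_ c1 m by exact: cvg_cst.
    exact: (cvg_pair h1 h2).
  have H2 : nbhs (0 : T) (fun s : T => adom c1 c (s, at_ c1 m)) by exact: (pc _ H1).
  by apply: filterS H2 => s [/= _]; rewrite (cfunK c1m).
apply: filterS => s cs /=; rewrite /tmap /= (cfunK cs).
by rewrite addrC (actD actP).
Qed.

Lemma induced_field_glue c c' (m : M) w : cdom (at_ c) m -> cdom (at_ c') m ->
  X w c' (at_ c' m) = 'D_(X w c (at_ c m)) (trans c c') (at_ c m).
Proof.
move=> cm c'm.
have tE : tmap 0 c c' = trans c c'.
  by apply/funext => x; rewrite /tmap /trans /= (act0 actP).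
have c'm0 : cdom (at_ c') (act 0 m) by rewrite (act0 actP).
by have := induced_field_push w cm c'm0; rewrite tE (act0 actP m).
Qed.

End Action.

(** * Differentiating a 3-form on moving vectors *)

Section Trilinear.
Context {R : realType} {n : nat}.
Local Notation E := 'rV[R]_n.
Local Notation e i := (delta_mx ord0 i : 'rV[R]_n).

Lemma is_derive_sumf {V : normedModType R} m (h : 'I_m -> V -> R^o) (x v : V) (dh : 'I_m -> R) :
  (forall i, is_derive x v (h i) (dh i)) ->
  is_derive x v (fun y => \sum_i h i y : R^o) (\sum_i dh i).
Proof.
move=> H; rewrite (_ : (fun y => _) = \sum_i h i); first exact: is_derive_sum.
by apply/funext => y; rewrite fct_sumE.
Qed.

Lemma is_derive_coord {V : normedModType R} (u : V -> E) (x v : V) i :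
  derivable u x v -> is_derive x v (fun y => u y ord0 i : R^o) ('D_v u x ord0 i).
Proof.
move=> ud; have H := ud; move/derivable_mxP : H => /(_ ord0 i) H.
by apply: DeriveDef => //; rewrite (derive_mx ud) mxE.
Qed.

Definition trilinear (f : ('I_3 -> E) -> R) := forall u v w,
  f (tri u v w) = \sum_i \sum_j \sum_k
    u ord0 i * (v ord0 j * (w ord0 k * f (tri (e i) (e j) (e k)))).

Let sum3D (F G : 'I_n -> 'I_n -> 'I_n -> R) :
  \sum_i \sum_j \sum_k (F i j k + G i j k) =
  \sum_i \sum_j \sum_k F i j k + \sum_i \sum_j \sum_k G i j k.
Proof.
rewrite -big_split; apply: eq_bigr => i _ /=; rewrite -big_split.
by apply: eq_bigr => j _ /=; rewrite -big_split.
Qed.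

Context (P : E -> ('I_3 -> E) -> R) (O : set E) (oO : open O).
Hypothesis P3 : forall y, O y -> trilinear (P y).
Hypothesis PC : forall v, Ck_on 1 O (fun y => P y v : R^o).

(** The Leibniz rule on the basis expansion, with the base point and all three vectors moving. *)
Let derive_raw {V : normedModType R} (y u1 u2 u3 : V -> E) (x d : V) :
  (\forall z \near x, O (y z)) -> derivable y x d ->
  derivable u1 x d -> derivable u2 x d -> derivable u3 x d ->
  is_derive x d (fun z => P (y z) (tri (u1 z) (u2 z) (u3 z)) : R^o)
  (\sum_i \sum_j \sum_k (u1 x ord0 i * (u2 x ord0 j * (u3 x ord0 k *
        'D_('D_d y x) (fun z => P z (tri (e i) (e j) (e k)) : R^o) (y x)))) +
   \sum_i \sum_j \sum_k ('D_d u1 x ord0 i * (u2 x ord0 j * (u3 x ord0 k *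
        P (y x) (tri (e i) (e j) (e k))))) +
   \sum_i \sum_j \sum_k (u1 x ord0 i * ('D_d u2 x ord0 j * (u3 x ord0 k *
        P (y x) (tri (e i) (e j) (e k))))) +
   \sum_i \sum_j \sum_k (u1 x ord0 i * (u2 x ord0 j * ('D_d u3 x ord0 k *
        P (y x) (tri (e i) (e j) (e k)))))).
Proof.
move=> Oy yd u1d u2d u3d.
have Oyx : O (y x) := nbhs_singleton Oy.
pose q i j k := fun z : V => P (y z) (tri (e i) (e j) (e k)) : R^o.
pose dq i j k := 'D_('D_d y x) (fun z => P z (tri (e i) (e j) (e k)) : R^o) (y x).
have qd i j k : is_derive x d (q i j k) (dq i j k).
  have [d1 d2] := C1_chain1 oO (PC (tri (e i) (e j) (e k))) Oyx yd.
  exact: DeriveDef d1 d2.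
pose G (z : V) : R^o := \sum_i \sum_j \sum_k
    u1 z ord0 i * (u2 z ord0 j * (u3 z ord0 k * q i j k z)).
apply: (@near_eq_is_derive _ _ _ G).
  by apply: filterS Oy => z /P3; rewrite /trilinear => ->.
have H : is_derive x d G (\sum_i \sum_j \sum_k
  (u1 x ord0 i * (u2 x ord0 j * (u3 x ord0 k * dq i j k + q i j k x * 'D_d u3 x ord0 k)
     + (u3 x ord0 k * q i j k x) * 'D_d u2 x ord0 j)
   + (u2 x ord0 j * (u3 x ord0 k * q i j k x)) * 'D_d u1 x ord0 i)).
  apply: is_derive_sumf => i; apply: is_derive_sumf => j; apply: is_derive_sumf => k.
  have h1 := is_derive_coord i u1d; have h2 := is_derive_coord j u2d.
  have h3 := is_derive_coord k u3d.
  exact: (is_deriveM h1 (is_deriveM h2 (is_deriveM h3 (qd i j k)))).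
apply: (is_derive_eq H); rewrite -!sum3D.
apply: eq_bigr => i _; apply: eq_bigr => j _; apply: eq_bigr => k _.
rewrite -/(dq i j k) -[P _ _]/(q i j k x).
move: (dq i j k) (q i j k x) ('D_d u3 x ord0 k) ('D_d u2 x ord0 j) ('D_d u1 x ord0 i).
by move=> a b c d' f; ring.
Qed.

Lemma derive_trilinear {V : normedModType R} (y u1 u2 u3 : V -> E) (x d : V) :
  (\forall z \near x, O (y z)) -> derivable y x d ->
  derivable u1 x d -> derivable u2 x d -> derivable u3 x d ->
  is_derive x d (fun z => P (y z) (tri (u1 z) (u2 z) (u3 z)) : R^o)
   ('D_('D_d y x) (fun z => P z (tri (u1 x) (u2 x) (u3 x)) : R^o) (y x)
    + P (y x) (tri ('D_d u1 x) (u2 x) (u3 x))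
    + P (y x) (tri (u1 x) ('D_d u2 x) (u3 x))
    + P (y x) (tri (u1 x) (u2 x) ('D_d u3 x))).
Proof.
move=> Oy yd u1d u2d u3d; have Oyx : O (y x) := nbhs_singleton Oy.
apply: (is_derive_eq (derive_raw Oy yd u1d u2d u3d)).
rewrite !(P3 Oyx); do 3!congr (_ + _).
have nO : \forall z \near y x, O (id z) by exact: (open_nbhs_nbhs (conj oO Oyx)).
have cd (c : E) : derivable (fun=> c) (y x) ('D_d y x) by exact: derivable_cst.
(* The same expansion with constant vectors identifies the first sum as a directional derivative of
   [P]. *)
have [_ ->] := derive_raw nO (@derivable_id _ _ (y x) ('D_d y x))
  (cd (u1 x)) (cd (u2 x)) (cd (u3 x)).
have z3 (F : 'I_n -> 'I_n -> 'I_n -> R) : (forall i j k, F i j k = 0) ->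
    \sum_i \sum_j \sum_k F i j k = 0.
  by move=> F0; rewrite big1 // => i _; rewrite big1 // => j _; rewrite big1.
rewrite derive_id !derive_cst.
rewrite [X in _ + X + _ + _]z3 ?[X in _ + _ + X + _]z3 ?[X in _ + _ + _ + X]z3 ?addr0 //.
all: by move=> i j k; rewrite mxE ?mul0r ?mulr0.
Qed.

(** Values and velocities at [x] become parameters, for curves that are complicated away from
    [x]. *)
Lemma derive_trilinear_at {V : normedModType R} (y u1 u2 u3 : V -> E) (x d : V)
    (y0 dy a1 a2 a3 b1 b2 b3 : E) :
  (\forall z \near x, O (y z)) -> derivable y x d ->
  derivable u1 x d -> derivable u2 x d -> derivable u3 x d ->
  y x = y0 -> 'D_d y x = dy -> u1 x = a1 -> u2 x = a2 -> u3 x = a3 ->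
  'D_d u1 x = b1 -> 'D_d u2 x = b2 -> 'D_d u3 x = b3 ->
  is_derive x d (fun z => P (y z) (tri (u1 z) (u2 z) (u3 z)) : R^o)
   ('D_dy (fun z => P z (tri a1 a2 a3) : R^o) y0 + P y0 (tri b1 a2 a3)
    + P y0 (tri a1 b2 a3) + P y0 (tri a1 a2 b3)).
Proof.
by move=> ny yd d1 d2 d3 <- <- <- <- <- <- <- <-; exact: derive_trilinear.
Qed.

End Trilinear.

Section SymVec.
Context {R : realType} {V : normedModType R}.

Lemma derive_sym_vec n (f : V -> 'rV[R]_n) (U : set V) (x u v : V) : open U ->
  Ck_on 2 U f -> U x -> 'D_v ('D_u f) x = 'D_u ('D_v f) x.
Proof.
move=> oU fU Ux.
have fj := (Ck_on_mx 2 f oU).1 fU.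
have d1 a y : U y -> derivable f y a.
  by move=> Uy; have [_ /(_ a)[+ _]] := fU; apply.
have d2 a b : derivable ('D_a f) x b.
  by have [_ /(_ a)[_ [_ /(_ b)[+ _]]]] := fU; apply.
have key a b j : 'D_b ('D_a f) x ord0 j = 'D_b ('D_a (fun y => f y ord0 j : R^o)) x.
  rewrite (derive_mx (d2 a b)) mxE; apply: near_eq_derive.
  by apply: (near_open oU Ux) => y Uy; rewrite (derive_mx (d1 a y Uy)) mxE.
apply/rowP => j; apply: (etrans (key u v j)); apply: etrans (esym (key v u j)).
exact: (derive_sym u v oU (fj j) Ux).
Qed.

End SymVec.

(** * Flows of induced fields *)

Section FlowDerivative.
Context {R : realType} {n r : nat} (M : smooth_manifold R n).
Context (act : 'rV[R]_r -> M -> M) (actP : torus_action act).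
Local Notation E := 'rV[R]_n.
Local Notation T := 'rV[R]_r.
Local Notation at_ := (@atlas R n M).
Local Notation X := (induced_field act).
Local Notation A c := (amap act c c).

(* amap takes this line to the integral curve of X w through x. *)
Definition flow (w : T) (c : idx M) (x : E) (s : R) : T * E :=
  s *: ((w, 0) : T * E) + ((0 : T), x).

Lemma flowE w c x s : flow w c x s = (s *: w, x).
Proof. by rewrite /flow; congr pair; rewrite /= ?addr0 // scaler0 add0r. Qed.

Lemma near_flow w c x : ccod (at_ c) x -> \forall s \near (0 : R), adom act c c (flow w c x s).
Proof.
move=> cx; have A0 := adom0 actP cx.
have H0 : nbhs (((0 : T), x) : T * E) (adom act c c).
  exact: (open_nbhs_nbhs (conj (@open_adom _ _ _ _ _ actP c c) A0)).
have sc : {for (0 : R), continuous (fun s : R => s *: w)} by exact: scalel_continuous.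
have h1 : (fun s : R => s *: w) @ nbhs (0 : R) --> (0 : T) by have := sc; rewrite /prop_for /continuous_at scale0r.
have h2 : (fun=> x) @ nbhs (0 : R) --> x by exact: cvg_cst.
have H1 : nbhs (0 : R) (fun s : R => adom act c c (s *: w, x)) by exact: (cvg_pair h1 h2 H0).
by apply: filterS H1 => s; rewrite flowE.
Qed.

Lemma amap0 c x : ccod (at_ c) x -> A c (0, x) = x.
Proof. by move=> cx; rewrite /amap /= (act0 actP) cinvK. Qed.

Lemma flow0 w c x : flow w c x 0 = (0, x).
Proof. by rewrite flowE scale0r. Qed.

Lemma derivable_flow w c x : ccod (at_ c) x ->
  derivable (A c \o flow w c x) 0 1 /\ 'D_1 (A c \o flow w c x) 0 = X w c x.
Proof.
move=> cx; have A0 := adom0 actP cx; split.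
  apply/derivable_lineP; rewrite scale0r add0r.
  by have [_ /(_ (w, 0))[+ _]] := smooth_amap actP c c 1; apply.
by rewrite (derive_line (A c) ((0 : T), x) ((w, 0) : T * E)) scale0r add0r induced_fieldE.
Qed.

Lemma derive_amap0 c x b : ccod (at_ c) x -> 'D_(0, b) (A c) (0, x) = b.
Proof.
move=> cx; rewrite -derive_tmap -[RHS](derive_id x b); apply: near_eq_derive.
apply: (near_open _ cx); first exact: ccod_open.
by move=> y cy; rewrite /tmap /= (act0 actP) cinvK.
Qed.

(** Symmetry of second derivatives: the time derivative of the differential of the flow is the
    differential of its velocity field. *)
Lemma derivable_flow_jac w c x b : ccod (at_ c) x ->
  derivable ('D_(0, b) (A c) \o flow w c x) 0 1 /\
  'D_1 ('D_(0, b) (A c) \o flow w c x) 0 = 'D_b (X w c) x.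
Proof.
move=> cx; have A0 := adom0 actP cx.
have oA := @open_adom _ _ _ _ _ actP c c.
have C2 := smooth_amap actP c c 2; split.
  apply/derivable_lineP; rewrite scale0r add0r.
  by have [_ /(_ (0, b))[_ [_ /(_ (w, 0))[+ _]]]] := C2; apply.
rewrite (derive_line ('D_(0, b) (A c)) ((0 : T), x) ((w, 0) : T * E)) scale0r add0r.
rewrite (derive_sym_vec _ _ oA C2 A0).
have AL (h : R) : ((0 : T), h *: b + x) = h *: ((0 : T), b) + ((0 : T), x) :> T * E.
  by congr pair; rewrite /= scaler0 add0r.
rewrite -(@derive_comp_affine _ _ _ _ ('D_(w, 0) (A c)) (fun y : E => ((0 : T), y))
  (fun v => ((0 : T), v)) x b AL).
by congr ('D_b _ x); apply/funext => y; rewrite induced_fieldE.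
Qed.

(** Differentiate at time 0 the invariance of X w2 under the flow of X w1. In coordinates this is
    the vanishing of the Lie bracket. *)
Lemma induced_fields_commute w1 w2 c x : ccod (at_ c) x ->
  'D_(X w1 c x) (X w2 c) x = 'D_(X w2 c x) (X w1 c) x.
Proof.
move=> cx; set b := X w2 c x.
have [d1 e1] := derivable_flow w1 cx.
have [_ <-] := derivable_flow_jac w1 b cx.
have Ox : ccod (at_ c) ((A c \o flow w1 c x) 0) by rewrite /= flow0 amap0.
have [_] := C1_chain (@ccod_open _ _ _ (at_ c)) (smooth_induced_field actP w2 c 1) Ox d1.
rewrite e1 /= flow0 (amap0 cx) => <-.
apply: near_eq_derive; apply: filterS (near_flow w1 cx) => s.
rewrite /= flowE => -[/= _ cs].
have cm := cinv_dom cx; have := induced_field_push actP w2 cm cs.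
by rewrite (cinvK cx) /amap /= => ->; rewrite derive_tmap.
Qed.

End FlowDerivative.

(** * Closedness of the contracted 1-forms *)

Section G2Manifold.
Context {R : realType} (M : smooth_manifold R 7) (phi : coord_form M 3).
Context (phi_G2 : G2_form phi).
Local Notation E := 'rV[R]_7.
Local Notation at_ := (@atlas R 7 M).

Lemma G2_is_frame c x : ccod (at_ c) x -> exists B, is_frame (phi c x) B.
Proof. by have [_ H] := phi_G2; exact: H. Qed.

Lemma G2_frameP c x : ccod (at_ c) x -> is_frame (phi c x) (G2_frame phi c x).
Proof.
move=> /G2_is_frame[B fB].
exact: (@xgetI _ 1%:M [set B | G2_iso phi c x B] B fB).
Qed.

Lemma phi_smooth c v k : Ck_on k (ccod (at_ c)) (fun x => phi c x v : R^o).
Proof. by have [[_ _ H _] _] := phi_G2; exact: H. Qed.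

Lemma frame_trilinear (f : ('I_3 -> E) -> R) B : is_frame f B -> trilinear f.
Proof.
move=> fB u v w.
have mE (x : E) : x *m B = \sum_i x ord0 i *: (delta_mx ord0 i *m B).
  rewrite {1}[x](row_sum_delta x) mulmx_suml.
  by apply: eq_bigr => i _; rewrite scalemxAl.
rewrite (frame_tri _ _ _ fB) [u *m B]mE phi0_sum1; apply: eq_bigr => i _.
rewrite [v *m B]mE phi0_sum2 mulr_sumr; apply: eq_bigr => j _.
rewrite [w *m B]mE phi0_sum3 !mulr_sumr; apply: eq_bigr => k _.
by rewrite (frame_tri _ _ _ fB).
Qed.

Lemma phi_trilinear c x : ccod (at_ c) x -> trilinear (phi c x).
Proof. by move=> /G2_is_frame[B]; exact: frame_trilinear. Qed.

Lemma phi_swap01 c x u v w : ccod (at_ c) x -> phi c x (tri v u w) = - phi c x (tri u v w).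
Proof. by move=> /G2_is_frame[B fB]; rewrite !(frame_tri _ _ _ fB) phi0_swap01. Qed.

Lemma phi_swap12 c x u v w : ccod (at_ c) x -> phi c x (tri u w v) = - phi c x (tri u v w).
Proof. by move=> /G2_is_frame[B fB]; rewrite !(frame_tri _ _ _ fB) phi0_swap12. Qed.

Lemma phi_tri0 c x u v : ccod (at_ c) x -> phi c x (tri u v 0) = 0.
Proof.
by move=> /G2_is_frame[B fB]; rewrite (frame_tri _ _ _ fB) mul0mx phi0_tri /D3 !mxE; ring.
Qed.

Context (r : nat) (act : 'rV[R]_r -> M -> M) (actP : torus_action act).
Context (act_phi : forall t, preserves (act t) phi).
Local Notation X := (induced_field act).
Local Notation A c := (amap act c c).

(** The vanishing Lie derivative in coordinates: phi equals its pullback under the flow of X w, and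
    this is differentiated at s = 0 on constant vectors. *)
Lemma lie_derivative_phi w c x (a1 a2 a3 : E) : ccod (at_ c) x ->
  'D_(X w c x) (fun y => phi c y (tri a1 a2 a3) : R^o) x
  + phi c x (tri ('D_a1 (X w c) x) a2 a3) + phi c x (tri a1 ('D_a2 (X w c) x) a3)
  + phi c x (tri a1 a2 ('D_a3 (X w c) x)) = 0.
Proof.
move=> cx.
(* [y] is the integral curve through [x], and [u a] is the vector [a] carried along by the
   differential of the flow. *)
pose y := A c \o flow w c x; pose u a := 'D_(0, a) (A c) \o flow w c x.
have [dy ey] : derivable y 0 1 /\ 'D_1 y 0 = X w c x := derivable_flow actP w cx.
have du a : derivable (u a) 0 1 by have [] := derivable_flow_jac actP w a cx.
have eu a : 'D_1 (u a) 0 = 'D_a (X w c) x by have [] := derivable_flow_jac actP w a cx.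
have y0 : y 0 = x by rewrite /y /= flow0 (amap0 actP cx).
have u0 a : u a 0 = a by rewrite /u /= flow0 (derive_amap0 actP _ cx).
have nf := near_flow actP w cx.
have nO : \forall s \near (0 : R), ccod (at_ c) (y s).
  by apply: filterS nf => s; rewrite /y /= flowE => -[_ /=]; exact: cfun_cod.
have [_ <-] := derive_trilinear_at (@ccod_open _ _ _ (at_ c)) (@phi_trilinear c)
  (fun v => phi_smooth c v 1) nO dy (du a1) (du a2) (du a3) y0 ey (u0 a1) (u0 a2) (u0 a3)
  (eu a1) (eu a2) (eu a3).
rewrite -[RHS](derive_cst (phi c x (tri a1 a2 a3) : R^o) (0 : R) (1 : R)).
apply: near_eq_derive; apply: filterS nf => s; rewrite flowE => -[/= _ cs].
have cm := cinv_dom cx; have H := act_phi cm cs (tri a1 a2 a3).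
rewrite (cinvK cx) in H; apply: etrans (esym H).
have uE a : u a s = 'D_a (tmap act (s *: w) c c) x by rewrite derive_tmap /u /= flowE.
have -> : y s = at_ c (act (s *: w) (cinv (at_ c) x)) by rewrite /y /= flowE.
rewrite !uE; congr (phi c _ _).
by rewrite -(tri_comp (fun a => 'D_a (tmap act (s *: w) c c) x)).
Qed.

Hypothesis phi_closed : closed_form phi.

Lemma closed_quad c x (z y a b : E) : ccod (at_ c) x ->
  'D_z (fun p => phi c p (tri y a b) : R^o) x - 'D_y (fun p => phi c p (tri z a b) : R^o) x
  + 'D_a (fun p => phi c p (tri z y b) : R^o) x
  - 'D_b (fun p => phi c p (tri z y a) : R^o) x = 0.
Proof.
move=> cx; have := phi_closed cx (quad z y a b).
rewrite /ext_d !big_ord_recl big_ord0 addr0.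
have L i j : nat_of_ord (lift i j : 'I_4) = bump i j by [].
have e0 : (fun j => quad z y a b (lift ord0 j)) = tri y a b.
  by rewrite [LHS]triE; congr tri; rewrite /quad lift0 inordK.
have e1 : (fun j => quad z y a b (lift (lift ord0 ord0) j)) = tri z a b.
  by rewrite [LHS]triE; congr tri; rewrite /quad !L inordK.
have e2 : (fun j => quad z y a b (lift (lift ord0 (lift ord0 ord0)) j)) = tri z y b.
  by rewrite [LHS]triE; congr tri; rewrite /quad !L inordK.
have e3 : (fun j => quad z y a b (lift (lift ord0 (lift ord0 (lift ord0 ord0))) j)) = tri z y a.
  by rewrite [LHS]triE; congr tri; rewrite /quad !L inordK.
rewrite e0 e1 e2 e3 /quad /= /bump /= !exprS expr0 !mulr1 mulrNN !mulr1 !mul1r.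
rewrite !mulN1r !addrA => H; exact: H.
Qed.

(** Cartan's formula written out. The three equations are d phi = 0 and the vanishing Lie
    derivatives along Z and Y; [W] is the common value of D_Z Y and D_Y Z, [aZ] stands for D_a Z,
    and p1, ..., p4 are derivatives of the coefficients of phi. The conclusion is d(i_Y i_Z phi)(a,
    b) = 0; the terms with [W] cancel. *)
Let closed_algebra (T : E -> E -> E -> R) (Z Y a b W aZ bZ aY bY : E) (p1 p2 p3 p4 : R) :
  (forall u v w, T v u w = - T u v w) -> (forall u v w, T u w v = - T u v w) ->
  p1 - p2 + p3 - p4 = 0 ->
  p1 + T W a b + T Y aZ b + T Y a bZ = 0 ->
  p2 + T W a b + T Z aY b + T Z a bY = 0 ->
  p3 + T aZ Y b + T Z aY b + - (p4 + T bZ Y a + T Z bY a) = 0.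
Proof.
move=> s01 s12; rewrite (s01 Y aZ) (s01 Y bZ) (s12 Y a bZ) (s12 Z a bY) => *; lra.
Qed.

(** The inner contraction fills the first slot of phi, so i_(X2) i_(X3) phi comes from the pair (X3,
    X2). *)
Definition sigma_form (w1 w2 : 'rV[R]_r) : coord_form M 1 :=
  interior_product (X w2) (interior_product (X w1) phi).

Lemma sigma_formE w1 w2 c x v : sigma_form w1 w2 c x v = phi c x (tri (X w1 c x) (X w2 c x) (v ord0)).
Proof.
rewrite /sigma_form /interior_product; congr (phi c x _); rewrite [LHS]triE; congr tri.
- by rewrite (_ : inord 0 = ord0) ?unlift_none //; apply/val_inj; rewrite /= inordK.
- rewrite (_ : inord 1 = lift ord0 ord0) ?liftK ?unlift_none //.
  by apply/val_inj; rewrite /= inordK.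
- rewrite (_ : inord 2 = lift ord0 (lift ord0 ord0)) ?liftK //.
  by apply/val_inj; rewrite /= inordK.
Qed.

Lemma closed_sigma_form w1 w2 : closed_form (sigma_form w1 w2).
Proof.
move=> c x cx v; rewrite /ext_d !big_ord_recl big_ord0 addr0.
set a := v ord0; set b := v (lift ord0 ord0).
rewrite expr0 mul1r /= /bump /= expr1 mulN1r.
pose Z := X w1 c; pose Y := X w2 c.
have E1 d : (fun y => sigma_form w1 w2 c y (fun j => d) : R^o) =
    (fun y => phi c y (tri (Z y) (Y y) d)).
  by apply/funext => y; rewrite sigma_formE.
have ea : (fun j : 'I_1 => v (lift (lift ord0 ord0) j)) = (fun=> a).
  by apply/funext => j; congr v; apply/val_inj; case: j => -[].
have eb : (fun j : 'I_1 => v (lift ord0 j)) = (fun=> b).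
  by apply/funext => j; congr v; apply/val_inj; case: j => -[].
rewrite ea eb !E1.
have dZ d : derivable Z x d.
  by have [_ /(_ d)[+ _]] := smooth_induced_field actP w1 c 1; apply.
have dY d : derivable Y x d.
  by have [_ /(_ d)[+ _]] := smooth_induced_field actP w2 c 1; apply.
have nO : \forall z \near x, ccod (at_ c) (id z).
  exact: (open_nbhs_nbhs (conj (@ccod_open _ _ _ (at_ c)) cx)).
have DD d e : 'D_d (fun y => phi c y (tri (Z y) (Y y) e) : R^o) x =
    'D_d (fun y => phi c y (tri (Z x) (Y x) e) : R^o) x
    + phi c x (tri ('D_d Z x) (Y x) e) + phi c x (tri (Z x) ('D_d Y x) e).
  have cd : derivable (fun=> e) x d by exact: derivable_cst.
  have [_ ->] := derive_trilinear (@ccod_open _ _ _ (at_ c)) (@phi_trilinear c)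
    (fun v => phi_smooth c v 1) nO (@derivable_id _ _ x d) (dZ d) (dY d) cd.
  rewrite derive_id derive_cst -[RHS]addr0; congr (_ + _).
  exact: (phi_tri0 (Z x) (Y x) cx).
rewrite (DD a b) (DD b a).
have H := closed_quad (Z x) (Y x) a b cx.
have LZ := lie_derivative_phi w1 (Y x) a b cx; rewrite -/Z in LZ.
have LY := lie_derivative_phi w2 (Z x) a b cx; rewrite -/Y in LY.
have C := induced_fields_commute actP w1 w2 cx; rewrite -/Z -/Y in C.
rewrite C in LY.
exact: (closed_algebra (T := fun u v w => phi c x (tri u v w))
  (fun u v w => phi_swap01 u v w cx) (fun u v w => phi_swap12 u v w cx) H LZ LY).
Qed.

End G2Manifold.

(** * Primitives and their invariance *)

Section Primitive.
Context {R : realType} (M : smooth_manifold R 7) (phi : coord_form M 3).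
Context (phi_G2 : G2_form phi).
Context (r : nat) (act : 'rV[R]_r -> M -> M) (actP : torus_action act).
Context (act_phi : forall t, preserves (act t) phi).
Local Notation E := 'rV[R]_7.
Local Notation T := 'rV[R]_r.
Local Notation at_ := (@atlas R 7 M).
Local Notation X := (induced_field act).

Lemma smooth_sigma_form w1 w2 : smooth_form (sigma_form phi act w1 w2).
Proof.
split.
- move=> c x cx v i a u u'; rewrite !sigma_formE !(ord1 i) /replace eqxx.
  have [B fB] := G2_is_frame phi_G2 cx.
  by rewrite !(frame_tri _ _ _ fB) mulmxDl -scalemxAl phi0_lin3.
- by move=> c x _ v i j; rewrite !ord1 eqxx.
- move=> c v k; have oc := @ccod_open _ _ _ (at_ c).
  have CC := Ck_on_ring_class k oc.
  pose Z := X w1 c; pose Y := X w2 c; pose b := v ord0.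
  have H : Ck_on k (ccod (at_ c)) (fun x => \sum_i \sum_j \sum_l Z x ord0 i *
      (Y x ord0 j * (b ord0 l * phi c x (tri (delta_mx ord0 i) (delta_mx ord0 j) (delta_mx ord0 l)))) : R^o).
    do 3!apply: (rc_sum CC) => ?.
    apply: (rc_mul CC); first exact: ((Ck_on_mx k _ oc).1 (smooth_induced_field actP w1 c k)).
    apply: (rc_mul CC); first exact: ((Ck_on_mx k _ oc).1 (smooth_induced_field actP w2 c k)).
    apply: (rc_mul CC); first exact: (rc_cst CC).
    exact: (phi_smooth phi_G2).
  apply: (Ck_on_ext oc _ H) => x cx.
  by rewrite sigma_formE (phi_trilinear phi_G2 cx).
move=> c c' m cm c'm v; rewrite !sigma_formE.
have [[_ _ _ G] _] := phi_G2.
rewrite (G c c' m cm c'm); congr (phi c' _ _).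
apply: etrans (tri_comp (fun a => 'D_a (trans c c') (at_ c m)) _ _ _) _.
rewrite -(induced_field_glue actP w1 cm c'm) -(induced_field_glue actP w2 cm c'm).
by [].
Qed.

(** With b = 0 the combination of cohomology generators is an empty sum, so the closed form itself
    is a differential. *)
Lemma exists_primitive (eta : coord_form M 1) : first_betti_number M 0 ->
  smooth_form eta -> closed_form eta -> exists f, smooth_fun f /\ is_differential eta f.
Proof.
move=> [w [_ H]] se ce; have [a [[f sf df] _]] := H eta se ce.
exists f; split=> // c x cx v; rewrite -(df c x cx v) big_ord0 subr0 //.
Qed.

Lemma near_orbit c t (m : M) : cdom (at_ c) (act t m) ->
  \forall s \near t, cdom (at_ c) (act s m).
Proof.
move=> cm.
have H1 : nbhs (act t m) (cdom (at_ c)).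
  exact: (open_nbhs_nbhs (conj (@cdom_open _ _ _ (at_ c)) cm)).
have h1 : id @ nbhs t --> t by exact: cvg_id.
have h2 : (fun=> m) @ nbhs t --> m by exact: cvg_cst.
have H2 := @act_continuous _ _ _ _ _ actP (t, m) _ H1.
exact: (cvg_pair h1 h2 H2).
Qed.

Context (f : M -> R) (sf : smooth_fun f) (w1 w2 : T).
Hypothesis df : is_differential (sigma_form phi act w1 w2) f.

Lemma derive_primitive_orbit c t (m : M) w : cdom (at_ c) (act t m) ->
  derivable (fun s => f (act s m) : R^o) t w /\
  'D_w (fun s => f (act s m) : R^o) t =
  phi c (at_ c (act t m)) (tri (X w1 c (at_ c (act t m))) (X w2 c (at_ c (act t m)))
    (X w c (at_ c (act t m)))).
Proof.
move=> cm; pose g : E -> R^o := f \o cinv (at_ c).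
have D1 := @derivable_orbit_pt _ _ _ _ _ actP c t m w cm.
have E1 := @derive_orbit_field _ _ _ _ _ actP c t m w cm.
have Ox : ccod (at_ c) (at_ c (act t m)) by exact: cfun_cod.
have [d e] := C1_chain1 (g := g) (@ccod_open _ _ _ (at_ c)) (sf c 1%N) Ox D1.
have nE : \forall s \near t, (g \o (fun s => at_ c (act s m))) s = f (act s m).
  by apply: filterS (near_orbit cm) => s cs; rewrite /g /= (cfunK cs).
split; first exact: near_eq_derivable nE d.
rewrite -(near_eq_derive w nE) e E1.
have H := df Ox (fun=> X w c (at_ c (act t m))); rewrite sigma_formE in H.
exact: esym H.
Qed.

(** The action preserves phi and, by [induced_field_push], the fields. *)
Lemma phi_orbit_const c c' t (m : M) u1 u2 u3 : cdom (at_ c) m -> cdom (at_ c') (act t m) ->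
  phi c' (at_ c' (act t m)) (tri (X u1 c' (at_ c' (act t m))) (X u2 c' (at_ c' (act t m)))
    (X u3 c' (at_ c' (act t m)))) =
  phi c (at_ c m) (tri (X u1 c (at_ c m)) (X u2 c (at_ c m)) (X u3 c (at_ c m))).
Proof.
move=> cm c'm; apply: etrans (esym (act_phi cm c'm _)); congr (phi c' _ _).
apply: etrans (esym (tri_comp (fun a => 'D_a (tmap act t c c') (at_ c m)) _ _ _)).
rewrite -(induced_field_push actP u1 cm c'm) -(induced_field_push actP u2 cm c'm).
by rewrite -(induced_field_push actP u3 cm c'm).
Qed.

Section Invariance.
Context (m : M) (c : idx M) (cm : cdom (at_ c) m).
Let F (t : T) : R^o := f (act t m).
Let l w := phi c (at_ c m) (tri (X w1 c (at_ c m)) (X w2 c (at_ c m)) (X w c (at_ c m))).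

Let derive_F t w : derivable F t w /\ 'D_w F t = l w.
Proof.
have [c' c'm] := atlas_cover (act t m).
have [d e] := derive_primitive_orbit w c'm; split; first exact: d.
by rewrite e (phi_orbit_const _ _ _ cm c'm).
Qed.

Let F_add t w : F (w + t) - F t = l w.
Proof.
have dF (s : R) : 0 <= s <= 1 -> derivable F (s *: w + t) w by move=> _; have [] := derive_F (s *: w + t) w.
have [s _ ->] := MVT_dir dF.
by have [] := derive_F (s *: w + t) w.
Qed.

(** A unit vector is a lattice point, so the function returns to its value there and its constant
    slope along the axis is 0. *)
Let l_axis (s : R) i : l (s *: delta_mx ord0 i) = 0.
Proof.
have li : l (delta_mx ord0 i) = 0.
  rewrite -(F_add 0); apply/eqP; rewrite subr_eq0; apply/eqP.
  have -> : delta_mx ord0 i = map_mx intr (delta_mx ord0 i : 'rV[int]_r) :> T.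
    by apply/rowP => j; rewrite !mxE; case: (_ && _).
  by rewrite /F (actD actP) (act_lattice actP).
have [d e] := derive_F 0 (delta_mx ord0 i).
have [_ e'] := derivable_scale s d.
have [_ <-] := derive_F 0 (s *: delta_mx ord0 i).
by rewrite e' e li scaler0.
Qed.

(** [t] is reached from 0 along one coordinate axis at a time. *)
Lemma primitive_invariant t : f (act t m) = f m.
Proof.
rewrite -[in RHS](act0 actP m) -/(F t) -/(F 0) [t](row_sum_delta t).
elim/big_rec: _ => // i s _ <-.
by have /eqP := F_add s (t ord0 i *: delta_mx ord0 i); rewrite l_axis subr_eq0 => /eqP.
Qed.

Lemma phi_fields_eq0 w : l w = 0.
Proof. by rewrite -(F_add 0) /F !primitive_invariant subrr. Qed.

End Invariance.

End Primitive.

(** * Level sets *)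

Section Complement.
Context {F : fieldType}.

Lemma row_free_complement k m n (A : 'M[F]_(m, n)) : row_free A -> (k + m = n)%N ->
  exists C : 'M[F]_(k, n), row_free (col_mx C A).
Proof.
move=> Af kmn.
have rk : \rank (A^C)%MS = k by rewrite mxrank_compl (eqP Af) -kmn addnK.
exists (castmx (rk, erefl n) (row_base (A^C)%MS)).
rewrite /row_free -addsmxE.
have -> : \rank (castmx (rk, erefl n) (row_base (A^C)%MS) + A)%MS = \rank (A^C + A)%MS.
  have e : (castmx (rk, erefl n) (row_base (A^C)%MS) :=: A^C)%MS.
    case: _ / rk; rewrite castmx_id; exact: eq_row_base.
  by have [-> _] := adds_eqmx e (eqmx_refl A).
by rewrite addsmxC; have := addsmx_compl_full A; rewrite /row_full kmn.
Qed.

End Complement.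

Lemma big_ord3 (V : nmodType) (h : 'I_3 -> V) :
  \sum_i h i = h (inord 0) + h (inord 1) + h (inord 2).
Proof.
rewrite !big_ord_recl big_ord0 addr0 addrA.
by do !congr (_ + _); congr h; apply/val_inj; rewrite /= inordK.
Qed.

(** * Linear algebra at a regular point *)

Section CoassociativeAlgebra.
Context {R : realType}.
Local Notation E := 'rV[R]_7.
Implicit Types (f : ('I_3 -> E) -> R) (B : 'M[R]_7) (X : 'I_3 -> E).

(* The paper's sigma_1, sigma_2, sigma_3 at a point, for fields with the values X i there. *)
Definition sig3 f X (k : 'I_3) (v : E) : R :=
  nth 0 [:: f (tri (X (inord 2)) (X (inord 1)) v); f (tri (X (inord 0)) (X (inord 2)) v);
            f (tri (X (inord 1)) (X (inord 0)) v)] k.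

Section FrameForm.
Context f B (fB : is_frame f B).

Lemma frame_lin1 a (u u' v w : E) :
  f (tri (a *: u + u') v w) = a * f (tri u v w) + f (tri u' v w).
Proof. by rewrite !(frame_tri _ _ _ fB) mulmxDl -scalemxAl phi0_lin1. Qed.

Lemma frame_lin2 a (u v v' w : E) :
  f (tri u (a *: v + v') w) = a * f (tri u v w) + f (tri u v' w).
Proof. by rewrite !(frame_tri _ _ _ fB) mulmxDl -scalemxAl phi0_lin2. Qed.

Lemma frame_alt (u v : E) : f (tri u u v) = 0.
Proof. by rewrite (frame_tri _ _ _ fB) phi0_alt. Qed.

Lemma frame_swap01 (u v w : E) : f (tri v u w) = - f (tri u v w).
Proof. by rewrite !(frame_tri _ _ _ fB) phi0_swap01. Qed.

Lemma frame_scale1 a (u v w : E) : f (tri (a *: u) v w) = a * f (tri u v w).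
Proof.
have f0 : f (tri 0 v w) = 0.
  have := frame_lin1 (-1) 0 0 v w; rewrite scaler0 addr0 => ->.
  by rewrite mulN1r addNr.
by rewrite -[a *: u]addr0 frame_lin1 f0 addr0.
Qed.

Lemma frame_scale2 a (u v w : E) : f (tri u (a *: v) w) = a * f (tri u v w).
Proof. by rewrite frame_swap01 frame_scale1 frame_swap01 mulrN opprK. Qed.

End FrameForm.

(** Bivectors of a 3-space are decomposable: [a] times the given combination is f(Y, Z, .). By
    [frame_dependent], Y and Z are then proportional, against the independence of x, y, z. *)
Let sig_coef0 f B (x y z : E) (a b c : R) : is_frame f B ->
  (forall a b c : R, a *: x + b *: y + c *: z = 0 -> [/\ a = 0, b = 0 & c = 0]) ->
  (forall v, a * f (tri z y v) + b * f (tri x z v) + c * f (tri y x v) = 0) -> a = 0.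
Proof.
move=> fB ind H; apply/eqP; apply: contraT => a0.
pose Y := a *: z - c *: x; pose Z := a *: y - b *: x.
have Y0 : Y != 0.
  apply: contra_neq a0 => Y0; have [|_ _ ->] // := ind (- c) 0 a.
  by rewrite scale0r addr0 scaleNr addrC.
have YZ w : f (tri Y Z w) = 0.
  transitivity (a * 0); last by rewrite mulr0.
  rewrite -(H w) /Y /Z -!scaleNr (frame_lin1 fB) !(frame_lin2 fB) !(frame_scale1 fB).
  rewrite !(frame_scale2 fB) (frame_alt fB) (frame_swap01 fB x z) (frame_swap01 fB x y).
  move: (f _) (f _) (f _) => p q r; ring.
have [k Zk] := frame_dependent fB Y0 YZ.
have [|_ aE _] := ind (k * c - b) a (- (k * a)).
  transitivity (Z - k *: Y); last by rewrite Zk subrr.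
  by apply/rowP => i; rewrite !mxE; ring.
by rewrite aE eqxx in a0.
Qed.

Lemma sig3_independent f B X (a : 'I_3 -> R) : is_frame f B ->
  (forall b : 'rV[R]_3, \sum_i b ord0 i *: X i = 0 -> b = 0) ->
  (forall v, \sum_k a k * sig3 f X k v = 0) -> forall k, a k = 0.
Proof.
move=> fB ind H.
have ind' (b : 'rV[R]_3) : b ord0 (inord 0) *: X (inord 0) + b ord0 (inord 1) *: X (inord 1)
    + b ord0 (inord 2) *: X (inord 2) = 0 -> b = 0.
  by rewrite -(big_ord3 (fun i => b ord0 i *: X i)); exact: ind.
have ind3 p q r : p *: X (inord 0) + q *: X (inord 1) + r *: X (inord 2) = 0 ->
    [/\ p = 0, q = 0 & r = 0].
  move=> E1; have b0 : \row_(i < 3) nth 0 [:: p; q; r] i = 0.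
    by apply: ind'; rewrite !mxE !inordK.
  have bE i : (\row_(i < 3) nth 0 [:: p; q; r] i) ord0 i = 0 by rewrite b0 mxE.
  have := (bE (inord 0), bE (inord 1), bE (inord 2)).
  by rewrite !mxE !inordK //= => -[[-> ->] ->].
have H' v : a (inord 0) * f (tri (X (inord 2)) (X (inord 1)) v)
   + a (inord 1) * f (tri (X (inord 0)) (X (inord 2)) v)
   + a (inord 2) * f (tri (X (inord 1)) (X (inord 0)) v) = 0.
  by rewrite -(H v) big_ord3 /sig3 !inordK.
have a0 := sig_coef0 fB ind3 H'.
(* The hypotheses are invariant under cyclic rotation of the three fields, which yields the other
   two coefficients. *)
have a1 : a (inord 1) = 0.
  apply: (sig_coef0 fB (x := X (inord 1)) (y := X (inord 2)) (z := X (inord 0))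
    (b := a (inord 2)) (c := a (inord 0))) => [p q r|v].
    by rewrite addrC addrA => /ind3[-> -> ->].
  by rewrite -(H' v) addrC addrA.
have a2 : a (inord 2) = 0.
  apply: (sig_coef0 fB (x := X (inord 2)) (y := X (inord 0)) (z := X (inord 1))
    (b := a (inord 0)) (c := a (inord 1))) => [p q r|v].
    by rewrite -addrA addrC => /ind3[-> -> ->].
  by rewrite -(H' v) -addrA addrC.
by case=> -[|[|[|//]]] Hk; [rewrite -[RHS]a0|rewrite -[RHS]a1|rewrite -[RHS]a2];
  congr a; apply/val_inj; rewrite /= inordK.
Qed.

(* Complete the rows of x to a basis of the 4-space by one vector. *)
Lemma phi0_vanish (p : 'I_4 -> E) (x : 'M[R]_(3, 4)) : row_free x ->
  (forall i j d, phi0 (tri (\sum_l x i l *: p l) (\sum_l x j l *: p l) (p d)) = 0) ->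
  forall a b c, phi0 (tri (p a) (p b) (p c)) = 0.
Proof.
move=> xf H; have [y Nf] := @row_free_complement _ 1 3 4 x xf erefl.
pose N : 'M[R]_4 := col_mx y x.
have Nu : N \in unitmx by rewrite -row_free_unit.
pose n (r : 'I_4) := \sum_d N r d *: p d.
have pE a : p a = \sum_r (invmx N) a r *: n r.
  have -> : \sum_r (invmx N) a r *: n r = \sum_d (\sum_r (invmx N) a r * N r d) *: p d.
    under eq_bigr do rewrite scaler_sumr.
    rewrite exchange_big; apply: eq_bigr => d _ /=; rewrite scaler_suml.
    by apply: eq_bigr => r _; rewrite scalerA.
  transitivity (\sum_d (1%:M : 'M[R]_4) a d *: p d).
    rewrite (bigD1 a) //= !mxE eqxx scale1r big1 ?addr0 // => d da.
    by rewrite !mxE eq_sym (negbTE da) scale0r.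
  by apply: eq_bigr => d _; rewrite -(mulVmx Nu) mxE.
have nx (i : 'I_3) : n (rshift 1 i) = \sum_l x i l *: p l.
  apply: eq_bigr => d _; congr (_ *: _); exact: (col_mxEd y x i d).
have Hn i j r : phi0 (tri (n (rshift 1 i)) (n (rshift 1 j)) (n r)) = 0.
  by rewrite phi0_sum3 big1 // => d _; rewrite !nx H mulr0.
have alt02 u v : phi0 (tri u v u) = 0 :> R by rewrite phi0_swap12 phi0_alt oppr0.
have alt12 u v : phi0 (tri v u u) = 0 :> R by rewrite phi0_swap01 alt02 oppr0.
(* Either two arguments are the added vector, and alternation applies, or two come from rows of [x],
   and [Hn] applies after swaps. *)
have vanish (r q s : 'I_(1 + 3)) : phi0 (tri (n r) (n q) (n s)) = 0.
  have ord1E (k : 'I_1) : lshift 3 k = lshift 3 ord0 by rewrite (ord1 k).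
  case: (splitP r) => [r' rE|r' rE]; case: (splitP q) => [q' qE|q' qE];
    case: (splitP s) => [s' sE|s' sE].
  all: try (have {rE} -> : r = lshift 3 ord0 by apply/val_inj; rewrite /= rE (ord1 r')).
  all: try (have {qE} -> : q = lshift 3 ord0 by apply/val_inj; rewrite /= qE (ord1 q')).
  all: try (have {sE} -> : s = lshift 3 ord0 by apply/val_inj; rewrite /= sE (ord1 s')).
  all: try (have {rE} -> : r = rshift 1 r' by apply/val_inj).
  all: try (have {qE} -> : q = rshift 1 q' by apply/val_inj).
  all: try (have {sE} -> : s = rshift 1 s' by apply/val_inj).
  - exact: phi0_alt.
  - exact: phi0_alt.
  - exact: alt02.
  - by rewrite phi0_swap01 phi0_swap12 Hn !oppr0.
  - exact: alt12.
  - by rewrite phi0_swap12 Hn oppr0.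
  - exact: Hn.
  - exact: Hn.
move=> a b c; rewrite [p a]pE phi0_sum1 big1 // => r _.
rewrite [p b]pE phi0_sum2 big1 ?mulr0 // => q _.
rewrite [p c]pE phi0_sum3 big1 ?mulr0 // => s _.
by rewrite vanish mulr0.
Qed.

(** When the rows of [N] are the differentials of coordinates, these are the first four vectors of
    the dual basis: the coordinate vectors tangent to the slice. *)
Definition slice_basis (N : 'M[R]_7) (j : 'I_4) : E := row (lshift 3 j : 'I_(4 + 3)) (invmx N^T).

Lemma slice_basis_free N : N \in unitmx -> row_free (\matrix_j slice_basis N j).
Proof.
move=> Nu; apply: inj_row_free => v H.
have E1 : row_mx v (0 : 'rV_3) *m invmx N^T = 0.
  rewrite -[RHS]H; apply/rowP => k; rewrite !mxE (@big_split_ord _ _ _ 4 3) /=.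
  rewrite [X in _ + X]big1 ?addr0 => [|i _]; last by rewrite row_mxEr mxE mul0r.
  by apply: eq_bigr => i _; rewrite row_mxEl !mxE.
have : row_mx v (0 : 'rV_3) = 0.
  have NtU : N^T \in unitmx by rewrite unitmx_tr.
  by rewrite -[LHS]mulmx1 -(mulVmx NtU) mulmxA E1 mul0mx.
by rewrite -row_mx0 => /eq_row_mx[].
Qed.

Section Basis.
Context f B X (A : 'M[R]_(3, 7)) (C : 'M[R]_(4, 7)).
Hypothesis fB : is_frame f B.
Hypothesis AE : forall v k, (v *m A^T) ord0 k = sig3 f X k v.
Hypothesis AX : forall i k, sig3 f X k (X i) = 0.
Let N : 'M[R]_7 := col_mx C A.
Hypothesis Nu : N \in unitmx.
Let s := slice_basis N.
Let t (k : 'I_3) : E := row (rshift 4 k : 'I_(4 + 3)) (invmx N^T).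

Let NtE v : v *m N^T = row_mx (v *m C^T) (v *m A^T) :> 'rV_(4 + 3).
Proof. by have -> : N^T = row_mx C^T A^T := tr_col_mx C A; exact: mul_mx_row. Qed.

Let NtR v (k : 'I_3) : (v *m N^T) ord0 (rshift 4 k : 'I_(4 + 3)) = sig3 f X k v.
Proof. by rewrite NtE -AE; exact: row_mxEr. Qed.

Let NtU : N^T \in unitmx. Proof. by rewrite unitmx_tr. Qed.

Let sN j k : (row j (invmx N^T) *m N^T) ord0 k = (j == k)%:R.
Proof. by rewrite -row_mul mulVmx // mxE mxE. Qed.

Lemma sig3_slice_basis k j : sig3 f X k (s j) = 0.
Proof.
have := sN (lshift 3 j) (rshift 4 k); rewrite NtR => ->.
by rewrite (eq_lrshift j k : (lshift 3 j == rshift 4 k :> 'I_7) = false).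
Qed.

Let sig3_t k l : sig3 f X k (t l) = (l == k)%:R.
Proof.
have := sN (rshift 4 l) (rshift 4 k); rewrite NtR => ->.
by rewrite (@eq_rshift 4 3 l k : (rshift 4 l == rshift 4 k :> 'I_7) = (l == k)).
Qed.

Let x : 'M[R]_(3, 4) := \matrix_(i, l) (X i *m C^T) ord0 l.

(** [sig3] kills the fields, so the last three coordinates of X i in the dual basis vanish. *)
Let XE i : X i = \sum_l x i l *: s l.
Proof.
have A0 : X i *m A^T = 0 by apply/rowP => k; rewrite AE AX mxE.
have -> : X i = row_mx (X i *m C^T) (0 : 'rV_3) *m (invmx N^T : 'M[R]_((4 + 3)%N, 7)).
  by rewrite -[LHS]mulmx1 -(mulmxV NtU) mulmxA NtE A0.
apply/rowP => d; rewrite mxE (@big_split_ord _ _ _ 4 3) /=.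
rewrite [X in _ + X]big1 ?addr0 => [|k _]; last by rewrite row_mxEr mxE mul0r.
rewrite summxE; apply: eq_bigr => l _.
by rewrite row_mxEl [RHS]mxE [x _ _]mxE [s _ _ _]mxE.
Qed.

(** The dual vectors [t] isolate coefficients: contracting a relation among the fields with some X j
    and t l leaves one sigma on its dual vector. *)
Let X_free : row_free x.
Proof.
apply: inj_row_free => a ax.
have aX : \sum_i a ord0 i *: X i = 0.
  under eq_bigr do rewrite XE scaler_sumr.
  rewrite exchange_big big1 // => l _ /=.
  under eq_bigr do rewrite scalerA.
  rewrite -scaler_suml; have /rowP/(_ l) := ax; rewrite mxE => ->.
  by rewrite mxE scale0r.
rewrite big_ord3 in aX.
have lin j v : a ord0 (inord 0) * f (tri (X (inord 0)) (X j) v)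
    + a ord0 (inord 1) * f (tri (X (inord 1)) (X j) v)
    + a ord0 (inord 2) * f (tri (X (inord 2)) (X j) v) = 0.
  transitivity (f (tri (a ord0 (inord 0) *: X (inord 0) + a ord0 (inord 1) *: X (inord 1)
    + a ord0 (inord 2) *: X (inord 2)) (X j) v)).
    by rewrite -[in RHS]addrA !(frame_lin1 fB) (frame_scale1 fB) addrA.
  by rewrite aX -[X in tri X _ _](scale0r (X j)) (frame_scale1 fB) mul0r.
have alt := frame_alt fB; have sw := frame_swap01 fB.
have S0 l : f (tri (X (inord 2)) (X (inord 1)) (t l)) = (l == inord 0)%:R.
  by rewrite -sig3_t /sig3 inordK.
have S1 l : f (tri (X (inord 0)) (X (inord 2)) (t l)) = (l == inord 1)%:R.
  by rewrite -sig3_t /sig3 inordK.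
have S2 l : f (tri (X (inord 1)) (X (inord 0)) (t l)) = (l == inord 2)%:R.
  by rewrite -sig3_t /sig3 inordK.
have o (p q : nat) : (p < 3)%N -> (q < 3)%N -> p != q -> (inord p == inord q :> 'I_3) = false.
  by move=> p3 q3 pq; rewrite -val_eqE /= !inordK // (negbTE pq).
have a0 : a ord0 (inord 0) = 0.
  have := lin (inord 1) (t (inord 2)); rewrite alt S0 (sw (X (inord 1))) S2.
  by rewrite eqxx !o // !mulr0 !addr0 mulrN1 => /eqP; rewrite oppr_eq0 => /eqP.
have a2 : a ord0 (inord 2) = 0.
  have := lin (inord 1) (t (inord 0)); rewrite alt S0 (sw (X (inord 1))) S2.
  by rewrite eqxx !o // mulr1 mulr0n oppr0 !mulr0 !add0r.
have a1 : a ord0 (inord 1) = 0.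
  have := lin (inord 0) (t (inord 2)); rewrite alt S2 (sw (X (inord 0))) S1.
  by rewrite eqxx !o // mulr1 mulr0n oppr0 !mulr0 add0r addr0.
apply/rowP => i; rewrite mxE.
by case: i => -[|[|[|//]]] Hk; [rewrite -[RHS]a0|rewrite -[RHS]a1|rewrite -[RHS]a2];
  congr (a _ _); apply/val_inj; rewrite /= inordK.
Qed.

(** On two fields and a slice vector, [f] is 0 or a sigma up to sign, hence 0; [phi0_vanish] extends
    this to the whole slice. *)
Lemma slice_basis_vanish i j k : f (tri (s i) (s j) (s k)) = 0.
Proof.
rewrite (frame_tri _ _ _ fB).
apply: (phi0_vanish (p := fun l => s l *m B) X_free) => p q d.
have XB l : \sum_d x l d *: (s d *m B) = X l *m B.
  by rewrite XE mulmx_suml; apply: eq_bigr => ? _; rewrite scalemxAl.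
rewrite !XB -(frame_tri _ _ _ fB).
have S0 := sig3_slice_basis (inord 0) d; have S1 := sig3_slice_basis (inord 1) d.
have S2 := sig3_slice_basis (inord 2) d; rewrite /sig3 !inordK //= in S0 S1 S2.
have alt := frame_alt fB; have sw := frame_swap01 fB.
have c3 (l : 'I_3) : [\/ l = inord 0, l = inord 1 | l = inord 2].
  case: l => -[|[|[|//]]] Hl; [constructor 1|constructor 2|constructor 3];
  by apply/val_inj; rewrite /= inordK.
case: (c3 p) => ->; case: (c3 q) => ->; rewrite ?alt ?S0 ?S1 ?S2 //;
  by rewrite sw ?S0 ?S1 ?S2 oppr0.
Qed.

Lemma star_slice_basis :
  star f s ^+ 2 = \det (\matrix_(i, j) gdot f (s i) (s j)) /\ star f s != 0.
Proof.
have sf := slice_basis_free Nu.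
have E1 := star_sqr fB sf slice_basis_vanish; split=> //.
suff : \det (\matrix_(i, j) gdot f (s i) (s j)) != 0.
  by rewrite -E1 expf_eq0.
have -> : \matrix_(i, j) gdot f (s i) (s j) =
    ((\matrix_i s i) *m B) *m ((\matrix_i s i) *m B)^T.
  have sE i k : ((\matrix_i s i) *m B) i k = (s i *m B) ord0 k.
    by rewrite [LHS]mxE [RHS]mxE; apply: eq_bigr => l _; rewrite [in LHS]mxE.
  apply/matrixP => i j; rewrite [LHS]mxE [RHS]mxE (frame_gdot _ _ fB) /dot.
  by apply: eq_bigr => k _; rewrite -(sE i) -(sE j); congr (_ * _); rewrite [RHS]mxE.
apply: gram_det_neq0; have [Bu _] := fB.
by rewrite /row_free mxrankMfree // row_free_unit.
Qed.

End Basis.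

Lemma star_oppl f B (v : 'I_4 -> E) : is_frame f B ->
  star f (fun j => if j == ord0 then - v j else v j) = - star f v.
Proof.
move=> fB; rewrite -!(frame_star _ fB).
have hq (g : 'I_4 -> E) : hodge (k := 3) (l := 4) (@phi0 R) g =
    psi4 (g (inord 0)) (g (inord 1)) (g (inord 2)) (g (inord 3)).
  by rewrite [g in LHS]quadE hodge_phi0.
have o (p : nat) : (p < 4)%N -> (inord p == ord0 :> 'I_4) = (p == 0)%N.
  by move=> p4; rewrite -val_eqE /= inordK.
rewrite !hq !o //= mulNmx.
have idB : is_frame (@phi0 R) 1%:M.
  by split=> [|w]; rewrite ?unitmx1 //; congr phi0; apply/funext => i; rewrite mulmx1.
rewrite !psi4E -scaleN1r !dotZl opprB opprD -sumrN; congr (_ + _); last by ring.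
by apply: eq_bigr => k _; rewrite (frame_scale1 idB) mulN1r mulNr.
Qed.

(* If the sign is wrong, negate the first row of C. *)
Lemma positive_complement f B (A : 'M[R]_(3, 7)) : is_frame f B -> row_free A ->
  (forall C : 'M[R]_(4, 7), col_mx C A \in unitmx ->
     star f (slice_basis (col_mx C A)) != 0) ->
  exists2 C : 'M[R]_(4, 7), col_mx C A \in unitmx &
    0 < star f (slice_basis (col_mx C A)).
Proof.
move=> fB Af sn0; have [C Nf] := @row_free_complement _ 4 3 7 A Af erefl.
pose N : 'M[R]_7 := col_mx C A.
have Nu : N \in unitmx by rewrite -row_free_unit.
have [sp|] := ltrP 0 (star f (slice_basis N)); first by exists C.
rewrite le_eqVlt (negbTE (sn0 _ Nu)) /= => sneg.
(* An involution, so the inverse transpose of [N1] is that of [N] with its first row negated, and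
   only the first slice vector changes sign. *)
pose d : 'rV[R]_7 := \row_j (if j == ord0 then -1 else 1).
pose N1 : 'M[R]_(4 + 3, 7) := diag_mx d *m N.
have dd : diag_mx d *m diag_mx d = 1%:M.
  apply/matrixP => i j; rewrite mul_diag_mx !mxE.
  by case: (i == j); case: (i == ord0); rewrite ?mulr0n ?mulr0 ?mulr1n ?mulr1 // mulrNN mulr1.
have N1u : N1 \in unitmx by rewrite unitmx_mul Nu andbT; have [] := mulmx1_unit dd.
have N1E : col_mx (usubmx N1) A = N1.
  rewrite -[RHS]vsubmxK; congr col_mx; apply/matrixP => i j.
  rewrite [RHS]mxE /N1 mul_diag_mx mxE [d _ _]mxE mul1r.
  exact/esym/(col_mxEd C A i j).
have invE : invmx N1^T = diag_mx d *m invmx N^T.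
  have N1t : N1^T \in unitmx by rewrite unitmx_tr.
  rewrite -[RHS](mulKmx N1t) -[LHS]mulmx1; congr (_ *m _).
  have K : (N^T *m diag_mx d) *m (diag_mx d *m invmx N^T) = 1%:M.
    by rewrite mulmxA -(mulmxA N^T) dd mulmx1 mulmxV // unitmx_tr.
  have N1T : N1^T = N^T *m diag_mx d by rewrite -[X in _ *m X]tr_diag_mx -trmx_mul.
  by rewrite -K N1T.
have sE : slice_basis N1 = (fun j => if j == ord0 then - slice_basis N j else slice_basis N j).
  apply/funext => j; rewrite /slice_basis invE; apply/rowP => k.
  rewrite mxE mul_diag_mx mxE [d _ _]mxE.
  have -> : (lshift 3 j == ord0 :> 'I_7) = (j == ord0) by [].
  by case: (j == ord0); rewrite ?mulN1r ?mul1r !mxE.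
exists (usubmx N1); rewrite N1E //.
by rewrite sE (star_oppl _ fB) oppr_gt0.
Qed.

End CoassociativeAlgebra.

(** * Charts obtained by a change of coordinates *)

Section Subchart.
Context {R : realType} {n : nat} (M : smooth_manifold R n).
Local Notation E := 'rV[R]_n.
Local Notation at_ := (@atlas R n M).

Lemma compose_chart (c : idx M) (O B : set E) (F G : E -> E) :
  open O -> open B -> O `<=` ccod (at_ c) -> smooth_on O F -> smooth_on B G ->
  (forall x, O x -> B (F x)) -> (forall y, B y -> O (G y)) ->
  (forall x, O x -> G (F x) = x) -> (forall y, B y -> F (G y) = y) ->
  exists h : chart R n M,
    [/\ cdom h = [set m | cdom (at_ c) m /\ O (at_ c m)], ccod h = B,
        (h : M -> E) = F \o at_ c & cinv h = cinv (at_ c) \o G] /\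
    forall c', compatible (at_ c') h.
Proof.
move=> oO oB Oc sF sG OB BO GF FG.
have h_open : open [set m | cdom (at_ c) m /\ O (at_ c m)] by exact: open_chart_dom.
have h_cod m : cdom (at_ c) m /\ O (at_ c m) -> B ((F \o at_ c) m) by case=> _ /OB.
have h_dom y : B y -> [set m | cdom (at_ c) m /\ O (at_ c m)] ((cinv (at_ c) \o G) y).
  move=> By; have Gc := Oc _ (BO _ By).
  by split; [exact: cinv_dom|rewrite /= cinvK //; exact: BO].
have h_K m : cdom (at_ c) m /\ O (at_ c m) -> (cinv (at_ c) \o G) ((F \o at_ c) m) = m.
  by move=> [cm Om]; rewrite /= GF // cfunK.
have h_VK y : B y -> (F \o at_ c) ((cinv (at_ c) \o G) y) = y.
  by move=> By; rewrite /= cinvK ?FG //; exact: Oc _ (BO _ By).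
have h_cont m : cdom (at_ c) m /\ O (at_ c m) -> {for m, continuous (F \o at_ c)}.
  move=> [cm Om]; apply: continuous_comp; first exact: cfun_continuous.
  exact: (Ck_on_continuous (sF 0) Om).
have h_Vcont y : B y -> {for y, continuous (cinv (at_ c) \o G)}.
  move=> By; apply: continuous_comp; first exact: (Ck_on_continuous (sG 0) By).
  by apply: cinv_continuous; exact: Oc _ (BO _ By).
pose h := Chart h_open oB h_cod h_dom h_K h_VK h_cont h_Vcont.
exists h; split=> // c'; split=> k.
- have oU : open [set x | ccod (at_ c') x /\ cdom h (cinv (at_ c') x)].
    exact: open_chart_cod h_open.
  apply: (@Ck_on_comp _ _ _ _ k _ O (trans c' c) F oU oO) => [x [_ []]//| |]; last exact: sF.
  by apply: Ck_on_sub (smooth_trans c' c k) => x [xc []].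
- have oU : open [set x | ccod h x /\ cdom (at_ c') (cinv h x)].
    exact: open_chart_cod (@cdom_open _ _ _ (at_ c')).
  apply: (@Ck_on_comp _ _ _ _ k _ (overlap c c') G (trans c c') oU (@open_overlap _ _ _ c c')).
  + by move=> x [/BO/Oc Gx cx].
  + by apply: Ck_on_sub (sG k) => x [].
  + exact: smooth_trans.
Qed.

Lemma jac_trans_unit (c c' : idx M) x : overlap c c' x -> jac (trans c c') x \in unitmx.
Proof.
move=> ox; have C1 := smooth_trans c c' 1%N; have oo := @open_overlap _ _ M c c'.
rewrite -row_free_unit; apply: inj_row_free => v v0.
rewrite -(trans_derive_inv v ox) (C1_derive_jac v oo C1 ox) v0.
exact: derive0.
Qed.

Lemma derive_right_inverse (O B : set E) (F G : E -> E) y v : open O -> open B ->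
  Ck_on 1 O F -> Ck_on 1 B G -> (forall y, B y -> O (G y)) -> (forall y, B y -> F (G y) = y) ->
  B y -> jac F (G y) \in unitmx -> 'D_v G y = v *m invmx (jac F (G y)).
Proof.
move=> oO oB F1 G1 BO FG By Ju.
have GD : derivable G y v by have [_ /(_ v)[+ _]] := G1; apply.
have [_ E1] := C1_chain oO F1 (BO _ By) GD.
have E2 : 'D_v (F \o G) y = v.
  transitivity ('D_v (id : E -> E) y); last exact: derive_id.
  apply: near_eq_derive.
  exact: near_open oB By FG.
have E3 : v = 'D_v G y *m jac F (G y).
  exact: etrans (esym E2) (etrans E1 (C1_derive_jac _ oO F1 (BO _ By))).
by rewrite -[LHS](mulmxK Ju) -E3.
Qed.

End Subchart.

Section InducedLinear.
Context {R : realType} {n r : nat} (M : smooth_manifold R n).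
Context (act : 'rV[R]_r -> M -> M) (actP : torus_action act).
Local Notation E := 'rV[R]_n.
Local Notation T := 'rV[R]_r.
Local Notation at_ := (@atlas R n M).
Local Notation X := (induced_field act).

(** The derivative at 0 of the C^1 orbit map is linear in its direction. *)
Lemma induced_field_linear c x : ccod (at_ c) x ->
  exists J : 'M[R]_(r, n), forall w, X w c x = w *m J.
Proof.
move=> cx; exists (\matrix_(i, j) X (delta_mx ord0 i) c x ord0 j) => w.
pose A (t : T) : T * E := (t, x).
have Aa (h : R) (v t : T) : A (h *: v + t) = h *: ((v, 0) : T * E) + A t.
  by rewrite /A; apply/pair_equal_spec; split; rewrite //= scaler0 add0r.
have Ac : continuous A.
  move=> t; have h1 : (fun=> x) @ nbhs t --> x by exact: cvg_cst.
  have h2 : id @ nbhs t --> t by exact: cvg_id.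
  exact: (cvg_pair h2 h1).
pose O := A @^-1` adom act c c.
have oO : open O by apply: open_comp => [t _|]; [exact: Ac|exact: (@open_adom _ _ _ _ _ actP c c)].
have C1 : Ck_on 1 O (amap act c c \o A).
  exact: (@Ck_on_comp_affine R T _ _ 1 _ A (fun v => (v, 0)) _ Ac Aa (smooth_amap actP c c 1)).
have O0 : O 0 := adom0 actP cx.
apply/rowP => j; rewrite mxE.
have CC := (Ck_on_mx 1 _ oO).1 C1 j.
have XE v : X v c x ord0 j = 'D_v (fun t => (amap act c c \o A) t ord0 j : R^o) 0.
  have D0 : derivable (amap act c c \o A) 0 v by have [_ /(_ v)[+ _]] := C1; apply.
  have H := is_derive_coord j D0; rewrite derive_val.
  by [].
rewrite XE (C1_derive_sum _ oO CC O0); apply: eq_bigr => i _.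
by rewrite -XE mxE.
Qed.

Lemma regular_fields_free c x (xi : 'M[R]_r) : row_free xi -> ccod (at_ c) x ->
  regular_point act (cinv (at_ c) x) ->
  forall b : 'rV[R]_r, \sum_i b ord0 i *: X (row i xi) c x = 0 -> b = 0.
Proof.
move=> xif cx reg b Hb; have [J JE] := induced_field_linear cx.
have E1 : X (b *m xi) c x = 0.
  rewrite -[RHS]Hb JE -mulmxA mulmx_sum_row; apply: eq_bigr => i _.
  by rewrite JE row_mul.
have bx : b *m xi = 0.
  by apply: (reg c _); [exact: cinv_dom|rewrite cinvK].
by apply: (row_free_inj xif); rewrite bx mul0mx.
Qed.

End InducedLinear.

(** * Level sets near regular points *)

Section LevelSets.
Context {R : realType} (M : smooth_manifold R 7) (phi : coord_form M 3).
Context (phi_G2 : G2_form phi).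
Context (act : 'rV[R]_3 -> M -> M) (actP : torus_action act).
Context (act_phi : forall t, preserves (act t) phi).
Context (xi : 'M[R]_3) (xi_free : row_free xi).
Local Notation E := 'rV[R]_7.
Local Notation at_ := (@atlas R 7 M).
Local Notation w i := (row (inord i) xi).

Definition fields (c : idx M) (x : E) (i : 'I_3) : E := induced_field act (row i xi) c x.

Definition sigk (k : 'I_3) : coord_form M 1 :=
  nth (sigma_form phi act 0 0) [:: sigma_form phi act (w 2) (w 1); sigma_form phi act (w 0) (w 2); sigma_form phi act (w 1) (w 0)] k.

Lemma frame_trans (c c' : idx M) x B : overlap c c' x -> is_frame (phi c' (trans c c' x)) B ->
  is_frame (phi c x) (jac (trans c c') x *m B).
Proof.
move=> ox [Bu BE]; split; first by rewrite unitmx_mul Bu jac_trans_unit.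
move=> v; have [cx c'x] := ox; have [[_ _ _ glue] _] := phi_G2.
have := glue c c' (cinv (at_ c) x) (cinv_dom cx) c'x v; rewrite cinvK // => ->.
transitivity (phi c' (trans c c' x) (fun i => v i *m jac (trans c c') x)).
  congr (phi _ _); apply/funext => i.
  exact: (C1_derive_jac _ (@open_overlap _ _ _ c c') (smooth_trans c c' 1) ox).
by rewrite BE; congr phi0; apply/funext => i; rewrite mulmxA.
Qed.

Lemma trans_cod (c c' : idx M) x : overlap c c' x -> ccod (at_ c') (trans c c' x).
Proof. by case=> _; exact: cfun_cod. Qed.

(** The frames selected in the two charts are unrelated. The one of c', preceded by the Jacobian, is
    a frame in [c], and by [frame_star] every frame gives the same value. *)
Lemma star_trans (c c' : idx M) x (v : 'I_4 -> E) : overlap c c' x ->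
  G2_star phi c' (trans c c' x) (fun j => v j *m jac (trans c c') x) = star (phi c x) v.
Proof.
move=> ox; have fB := frame_trans ox (G2_frameP phi_G2 (trans_cod ox)).
rewrite -(frame_star _ fB) /G2_star; congr hodge.
by apply/funext => j; rewrite mulmxA.
Qed.

Lemma metric_trans (c c' : idx M) x (u v : E) : overlap c c' x ->
  G2_metric phi c' (trans c c' x) (u *m jac (trans c c') x) (v *m jac (trans c c') x) =
  gdot (phi c x) u v.
Proof.
move=> ox; have fB := frame_trans ox (G2_frameP phi_G2 (trans_cod ox)).
by rewrite (frame_gdot _ _ fB) !mulmxA.
Qed.

Lemma sigkE k c x v : sigk k c x v = sig3 (phi c x) (fields c x) k (v ord0).
Proof. by case: k => -[|[|[|//]]] k3; rewrite /sigk /sig3 /= sigma_formE. Qed.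

Context (f : 'I_3 -> M -> R) (sf : forall k, smooth_fun (f k)).
Hypothesis df : forall k, is_differential (sigk k) (f k).
Context (c : idx M).
Let U := ccod (at_ c).
Let oU : open U := @ccod_open _ _ _ (at_ c).

Definition fhat (k : 'I_3) : E -> R^o := f k \o cinv (at_ c).
Definition dfhat x : 'M[R]_(3, 7) := \matrix_(k, j) 'D_(delta_mx ord0 j) (fhat k) x.

Lemma smooth_fhat k l : Ck_on l U (fhat k).
Proof. exact: sf. Qed.

Lemma derive_fhat k x v : U x -> 'D_v (fhat k) x = sig3 (phi c x) (fields c x) k v.
Proof. by move=> Ux; rewrite -(sigkE k c x (fun=> v)) (df k Ux). Qed.

Lemma dfhatE x v k : U x -> (v *m (dfhat x)^T) ord0 k = sig3 (phi c x) (fields c x) k v.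
Proof.
move=> Ux; rewrite -(derive_fhat k v Ux) (C1_derive_sum _ oU (smooth_fhat k 1) Ux) mxE.
by apply: eq_bigr => j _; rewrite !mxE.
Qed.

Lemma sig3_fields x i k : U x -> sig3 (phi c x) (fields c x) k (fields c x i) = 0.
Proof.
move=> Ux; have cx := cinv_dom Ux.
have D (w1 w2 : 'rV[R]_3) : is_differential (sigma_form phi act w1 w2) (f k) ->
    phi c x (tri (induced_field act w1 c x) (induced_field act w2 c x) (fields c x i)) = 0.
  move=> d12; have := phi_fields_eq0 actP act_phi (sf k) d12 cx (row i xi).
  by rewrite cinvK.
have := df k; case: k D => -[|[|[|//]]] k3 D dk; exact: D dk.
Qed.

Lemma dfhat_row_free x : U x -> regular_point act (cinv (at_ c) x) -> row_free (dfhat x).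
Proof.
move=> Ux reg; apply: inj_row_free => a a0.
have [B fB] := G2_is_frame phi_G2 Ux.
have ind := regular_fields_free actP xi_free Ux reg.
apply/rowP => k; rewrite [RHS]mxE.
apply: (sig3_independent fB ind (a := fun k => a ord0 k)) => v.
transitivity ((v *m (a *m dfhat x)^T) ord0 ord0); last by rewrite a0 trmx0 mulmx0 mxE.
rewrite trmx_mul mulmxA mxE; apply: eq_bigr => l _.
by rewrite -(dfhatE _ _ Ux) [in RHS]mulrC; congr (_ * _); rewrite mxE.
Qed.

Context (lv : 'I_3 -> R).

Section SliceMap.
Context (C : 'M[R]_(4, 7)).

Definition slice_map (x : E) : E :=
  row_mx (x *m C^T) (\row_k (fhat k x - lv k)) : 'rV_(4 + 3).

Lemma slice_map_l x (j : 'I_4) : slice_map x ord0 (lshift 3 j) = (x *m C^T) ord0 j.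
Proof. exact: row_mxEl. Qed.

Lemma slice_map_r x (k : 'I_3) : slice_map x ord0 (rshift 4 k) = fhat k x - lv k.
Proof. by rewrite [LHS]row_mxEr mxE. Qed.

Lemma derive_linear_coord (j : 'I_4) (x v : E) :
  'D_v (fun x => (x *m C^T) ord0 j : R^o) x = (v *m C^T) ord0 j.
Proof.
pose A (y : E) : R^o := (y *m C^T) ord0 j.
have AL (h : R) : A (h *: v + x) = h *: A v + A x.
  by rewrite /A mulmxDl -scalemxAl !mxE.
rewrite -[LHS]/('D_v (id \o A) x) (@derive_comp_affine _ _ _ _ id A A x v AL).
exact: derive_id.
Qed.

Lemma smooth_linear_coord l (j : 'I_4) : Ck_on l U (fun x => (x *m C^T) ord0 j : R^o).
Proof.
have CC := Ck_on_ring_class l oU.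
have Cid : Ck_on l U (id : E -> E).
  have cid x : {for x, continuous (id : E -> E)} by exact: cvg_id.
  case: l {CC} => [|l]; (split; first by move=> x _; exact: cid) => //.
  move=> v; split=> [x _|]; first exact: derivable_id.
  apply: (@Ck_on_ext _ _ E l U (fun=> v) _ oU); last exact: Ck_on_cst.
  by move=> x _; rewrite derive_id.
apply: (@Ck_on_ext _ _ R^o l U (fun x : E => \sum_i x ord0 i * C^T i j) _ oU).
  by move=> x _; rewrite [RHS]mxE.
apply: (rc_sum CC) => i; apply: (rc_mul CC); last exact: Ck_on_cst.
exact: (Ck_on_mx l id oU).1 Cid i.
Qed.

Lemma smooth_slice_map : smooth_on U slice_map.
Proof.
move=> l; have CC := Ck_on_ring_class l oU.
apply/(Ck_on_mx l slice_map oU) => i.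
case: (splitP (i : 'I_(4 + 3))) => [j ij|k ik].
  have -> : i = lshift 3 j by exact/val_inj.
  apply: (@Ck_on_ext _ _ R^o l U (fun x : E => (x *m C^T) ord0 j) _ oU).
    by move=> x _; rewrite slice_map_l.
  exact: smooth_linear_coord.
have -> : i = rshift 4 k by exact/val_inj.
apply: (@Ck_on_ext _ _ R^o l U (fun x : E => fhat k x - lv k) _ oU).
  by move=> x _; rewrite slice_map_r.
apply: (rc_sub CC); [exact: smooth_fhat|exact: Ck_on_cst].
Qed.

(** Jacobians act on row vectors from the right, so the transpose has the differentials of the
    coordinates as rows, the shape [slice_basis] expects. *)
Lemma jac_slice_map x : U x -> (jac slice_map x)^T = (col_mx C (dfhat x) : 'M[R]_7).
Proof.
move=> Ux; apply/matrixP => i j; rewrite [LHS]mxE [LHS]mxE.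
have D : derivable slice_map x (delta_mx ord0 j).
  by have [_ /(_ (delta_mx ord0 j))[+ _]] := smooth_slice_map 1; apply.
have H := is_derive_coord (i : 'I_7) D; rewrite -(@derive_val _ _ _ _ _ _ _ H).
case: (splitP (i : 'I_(4 + 3))) => [k ik|k ik].
  have {ik} -> : i = lshift 3 k by exact/val_inj.
  apply: etrans _ (esym (col_mxEu C (dfhat x) k j)); rewrite (_ : (fun y => _) = fun x => (x *m C^T) ord0 k : R^o).
    by rewrite derive_linear_coord -rowE !mxE.
  by apply/funext => y; exact: slice_map_l.
have {ik} -> : i = rshift 4 k by exact/val_inj.
apply: etrans _ (esym (col_mxEd C (dfhat x) k j)); rewrite (_ : (fun y => _) = fhat k - (fun=> lv k : R^o)).
  rewrite deriveB; first by rewrite derive_cst subr0 mxE.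
    by have [_ /(_ (delta_mx ord0 j))[+ _]] := smooth_fhat k 1; apply.
  exact: derivable_cst.
by apply/funext => y; exact: slice_map_r.
Qed.

Let basis x := slice_basis (jac slice_map x)^T.

Lemma near_star_basis x0 : U x0 -> jac slice_map x0 \in unitmx ->
  0 < star (phi c x0) (basis x0) ->
  exists2 r : R, 0 < r & forall x, `|x - x0| < r ->
    [/\ U x, jac slice_map x \in unitmx & 0 < star (phi c x) (basis x)].
Proof.
move=> Ux0 Ju0 s0; have [B fB] := G2_is_frame phi_G2 Ux0.
have CC := @continuous_at_ring_class R E x0.
pose J := jac slice_map.
have Jc i j : cont_at x0 (fun x => J x i j).
  exact: (Ck_on_continuous (smooth_jac 0 oU smooth_slice_map i j) Ux0).
(* [invmx] is defined by cases; this formula agrees with it where the Jacobian is invertible, and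
   its continuity at [x0] is direct. *)
pose V x (j : 'I_4) : E := row (lshift 3 j : 'I_(4 + 3)) ((\det (J x))^-1 *: \adj (J x)).
have VE x : J x \in unitmx -> V x = basis x.
  by move=> Ju; apply/funext => j; rewrite /basis /slice_basis trmxK /invmx Ju.
have Vc i j : cont_at x0 (fun x => V x i ord0 j).
  rewrite (_ : (fun x => _) = fun x => (\det (J x))^-1 * (\adj (J x)) (lshift 3 i : 'I_(4 + 3)) j).
    apply: (rc_mul CC); last exact: (rc_adj CC).
    by apply: continuousV; [rewrite -unitfE; exact: Ju0|exact: (rc_det CC)].
  by apply/funext => x; rewrite !mxE.
have sc := continuous_star (F := phi c) (fun v => Ck_on_continuous (phi_smooth phi_G2 c v 0) Ux0) fB Vc.
have pos : nbhs x0 (fun x => 0 < star (phi c x) (V x)).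
  by apply: cvgr_gt sc _ _; rewrite VE.
have [r1 r1_gt0 H1] := open_norm_ex (open_jac_unit oU smooth_slice_map) (conj Ux0 Ju0).
have [r2 r2_gt0 H2] := nbhs_norm_ex pos.
exists (Num.min r1 r2); first by rewrite lt_min r1_gt0.
move=> x; rewrite lt_min => /andP[/H1[Ux Ju] /H2]; rewrite VE //.
Qed.

End SliceMap.

Lemma coassociative_near_level (S : set M) m :
  (forall p, S p <-> forall k, f k p = lv k) -> cdom (at_ c) m -> regular_point act m ->
  coassociative_near phi S m.
Proof.
move=> SE cm reg; pose x0 := at_ c m.
have Ux0 : U x0 := cfun_cod cm.
have reg0 : regular_point act (cinv (at_ c) x0) by rewrite cfunK.
have star_basis (C : 'M[R]_(4, 7)) x : U x -> (col_mx C (dfhat x) : 'M[R]_7) \in unitmx ->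
    star (phi c x) (slice_basis (col_mx C (dfhat x))) ^+ 2 =
    \det (\matrix_(i, j) gdot (phi c x) (slice_basis (col_mx C (dfhat x)) i)
      (slice_basis (col_mx C (dfhat x)) j)) /\
    star (phi c x) (slice_basis (col_mx C (dfhat x))) != 0.
  move=> Ux Nu; have [B fB] := G2_is_frame phi_G2 Ux.
  exact: (star_slice_basis fB (fun v k => dfhatE v k Ux) (fun i k => sig3_fields i k Ux) Nu).
have [B fB] := G2_is_frame phi_G2 Ux0.
have [C Nu pos0] := positive_complement fB (dfhat_row_free Ux0 reg0)
  (fun C Nu => (star_basis C x0 Ux0 Nu).2).
pose F := slice_map C.
have JE x : U x -> (jac F x)^T = (col_mx C (dfhat x) : 'M[R]_7) := @jac_slice_map C x.
have Ju0 : jac F x0 \in unitmx by rewrite -unitmx_tr (JE _ Ux0).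
have [r r0 Hr] : exists2 r : R, 0 < r & forall x, `|x - x0| < r ->
    [/\ U x, jac F x \in unitmx & 0 < star (phi c x) (slice_basis (jac F x)^T)].
  by apply: near_star_basis => //; rewrite (JE _ Ux0).
pose V := [set x : E | `|x - x0| < r]; have oV : open V := @open_norm_ball _ _ x0 r.
have VU : V `<=` U by move=> x /Hr[].
have sF : smooth_on V F := smooth_on_sub VU (smooth_slice_map C).
have V0 : V x0 by rewrite /V /= subrr normr0.
have inj v : 'D_v F x0 = 0 -> v = 0.
  rewrite (C1_derive_jac v oU (smooth_slice_map C 1) Ux0) => E1.
  by rewrite -[v](mulmxK Ju0) E1 mul0mx.
have [Q [G [rho [oO O0 OV rho0 [OB BO GF FG sG]]]]] := inverse_function oV sF V0 inj.
have oB := @open_norm_ball _ _ (F x0) rho.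
have sFO : smooth_on Q F := smooth_on_sub OV sF.
have [h [[hdom hcod hfun hinv] hcomp]] :=
  compose_chart oO oB (subset_trans OV VU) sFO sG OB BO GF FG.
(* The neighbourhood is the domain of the new chart, so this one chart serves at all points of the
   level set in it. *)
exists (cdom h); split; [exact: cdom_open|by rewrite hdom|].
move=> p [Sp hp]; exists h; split=> //.
  split=> // y hy; have By := hy; rewrite hcod in By.
  have yk k : y ord0 (rshift 4 k : 'I_(4 + 3)) = f k (cinv h y) - lv k.
    by rewrite -{1}(FG y By) hinv; exact: slice_map_r.
  split=> [[/SE Sy _] i i4|y0].
    case: (splitP (i : 'I_(4 + 3))) => [j ij|k ik].
      by move: i4; rewrite ij leqNgt ltn_ord.
    have -> : i = rshift 4 k by exact/val_inj.
    by rewrite yk Sy subrr.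
  split; last exact: cinv_dom.
  by apply/SE => k; apply/eqP; rewrite -subr_eq0 -yk y0 // leq_addr.
move=> y c' hy _; have By := hy; rewrite hcod in By.
have Gy := BO _ By; have [UG Ju pos] := Hr _ (OV _ Gy).
rewrite {1 2}hinv => c'y; cbv zeta.
have oy : overlap c c' (G y) by [].
(* The j-th coordinate vector of [h] is row j of the inverse Jacobian, carried to c' by the
   transition map. *)
have sv (j : 'I_4) : slice_vector h c' y j =
    slice_basis (jac F (G y))^T j *m jac (trans c c') (G y).
  rewrite /slice_vector hinv.
  set e := delta_mx _ _.
  have GD : derivable G y e by have [_ /(_ e)[+ _]] := sG 1; apply.
  have [_ E1] := C1_chain (@open_overlap _ _ _ c c') (smooth_trans c c' 1) oy GD.
  apply: (etrans E1).
  rewrite (C1_derive_jac _ (@open_overlap _ _ _ c c') (smooth_trans c c' 1) oy).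
  rewrite (derive_right_inverse e oO oB (sFO 1) (sG 1) BO FG By Ju).
  rewrite /slice_basis trmxK rowE; congr (delta_mx _ _ *m _ *m _).
  by apply/val_inj; rewrite /= inordK // (ltn_trans (ltn_ord j)).
have xE : at_ c' ((cinv (at_ c) \o G) y) = trans c c' (G y) by [].
rewrite xE (_ : (fun j : 'I_4 => _) =
    fun j => slice_basis (jac F (G y))^T j *m jac (trans c c') (G y)); last first.
  by apply/funext => j; exact: sv.
rewrite (star_trans _ oy) (_ : \matrix_(i < 4, j < 4) _ = \matrix_(i, j)
    gdot (phi c (G y)) (slice_basis (jac F (G y))^T i) (slice_basis (jac F (G y))^T j)); last first.
  by apply/matrixP => i j; rewrite [LHS]mxE [RHS]mxE !sv (metric_trans _ _ oy).
have NuG : (jac F (G y))^T \in unitmx by rewrite unitmx_tr.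
move: pos NuG; rewrite (JE _ UG) => pos NuG.
(* Positivity makes the star the square root of its square, which is the Gram determinant. *)
rewrite -[LHS](ger0_norm (ltW pos)) -sqrtr_sqr; congr Num.sqrt.
exact: (star_basis C (G y) UG NuG).1.
Qed.

End LevelSets.

Theorem mainTheorem4 (R : realType) (M : smooth_manifold R 7)
    (phi : coord_form M 3)
    (phi_G2 : G2_form phi)
    (phi_closed : closed_form phi)
    (phi_coclosed : closed_form (G2_star phi))
    (b1_eq0 : first_betti_number M 0)
    (act : 'rV[R]_3 -> M -> M)
    (act_torus : torus_action act)
    (act_effective : effective act)
    (act_phi : forall t, preserves (act t) phi)
    (xi : 'M[R]_3)
    (xi_basis : row_free xi) :
  let X1 := induced_field act (row (inord 0) xi) in
  let X2 := induced_field act (row (inord 1) xi) in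
  let X3 := induced_field act (row (inord 2) xi) in
  let sigma1 := interior_product X2 (interior_product X3 phi) in
  let sigma2 := interior_product X3 (interior_product X1 phi) in
  let sigma3 := interior_product X1 (interior_product X2 phi) in
  exists f1 f2 f3 : M -> R,
    [/\ [/\ smooth_fun f1, smooth_fun f2 & smooth_fun f3],
        [/\ is_differential sigma1 f1, is_differential sigma2 f2 &
            is_differential sigma3 f3],
        forall t m, [/\ f1 (act t m) = f1 m, f2 (act t m) = f2 m &
                        f3 (act t m) = f3 m],
        forall c m, level_set f1 f2 f3 c m -> regular_point act m ->
          coassociative_near phi (level_set f1 f2 f3 c) m &
        \bigcup_c level_set f1 f2 f3 c = setT /\
        trivIset setT (level_set f1 f2 f3)].
Proof.
cbv zeta.
have primitive (w1 w2 : 'rV[R]_3) : exists f, smooth_fun f /\ is_differential (sigma_form phi act w1 w2) f.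
  apply: (exists_primitive b1_eq0); first exact: smooth_sigma_form.
  exact: closed_sigma_form.
(* [sigma_form] contracts with its first argument first, whence the order within each pair. *)
have [f1 [s1 d1]] := primitive (row (inord 2) xi) (row (inord 1) xi).
have [f2 [s2 d2]] := primitive (row (inord 0) xi) (row (inord 2) xi).
have [f3 [s3 d3]] := primitive (row (inord 1) xi) (row (inord 0) xi).
exists f1, f2, f3; split=> //.
- by move=> t m; have [c cm] := atlas_cover m; split;
    [exact: (primitive_invariant act_torus act_phi s1 d1 cm)
    |exact: (primitive_invariant act_torus act_phi s2 d2 cm)
    |exact: (primitive_invariant act_torus act_phi s3 d3 cm)].
- move=> a m am reg; have [c cm] := atlas_cover m.
  pose f (k : 'I_3) : M -> R := nth f1 [:: f1; f2; f3] k.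
  pose lv (k : 'I_3) : R := nth 0 [:: a.1.1; a.1.2; a.2] k.
  apply: (@coassociative_near_level R M phi phi_G2 act act_torus act_phi xi xi_basis f
    _ _ c lv) => // [k|k|p].
  + by case: k => -[|[|[|//]]] k3.
  + by case: k => -[|[|[|//]]] k3.
  + split=> [[p1 p2 p3] [[|[|[|//]]] k3]//|H].
    have := (H (inord 0), H (inord 1), H (inord 2)).
    by rewrite /f /lv !inordK //= => -[[]].
- split; last by move=> [[a1 a2] a3] [[b1 b2] b3] _ _ [m [[/= <- <- <-] [/= <- <- <-]]].
  by apply/seteqP; split=> // m _; exists (f1 m, f2 m, f3 m).
Qed.
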